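(* Let $p_1,\dots,p_n\in\mathbb{R}^3$ ($n\ge3$) be landmarks, at least three of which are non-collinear, and let $k_1,\dots,k_n>0$. Consider the inertial navigation system $\dot R=R\omega^\times$, $\dot p=v$, $\dot v=\mathsf{g}+Ra$ with landmark measurements $y_i=R^\top(p_i-p)$, together with the variable-gain hybrid observer $\mathcal{H}^o_2$ defined in the context. Choose the set $\mathbb{Q}$ (with parameters $\theta\in(0,\pi]$ and $\mathbb{U}$) as defined in the context and the constant $\delta>0$ defining $\mathcal{F}_o,\mathcal{J}_o$ such that $\delta<(1-\cos\theta)\Delta_M^*$. Let $k_R>0$, and let $Q(t)\in\mathbb{R}^{3\times3}$ and $V(t)\in\mathbb{R}^{6\times6}$ be uniformly positive definite. Then the number of discrete jumps is finite, and the set $$\mathcal{A}_2=\{(\hat X,\tilde R,\mathsf{x},t)\in\mathcal{S}^c_2:\ \tilde R=I_3,\ \mathsf{x}=0_{6\times1}\},\qquad \mathcal{S}^c_2=SE_2(3)\times SO(3)\times\mathbb{R}^6\times\mathbb{R}^+,$$ is uniformly globally exponentially stable for the resulting hybrid closed-loop system with state $x^c_2=(\hat X,\tilde R,\mathsf{x},t)$.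
   Context: Notation. $SO(3)$ is the group of $3\times3$ rotation matrices. For $x\in\mathbb{R}^3$, $x^\times$ is the skew-symmetric matrix with $x^\times y=x\times y$. For $A\in\mathbb{R}^{3\times3}$, $\mathbb{P}_a(A)=(A-A^\top)/2$. For $R\in SO(3)$, $|R|_I^2=\frac14\mathrm{tr}(I_3-R)$. $\mathbb{S}^2$ is the set of unit vectors of $\mathbb{R}^3$ and $\mathcal{R}_a(\theta,u)=I_3+\sin\theta\,u^\times+(1-\cos\theta)(u^\times)^2$ for $u\in\mathbb{S}^2$. $\mathcal{T}(R,v,p)=\begin{bmatrix}R&v&p\\0_{1\times3}&1&0\\0_{1\times3}&0&1\end{bmatrix}$ and $SE_2(3)=\{\mathcal{T}(R,v,p): R\in SO(3),\,v,p\in\mathbb{R}^3\}$. $\mathrm{Ad}_XU=XUX^{-1}$. $\mathbb{R}^+$ is the set of nonnegative reals. System and measurements. $X=\mathcal{T}(R,v,p)$ satisfies $\dot X=f(X,\omega,a):=\begin{bmatrix}R\omega^\times&\mathsf{g}+Ra&v\\0_{1\times 3}&0&0\\0_{1\times 3}&0&0\end{bmatrix}$, with $\mathsf{g}\in\mathbb{R}^3$ constant and $\omega,a$ known continuous functions of time. Put $r_i=[p_i^\top\ 0\ 1]^\top$, $b_i=[y_i^\top\ 0\ 1]^\top=X^{-1}r_i$, $r=[r_1\cdots r_n]$, $b=[b_1\cdots b_n]$. Let $k_c=\sum_ik_i$, $p_c=\frac1{k_c}\sum_ik_ip_i$, $M=\sum_ik_i(p_i-p_c)(p_i-p_c)^\top$,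 $X_c=\mathcal{T}(I_3,0_{3\times 1},p_c)$, $K_n=\mathrm{diag}(k_1,\dots,k_n)$. Errors. With the estimate $\hat X=\mathcal{T}(\hat R,\hat v,\hat p)$: $\tilde R=R\hat R^\top$, $\tilde v=v-\tilde R\hat v$, $\tilde p=p-\tilde R\hat p$, $\tilde p_e=\tilde p-(I_3-\tilde R)p_c$, $\mathsf{x}=[(R^\top\tilde p_e)^\top,(R^\top\tilde v)^\top]^\top\in\mathbb{R}^6$. Flow/jump sets and jump map. $\Upsilon(\hat X,r,b)=\frac12\sum_ik_i\|(r_i-r_c)-\hat X(b_i-b_c)\|^2$ with $r_c=\frac1{k_c}\sum_ik_ir_i$, $b_c=\frac1{k_c}\sum_ik_ib_i$ (so $\Upsilon(\hat X,r,b)=\mathrm{tr}((I_3-\tilde R)M)$). $\mu_{\mathbb{Q}}(\hat X,r,b)=\Upsilon(\hat X,r,b)-\min_{X_q\in\mathbb{Q}}\Upsilon(X_q^{-1}\hat X,r,b)$. $\mathcal{F}_o=\{\hat X\in SE_2(3):\mu_{\mathbb{Q}}(\hat X,r,b)\le\delta\}$, $\mathcal{J}_o=\{\hat X\in SE_2(3):\mu_{\mathbb{Q}}(\hat X,r,b)\ge\delta\}$. $\gamma(\hat X)$ is the set of minimizers of $X_q\mapsto\Upsilon(X_q^{-1}\hat X,r,b)$ over $\mathbb{Q}$. Set $\mathbb{Q}$. $\mathbb{Q}=\{\mathcal{T}(R,v,p)\in SE_2(3):R=\mathcal{R}_a(\theta,u),\,u\in\mathbb{U},\,p=(I_3-R)p_c,\,v=0_{3\times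 1}\}$ with constant $\theta\in(0,\pi]$ and $\mathbb{U}\subset\mathbb{S}^2$ a finite set chosen in one of two ways: (1) $\mathbb{U}$ contains an orthonormal eigenbasis $\mathbb{E}(M)$ of $M$, when the eigenvalues satisfy $\lambda_1^M\ge\lambda_2^M\ge\lambda_3^M>0$ or $\lambda_1^M>\lambda_2^M>\lambda_3^M=0$; (2) $\mathbb{U}$ contains three orthogonal unit vectors of $\mathbb{R}^3$, when $\mathrm{tr}(M)-2\lambda^M_{\max}>0$ ($\lambda_{\max}^M$ the largest eigenvalue). With $\mathcal{E}(M)$ the set of unit eigenvectors of $M$, $\Delta_M^*=\min_{v\in\mathcal{E}(M)}\max_{u\in\mathbb{U}}u^\top(\mathrm{tr}(M_v)I_3-M_v)u$, where $M_v=M(I_3-2vv^\top)$. Observer $\mathcal{H}^o_2$. Flow: $\dot{\hat X}=f(\hat X,\omega,a)-\Delta\hat X$ when $\hat X\in\mathcal{F}_o$. Jump: $\hat X^+=X_q^{-1}\hat X$, $X_q\in\gamma(\hat X)$, when $\hat X\in\mathcal{J}_o$. Here $\hat X(0)\in SE_2(3)$, $\Delta=-\mathrm{Ad}_{X_c}\big(\mathbb{P}_{\mathcal{K}}(X_c^{-1}(r-\hat Xb)K_nr^\top X_c^{-\top})\big)$ and $\mathbb{P}_{\mathcal{K}}\left(\begin{bmatrix}A_1&a_2&a_3\\ a_4^\top&a_6&a_7\\ a_5^\top&a_8&a_9\end{bmatrix}\right)=\begin{bmatrix}k_R\mathbb{P}_a(A_1)&K_va_2&K_pa_3\\0_{1\times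 3}&0&0\\0_{1\times 3}&0&0\end{bmatrix}$. To match the paper's closed loop, in $\Delta$ the second column is built from the same vector as the third, i.e. explicitly, with $\tilde y_i=p_i-\hat p-\hat Ry_i$, $\Delta_R=\sum_ik_i\tilde y_i(p_i-p_c)^\top$, $\Delta_p=\sum_ik_i\tilde y_i$: $$\Delta=-\begin{bmatrix}k_R\mathbb{P}_a(\Delta_R)&K_v\Delta_p&K_p\Delta_p-k_R\mathbb{P}_a(\Delta_R)p_c\\0_{1\times 3}&0&0\\0_{1\times 3}&0&0\end{bmatrix}.$$ The gains are $K_p=\frac1{k_c}\hat RL_1\hat R^\top$, $K_v=\frac1{k_c}\hat RL_2\hat R^\top$, where $[L_1^\top,L_2^\top]^\top=L=PC^\top Q(t)$ ($L_1,L_2\in\mathbb{R}^{3\times3}$), and $P$ solves the continuous Riccati equation $\dot P=A(t)P+PA(t)^\top-PC^\top Q(t)CP+V(t)$ with $P(0)$ symmetric positive definite, $A(t)=\begin{bmatrix}-\omega(t)^\times&I_3\\0_{3\times 3}&-\omega(t)^\times\end{bmatrix}$, $C=[I_3\ 0_{3\times3}]$. Standing assumption for the Riccati equation: $A(t)$ is continuous and bounded on $t\ge0$. A matrix function is uniformly positive definite if it is symmetric and $\ge cI$ for some constant $c>0$ and all $t\ge0$. Closed-loop system. Its state is $x^c_2=(\hat X,\tilde R,\mathsf{x},t)$, with $\tilde R,\mathsf{x}$ the errors above between the true trajectory and the observer; $\dot t=1$ in flows; at jumps $\tilde R^+=\tilde RR_q$ (with $X_q=\mathcal{T}(R_q,v_q,p_q)$),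 $\mathsf{x}^+=\mathsf{x}$, $t^+=t$. It flows when $\hat X\in\mathcal{F}_o$ and jumps when $\hat X\in\mathcal{J}_o$; $\omega,a,A,P$ are treated as functions of $t$. Solutions and stability. Solutions are hybrid arcs on hybrid time domains $\mathrm{dom}\,x\subset\mathbb{R}^+\times\mathbb{N}$ (Goebel–Sanfelice–Teel framework). $\mathcal{A}_2$ is uniformly globally exponentially stable if there are $\kappa,\lambda>0$ such that for every initial condition each solution satisfies $|x(t,j)|_{\mathcal{A}_2}\le\kappa e^{-\lambda(t+j)}|x(0,0)|_{\mathcal{A}_2}$ for all $(t,j)\in\mathrm{dom}\,x$, where $|x^c_2|^2_{\mathcal{A}_2}=|\tilde R|_I^2+\|\mathsf{x}\|^2$.
   Formalization: Q(t) and V(t) are assumed bounded on t≥0 in addition to being uniformly positive definite; without upper bounds the uniform exponential stability fails, e.g. ω=0, Q=I, V=diag(I,(1+t)I). *)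

(* Defs.v *)
From HB Require Import structures.
From mathcomp Require Import all_boot all_order all_algebra.
From mathcomp Require Import all_classical all_reals all_analysis.
Import Order.TTheory GRing.Theory Num.Theory.
Import numFieldNormedType.Exports.

Set Implicit Arguments.
Unset Strict Implicit.
Unset Printing Implicit Defensive.

Local Open Scope classical_set_scope.
Local Open Scope ring_scope.

Section Euclidean.
Context {R : realType}.

Definition dot m (u v : 'cV[R]_m) : R := (u^T *m v) 0 0.

(* The Euclidean norm; [`|u|] on matrices is the sup norm. *)
Definition enorm m (u : 'cV[R]_m) : R := Num.sqrt (dot u u).

Definition quadform m (A : 'M[R]_m) (u : 'cV[R]_m) : R := dot u (A *m u).

Definition sphere2 : set 'cV[R]_3 := [set u | enorm u = 1].

Definition crossmx (x : 'cV[R]_3) : 'M[R]_3 :=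
  \matrix_(i < 3, j < 3)
    (nth [::] [:: [:: 0; - x 2%R 0; x 1%R 0];
                  [:: x 2%R 0; 0; - x 0%R 0];
                  [:: - x 1%R 0; x 0%R 0; 0]] i)`_j.

Definition antisym (A : 'M[R]_3) : 'M[R]_3 := 2^-1 *: (A - A^T).

Definition SO3 : set 'M[R]_3 := [set A | A^T *m A = 1%:M /\ \det A = 1].

Definition attnorm2 (A : 'M[R]_3) : R := 4^-1 * \tr (1%:M - A).

Definition Ra (theta : R) (u : 'cV[R]_3) : 'M[R]_3 :=
  1%:M + sin theta *: crossmx u + (1 - cos theta) *: (crossmx u *m crossmx u).

Definition TT (A : 'M[R]_3) (v p : 'cV[R]_3) : 'M[R]_5 :=
  (block_mx (block_mx A v 0 1%:M) (col_mx p 0) 0 1%:M : 'M[R]_(3 + 1 + 1)).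

Definition rotmx (X : 'M[R]_5) : 'M[R]_3 :=
  ulsubmx (ulsubmx (X : 'M[R]_(3 + 1 + 1))).
Definition velmx (X : 'M[R]_5) : 'cV[R]_3 :=
  ursubmx (ulsubmx (X : 'M[R]_(3 + 1 + 1))).
Definition posmx (X : 'M[R]_5) : 'cV[R]_3 :=
  usubmx (ursubmx (X : 'M[R]_(3 + 1 + 1))).

Definition SE23 : set 'M[R]_5 :=
  [set X | exists A v p, SO3 A /\ X = TT A v p].

(* The 5 x 5 matrix whose first three rows are [A v p], the others being 0. *)
Definition tangent (A : 'M[R]_3) (v p : 'cV[R]_3) : 'M[R]_5 :=
  (block_mx (block_mx A v 0 0) (col_mx p 0) 0 0 : 'M[R]_(3 + 1 + 1)).

Definition homog (x : 'cV[R]_3) : 'cV[R]_5 :=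
  (col_mx (col_mx x 0) 1%:M : 'cV[R]_(3 + 1 + 1)).

(* The three points lie on a common line (a degenerate direction [d = 0] only
   makes the three points equal). *)
Definition collinear (x y z : 'cV[R]_3) : Prop :=
  exists o d : 'cV[R]_3,
    forall q, q \in [:: x; y; z] -> exists s : R, q = o + s *: d.

Definition orthonormal3 (e1 e2 e3 : 'cV[R]_3) : Prop :=
  [/\ dot e1 e1 = 1, dot e2 e2 = 1 & dot e3 e3 = 1] /\
  [/\ dot e1 e2 = 0, dot e1 e3 = 0 & dot e2 e3 = 0].

Definition unit_eigenvectors (M : 'M[R]_3) : set 'cV[R]_3 :=
  [set v | enorm v = 1 /\ exists l : R, M *m v = l *: v].

Definition lambda_max (M : 'M[R]_3) : R := sup [set l | eigenvalue M l].

Definition pos_def m (A : 'M[R]_m) : Prop :=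
  A^T = A /\ forall u : 'cV[R]_m, u != 0 -> 0 < quadform A u.

Definition unif_pos_def m (A : R -> 'M[R]_m) : Prop :=
  (forall t, 0 <= t -> (A t)^T = A t) /\
  exists2 c, 0 < c &
    forall t, 0 <= t -> forall u, c * dot u u <= quadform (A t) u.

Definition bounded_mx m1 m2 (A : R -> 'M[R]_(m1.+1, m2.+1)) : Prop :=
  exists B : R, forall t, 0 <= t -> `|A t| <= B.

(* Classical solution on the half-line t >= 0. The equation is imposed for
   t > 0, together with continuity up to t = 0, so that no derivative at the
   end point is needed. *)
Definition ode_solution (W : normedModType R) (F : R -> W -> W) (x : R -> W)
    : Prop :=
  {within `[0, +oo[, continuous x} /\
  forall t : R, 0 < t -> is_derive t (1 : R) x (F t (x t)).

End Euclidean.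

Section Hybrid.
Context {R : realType} {W : normedModType R}.

Definition hybrid_time_domain (E : set (R * nat)) : Prop :=
  [/\ E !=set0, (forall t j, E (t, j) -> 0 <= t) &
      forall T J, E (T, J) ->
        exists tj : nat -> R,
          [/\ tj 0%N = 0, (forall j, (j <= J)%N -> tj j <= tj j.+1) &
              E `&` [set e | e.1 <= T /\ (e.2 <= J)%N] =
              [set e | (e.2 <= J)%N /\ tj e.2 <= e.1 <= tj e.2.+1]]].

Definition slice (E : set (R * nat)) (j : nat) : set R := [set t | E (t, j)].

Definition abs_continuous (a b : R) (f : R -> W) : Prop :=
  forall e : R, 0 < e -> exists2 d : R, 0 < d &
    forall (m : nat) (u v : 'I_m -> R),
      (forall i, [/\ a <= u i, u i <= v i & v i <= b]) ->
      (forall i l, i != l -> v i <= u l \/ v l <= u i) ->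
      \sum_(i < m) (v i - u i) < d ->
      \sum_(i < m) `|f (v i) - f (u i)| < e.

(* The values of [x] outside [E] are irrelevant. *)
Definition hybrid_arc (E : set (R * nat)) (x : R -> nat -> W) : Prop :=
  hybrid_time_domain E /\
  forall j a b, slice E j a -> slice E j b -> a <= b ->
    abs_continuous a b (x ^~ j).

Record hybrid_system := HybridSystem {
  flow_set : set W;
  flow_map : W -> set W;
  jump_set : set W;
  jump_map : W -> set W }.

Definition hybrid_solution (H : hybrid_system)
    (E : set (R * nat)) (x : R -> nat -> W) : Prop :=
  [/\ hybrid_arc E x,
      (closure (flow_set H) `|` jump_set H) (x 0 0%N),
      (forall j t, (slice E j)° t -> flow_set H (x t j)),
      (forall j, {ae (@lebesgue_measure R), forall t, (slice E j)° t ->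
         exists2 dx, flow_map H (x t j) dx &
                     is_derive t (1 : R) (x ^~ j) dx}) &
      (forall t j, E (t, j) -> E (t, j.+1) ->
         jump_set H (x t j) /\ jump_map H (x t j) (x t j.+1))].

Definition finitely_many_jumps (E : set (R * nat)) : Prop :=
  exists J, forall t j, E (t, j) -> (j <= J)%N.

(* Uniform global exponential stability, for the given set of solutions, of
   the set whose distance function is [dist]. *)
Definition uges (sol : set (R * nat) -> (R -> nat -> W) -> Prop)
    (dist : W -> R) : Prop :=
  exists kappa lambda : R, [/\ 0 < kappa, 0 < lambda &
    forall E x, sol E x -> forall t j, E (t, j) ->
      dist (x t j) <=
        kappa * expR (- (lambda * (t + j%:R))) * dist (x 0 0%N)].

End Hybrid.

Section Observer.
Context {R : realType}.
Variable n : nat.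
Variables (g : 'cV[R]_3) (p : 'I_n -> 'cV[R]_3) (k : 'I_n -> R).
Variables (omega a : R -> 'cV[R]_3).

Definition insf (X : 'M[R]_5) (w acc : 'cV[R]_3) : 'M[R]_5 :=
  tangent (rotmx X *m crossmx w) (g + rotmx X *m acc) (velmx X).

Definition true_trajectory (X : R -> 'M[R]_5) : Prop :=
  (forall t, 0 <= t -> SE23 (X t)) /\
  ode_solution (fun t Y => insf Y (omega t) (a t)) X.

Definition kc : R := \sum_(i < n) k i.

Definition wcenter m (x : 'I_n -> 'cV[R]_m) : 'cV[R]_m :=
  kc^-1 *: \sum_(i < n) k i *: x i.

Definition pc : 'cV[R]_3 := wcenter p.

Definition MM : 'M[R]_3 :=
  \sum_(i < n) k i *: ((p i - pc) *m (p i - pc)^T).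

Definition landmark_meas (X : 'M[R]_5) (i : 'I_n) : 'cV[R]_3 :=
  (rotmx X)^T *m (p i - posmx X).

(* In this section [y] stands for the family of landmark measurements; [r] and
   [b] are given by their columns. *)
Definition rvec (i : 'I_n) : 'cV[R]_5 := homog (p i).
Definition bvec (y : 'I_n -> 'cV[R]_3) (i : 'I_n) : 'cV[R]_5 := homog (y i).

Definition Upsilon (Xh : 'M[R]_5) (r b : 'I_n -> 'cV[R]_5) : R :=
  2^-1 * \sum_(i < n)
    k i * enorm ((r i - wcenter r) - Xh *m (b i - wcenter b)) ^+ 2.

Variables (theta : R) (U : set 'cV[R]_3) (delta : R).

Definition QQ : set 'M[R]_5 :=
  [set Xq | exists2 u, U u &
     Xq = TT (Ra theta u) 0 ((1%:M - Ra theta u) *m pc)].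

Definition Upsilon_jump (Xh : 'M[R]_5) (y : 'I_n -> 'cV[R]_3) (Xq : 'M[R]_5)
    : R :=
  Upsilon (invmx Xq *m Xh) rvec (bvec y).

(* [inf] is a minimum: [QQ] is finite and nonempty when [U] is. *)
Definition muQ (Xh : 'M[R]_5) (y : 'I_n -> 'cV[R]_3) : R :=
  Upsilon Xh rvec (bvec y) - inf [set Upsilon_jump Xh y Xq | Xq in QQ].

Definition Fo (y : 'I_n -> 'cV[R]_3) : set 'M[R]_5 :=
  [set Xh | SE23 Xh /\ muQ Xh y <= delta].
Definition Jo (y : 'I_n -> 'cV[R]_3) : set 'M[R]_5 :=
  [set Xh | SE23 Xh /\ muQ Xh y >= delta].

Definition gamma_min (y : 'I_n -> 'cV[R]_3) (Xh : 'M[R]_5) : set 'M[R]_5 :=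
  [set Xq | QQ Xq /\
     forall Xq', QQ Xq' -> Upsilon_jump Xh y Xq <= Upsilon_jump Xh y Xq'].

Definition eigenbasis_choice : Prop :=
  exists e1 e2 e3 : 'cV[R]_3, exists l1 l2 l3 : R,
    [/\ orthonormal3 e1 e2 e3,
        [/\ MM *m e1 = l1 *: e1, MM *m e2 = l2 *: e2 & MM *m e3 = l3 *: e3],
        [/\ U e1, U e2 & U e3] &
        [/\ l1 >= l2, l2 >= l3 & l3 > 0] \/ [/\ l1 > l2, l2 > l3 & l3 = 0]].

Definition orthonormal_choice : Prop :=
  (exists e1 e2 e3 : 'cV[R]_3,
     orthonormal3 e1 e2 e3 /\ [/\ U e1, U e2 & U e3]) /\
  \tr MM - 2 * lambda_max MM > 0.

Definition admissible_U : Prop :=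
  [/\ finite_set U, U `<=` sphere2 & eigenbasis_choice \/ orthonormal_choice].

Definition Mv (v : 'cV[R]_3) : 'M[R]_3 := MM *m (1%:M - 2 *: (v *m v^T)).

(* [inf] and [sup] are attained: the unit eigenvectors form a compact set and
   [U] is finite. *)
Definition DeltaMstar : R :=
  inf [set sup [set quadform ((\tr (Mv v))%:M - Mv v) u | u in U]
      | v in unit_eigenvectors MM].

Variables (kR : R) (Q : R -> 'M[R]_3) (V P : R -> 'M[R]_6).

Definition AA (t : R) : 'M[R]_6 :=
  (block_mx (- crossmx (omega t)) 1%:M 0 (- crossmx (omega t)) : 'M[R]_(3 + 3)).

Definition CC : 'M[R]_(3, 6) := (row_mx 1%:M 0 : 'M[R]_(3, 3 + 3)).

Definition riccati : Prop :=
  ode_solution (fun t S =>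
    AA t *m S + S *m (AA t)^T - S *m CC^T *m Q t *m CC *m S + V t) P.

Definition LL (t : R) : 'M[R]_(3 + 3, 3) := P t *m CC^T *m Q t.

Definition Kp (t : R) (Xh : 'M[R]_5) : 'M[R]_3 :=
  kc^-1 *: (rotmx Xh *m usubmx (LL t) *m (rotmx Xh)^T).
Definition Kv (t : R) (Xh : 'M[R]_5) : 'M[R]_3 :=
  kc^-1 *: (rotmx Xh *m dsubmx (LL t) *m (rotmx Xh)^T).

Definition ytilde (Xh : 'M[R]_5) (y : 'I_n -> 'cV[R]_3) (i : 'I_n)
    : 'cV[R]_3 :=
  p i - posmx Xh - rotmx Xh *m y i.
Definition DeltaR (Xh : 'M[R]_5) (y : 'I_n -> 'cV[R]_3) : 'M[R]_3 :=
  \sum_(i < n) k i *: (ytilde Xh y i *m (p i - pc)^T).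
Definition Deltap (Xh : 'M[R]_5) (y : 'I_n -> 'cV[R]_3) : 'cV[R]_3 :=
  \sum_(i < n) k i *: ytilde Xh y i.

(* This is - Ad_{X_c}(P_K(...)), expanded with X_c = TT 1 0 pc, where the second
   column of the argument of P_K is taken equal to its third column Deltap (it
   would otherwise vanish, since the fourth row of r is 0). *)
Definition innovation (t : R) (Xh : 'M[R]_5) (y : 'I_n -> 'cV[R]_3)
    : 'M[R]_5 :=
  - tangent (kR *: antisym (DeltaR Xh y))
            (Kv t Xh *m Deltap Xh y)
            (Kp t Xh *m Deltap Xh y - kR *: antisym (DeltaR Xh y) *m pc).

Definition observer_flow (t : R) (Xh : 'M[R]_5) (y : 'I_n -> 'cV[R]_3)
    : 'M[R]_5 :=
  insf Xh (omega t) (a t) - innovation t Xh y *m Xh.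

Definition Rtilde (X Xh : 'M[R]_5) : 'M[R]_3 := rotmx X *m (rotmx Xh)^T.
Definition vtilde (X Xh : 'M[R]_5) : 'cV[R]_3 :=
  velmx X - Rtilde X Xh *m velmx Xh.
Definition ptilde (X Xh : 'M[R]_5) : 'cV[R]_3 :=
  posmx X - Rtilde X Xh *m posmx Xh.
Definition ptilde_e (X Xh : 'M[R]_5) : 'cV[R]_3 :=
  ptilde X Xh - (1%:M - Rtilde X Xh) *m pc.
Definition xerr (X Xh : 'M[R]_5) : 'cV[R]_6 :=
  (col_mx ((rotmx X)^T *m ptilde_e X Xh) ((rotmx X)^T *m vtilde X Xh)
     : 'cV[R]_(3 + 3)).

(* (estimate, attitude error, translational error, time) *)
Definition cl_state : Type := 'M[R]_5 * 'M[R]_3 * 'cV[R]_6 * R.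

Definition est (z : cl_state) : 'M[R]_5 := z.1.1.1.
Definition rerr (z : cl_state) : 'M[R]_3 := z.1.1.2.
Definition terr (z : cl_state) : 'cV[R]_6 := z.1.2.
Definition tim (z : cl_state) : R := z.2.

Definition S2c : set cl_state :=
  [set z | SE23 (est z) /\ SO3 (rerr z) /\ 0 <= tim z].

Definition A2 : set cl_state :=
  [set z | S2c z /\ rerr z = 1%:M /\ terr z = 0].

Definition dist_A2 (z : cl_state) : R :=
  Num.sqrt (attnorm2 (rerr z) + enorm (terr z) ^+ 2).

(* The error components of the state are the errors between the true state at
   time [tim z] and the estimate. *)
Definition error_state (X : R -> 'M[R]_5) (z : cl_state) : Prop :=
  rerr z = Rtilde (X (tim z)) (est z) /\ terr z = xerr (X (tim z)) (est z).

(* The closed loop along the true trajectory [X]. The flow map prescribes the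
   derivatives of the estimate and of the time component only: those of the
   error components are determined by [error_state], which is part of the flow
   and jump sets. *)
Definition closed_loop (X : R -> 'M[R]_5)
    : @hybrid_system R ('M[R]_5 * 'M[R]_3 * 'cV[R]_6 * R)%type :=
  HybridSystem
    [set z | [/\ S2c z, error_state X z &
                 Fo (landmark_meas (X (tim z))) (est z)]]
    (fun z => [set dz |
       est dz = observer_flow (tim z) (est z) (landmark_meas (X (tim z))) /\
       tim dz = 1])
    [set z | [/\ S2c z, error_state X z &
                 Jo (landmark_meas (X (tim z))) (est z)]]
    (fun z => [set z' |
       exists2 Xq, gamma_min (landmark_meas (X (tim z))) (est z) Xq &
         z' = (invmx Xq *m est z, rerr z *m rotmx Xq, terr z, tim z)]).

(* The initial value of the time component is any nonnegative real. *)
Definition closed_loop_solution (E : set (R * nat))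
    (z : R -> nat -> 'M[R]_5 * 'M[R]_3 * 'cV[R]_6 * R) : Prop :=
  exists2 X, true_trajectory X & hybrid_solution (closed_loop X) E z.

End Observer.

Section DistA2.
Context {R : realType}.

Lemma dot_sum m (u : 'cV[R]_m) : dot u u = \sum_i u i 0 ^+ 2.
Proof. by rewrite /dot mxE; apply: eq_bigr => i _; rewrite mxE expr2. Qed.

Lemma dot_ge0 m (u : 'cV[R]_m) : 0 <= dot u u.
Proof. by rewrite dot_sum; apply: sumr_ge0 => i _; exact: sqr_ge0. Qed.

Lemma enorm_sqr m (u : 'cV[R]_m) : enorm u ^+ 2 = dot u u.
Proof. by rewrite sqr_sqrtr// dot_ge0. Qed.

Lemma dot_eq0 m (u : 'cV[R]_m) : dot u u = 0 -> u = 0.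
Proof.
rewrite dot_sum => /eqP; rewrite psumr_eq0 => [/allP h|i _]; last exact: sqr_ge0.
apply/matrixP => i j; rewrite ord1 mxE; apply/eqP.
by have := h i (mem_index_enum _); rewrite sqrf_eq0.
Qed.

Lemma attnorm2E (A : 'M[R]_3) : SO3 A ->
  attnorm2 A = 8^-1 * \sum_i \sum_j ((1%:M - A) i j) ^+ 2.
Proof.
move=> [AtA _].
have -> : \sum_i \sum_j ((1%:M - A) i j) ^+ 2 = 2 * \tr (1%:M - A).
  transitivity (\tr ((1%:M - A)^T *m (1%:M - A))).
    rewrite /mxtrace exchange_big; apply: eq_bigr => j _; rewrite mxE.
    by apply: eq_bigr => i _; rewrite [X in X * _]mxE expr2.
  have -> : (1%:M - A)^T *m (1%:M - A) = (1%:M - A) + (1%:M - A)^T.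
    have -> : (1%:M - A)^T = 1%:M - A^T by rewrite raddfB /= tr_scalar_mx.
    by rewrite mulmxBl mul1mx mulmxBr mulmx1 AtA opprB.
  by rewrite mxtraceD mxtrace_tr mulr_natl mulr2n.
rewrite /attnorm2 mulrA; congr (_ * _).
by rewrite -[8]/((4 * 2)%:R) natrM invfM mulfVK// pnatr_eq0.
Qed.

Lemma dist_A2_eq0 (z : 'M[R]_5 * 'M[R]_3 * 'cV[R]_6 * R) :
  S2c z -> dist_A2 z = 0 <-> A2 z.
Proof.
move=> Sz; have [_ [SOz _]] := Sz.
have sq_ge0 : 0 <= \sum_i \sum_j ((1%:M - rerr z) i j) ^+ 2.
  by do 2!apply: sumr_ge0 => ? _; exact: sqr_ge0.
rewrite /dist_A2 attnorm2E// enorm_sqr; split=> [/eqP|[_ [-> ->]]]; last first.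
  rewrite subrr big1 => [|i _]; last by apply: big1 => j _; rewrite mxE expr0n.
  by rewrite mulr0 add0r /dot mulmx0 mxE sqrtr0.
rewrite sqrtr_eq0 => le0.
have d0 := dot_ge0 (terr z).
have s0 : 0 <= 8^-1 * \sum_i \sum_j ((1%:M - rerr z) i j) ^+ 2.
  by rewrite mulr_ge0// invr_ge0.
have /eqP := le_anti (introT andP (conj le0 (addr_ge0 s0 d0))).
rewrite paddr_eq0// => /andP[/eqP s00 /eqP d00].
split=> //; split; last exact: dot_eq0.
move/eqP: s00; rewrite mulf_eq0 invr_eq0 pnatr_eq0/= => /eqP s00.
apply/esym/eqP; rewrite -subr_eq0; apply/eqP/matrixP => i j.
move/eqP: s00; rewrite psumr_eq0 => [/allP/(_ i (mem_index_enum _))|k _]; last first.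
  by apply: sumr_ge0 => ? _; exact: sqr_ge0.
rewrite psumr_eq0 => [/allP/(_ j (mem_index_enum _))|k _]; last exact: sqr_ge0.
by rewrite sqrf_eq0 => /eqP ->; rewrite [RHS]mxE.
Qed.

End DistA2.

(* Main.v *)
(** The attitude error obeys Rt' = - kR Rt Pa(M Rt), and the translational error
    x' = (A - L C) x + d with |d|^2 <= 4 |g|^2 |Rt|_I^2. If e is the vector part of a
    unit quaternion of Rt and W = tr(M) I - M, which is positive definite because the
    landmarks are not aligned, then the potential tr((I - Rt) M) equals 2 e^T W e and
    |Pa(M Rt)|^2 equals 2 (|W e|^2 - (e^T W e)^2). The latter vanishes only at Rt = I
    and at the half turns about eigenvectors of M. The flow set excludes these half
    turns since delta < (1 - cos theta) Delta*, so compactness makes the potential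
    decay exponentially during flows; each jump lowers it by at least delta, hence the
    number of jumps is bounded. The Riccati solution P stays between two positive
    multiples of the identity, x^T P^-1 x decays up to a multiple of |d|^2, and a
    weighted sum of both functions decays exponentially during flows and does not
    increase at jumps. As solutions flow only almost everywhere, these decays rest on
    the fact that an absolutely continuous function whose derivative is almost
    everywhere nonpositive is nonincreasing. *)

Require Import Defs.
From HB Require Import structures.
From mathcomp Require Import all_boot all_order all_algebra.
From mathcomp Require Import all_classical all_reals all_analysis.
From mathcomp Require Import ring lra.
Import Order.TTheory GRing.Theory Num.Theory.
Import numFieldNormedType.Exports.

Set Implicit Arguments.
Unset Strict Implicit.
Unset Printing Implicit Defensive.

Local Open Scope classical_set_scope.
Local Open Scope ring_scope.

(** * Absolutely continuous functions *)

(** Near the identity both the potential and its dissipation vanish, so compactness gives no rate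
    there: for |Rt|_I^2 <= 1/2 the rate comes from Cauchy-Schwarz on the axis vector, and
    compactness serves only on the rest of SO(3). At a half turn about a unit eigenvector v, M Rt =
    - M_v, and a jump along u lowers the potential by (1 - cos theta) u^T (tr(M_v) I - M_v) u: this
    is where [DeltaMstar] comes from. Traces replace largest eigenvalues throughout, which costs
    only constants. The velocity block of P is not seen by C; its upper bound comes from a trace
    functional with a negative off-diagonal weight, for which the coupling of position and velocity
    acts as damping. As the number of jumps is at most a constant over delta, the decay demanded in
    j is absorbed in the gain. The end points of each flow interval need separate care, since the
    flow condition, and with it membership in SO(3), is imposed only in the interior. *)

Section AbsCont.
Context {R : realType}.
Implicit Types (a b x y e : R) (f : R -> R).

(* [O] is an open set of small measure covering the exceptional null set. The
   growth of [f] up to [x] is split between the intervals of [s], which lie in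
   [O], and the rest of [[a, x]], where [f] grows at slope at most [e]. *)
Definition covered_growth (O : set R) a e f x (s : seq (R * R)) : Prop :=
  [/\ all (fun q => [&& a <= q.1, q.1 <= q.2 & q.2 <= x]) s,
      pairwise (fun q r => q.2 <= r.1) s,
      ((\sum_(q <- s) (q.2 - q.1))%:E <=
         @lebesgue_measure R (O `&` `[a, x[%classic))%E &
      f x - f a <= e * (x - a) + \sum_(q <- s) `|f q.2 - f q.1|].

(** A stretch inside [O] is recorded as one interval: [[x, y[] is disjoint from [[a, x[], so its
    length adds to the measure of the part of [O] met so far. *)
Lemma covered_growth_rcons O a e f x y s : open O -> a <= x -> x <= y ->
  `[x, y] `<=` O -> 0 <= e -> covered_growth O a e f x s ->
  covered_growth O a e f y (rcons s (x, y)).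
Proof.
move=> oO ax xy xyO e0 [h1 h2 h3 h4]; split.
- rewrite all_rcons /= ax xy lexx /=; apply: sub_all h1 => q /and3P[-> -> /=].
  by move=> /le_trans; apply.
- rewrite pairwise_rcons h2 andbT; apply: sub_all h1 => q /and3P[_ _ /=] //.
- rewrite big_rcons /= EFinD.
  have mO : measurable O by exact: measurable_realfun.open_measurable.
  have lexy : ((y - x)%:E <= @lebesgue_measure R `[x, y[%classic)%E.
    rewrite lebesgue_measure_itv /= lte_fin; case: ltP => // yx.
    by rewrite lee_fin subr_le0.
  have -> : O `&` `[a, y[ = (O `&` `[a, x[) `|` `[x, y[.
    apply/seteqP; split => z /=; rewrite !in_itv /=.
      move=> [Oz /andP[az zy]]; case: (ltP z x) => zx; [left|right].
        by rewrite az.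
      by rewrite zy.
    move=> [[Oz /andP[az zx]]|/andP[xz zy]].
      by split => //; rewrite az (lt_le_trans zx).
    split; last by rewrite (le_trans ax xz).
    by apply: xyO; rewrite /= in_itv /= xz ltW.
  rewrite measureU//; [|exact: measurableI|].
    exact: leeD.
  apply/seteqP; split => z //=; rewrite !in_itv /=.
  move=> [[_ /andP[_ zx]] /andP[xz _]].
  by have := lt_le_trans zx xz; rewrite ltxx.
- rewrite big_rcons /=.
  have := ler_norm (f y - f x).
  have : 0 <= e * (y - x) by rewrite mulr_ge0 // subr_ge0.
  lra.
Qed.

Lemma covered_growth_slope O a e f x y s : open O -> a <= x -> x <= y ->
  f y - f x <= e * (y - x) -> covered_growth O a e f x s ->
  covered_growth O a e f y s.
Proof.
move=> oO ax xy fxy [h1 h2 h3 h4]; split => //.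
- apply: sub_all h1 => q /and3P[-> -> /=].
  by move=> /le_trans; apply.
- apply: (le_trans h3); apply: le_measure.
  + by rewrite inE; apply: measurableI => //; exact: measurable_realfun.open_measurable.
  + by rewrite inE; apply: measurableI => //; exact: measurable_realfun.open_measurable.
  + apply: setIS => z /=; rewrite !in_itv /= => /andP[->] /=.
    by move=> /lt_le_trans; apply.
- by move: fxy h4; lra.
Qed.

(** Only the derivative at [t] is known, so the increment is split at [t] into two one-sided
    quotients, each at most [e]; [u] and [v] may equal [t]. *)
Lemma derive_le0_straddle f t d e : 0 < e -> is_derive t (1 : R) f d -> d <= 0 ->
  exists2 r, 0 < r & forall u v, u <= t -> t <= v -> t - u < r -> v - t < r ->
    f v - f u <= e * (v - u).
Proof.
move=> e0 [dft fd] d0.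
move/cvg_ex : dft => [l hl].
have ld : l = d by rewrite -fd /derive; apply/esym/cvg_lim.
move/cvgrPdist_le : hl => /(_ _ e0)[r /= r0 hr].
exists r => // u v ut tv tu vt.
have key h : h != 0 -> `|h| < r -> `|d - h^-1 * (f (h + t) - f t)| <= e.
  move=> h0 hr'; have := hr h; rewrite /ball_ /= sub0r normrN => /(_ hr' h0).
  by rewrite ld -!/(GRing.scale _ _) /GRing.scale /= mulr1.
have fv : f v - f t <= e * (v - t).
  have [->|vt0] := eqVneq v t; first by rewrite !subrr mulr0.
  have vt1 : 0 < v - t by rewrite subr_gt0 lt_neqAle eq_sym vt0.
  have := key (v - t); rewrite gt_eqF // gtr0_norm // subrK => /(_ isT vt).
  rewrite ler_norml => /andP[h _].
  have : (v - t)^-1 * (f v - f t) <= e by lra.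
  by rewrite ler_pdivrMl // mulrC.
have fu : f t - f u <= e * (t - u).
  have [->|ut0] := eqVneq u t; first by rewrite !subrr mulr0.
  have ut1 : 0 < t - u by rewrite subr_gt0 lt_neqAle ut0.
  have := key (u - t); rewrite subr_eq0 ut0 -normrN opprB gtr0_norm // subrK.
  move=> /(_ isT tu); rewrite ler_norml => /andP[h _].
  have : (u - t)^-1 * (f u - f t) <= e by lra.
  rewrite -(opprB t u) -(opprB (f t)) invrN mulrNN ler_pdivrMl // mulrC; lra.
lra.
Qed.

(** The supremum of the points reached with covered growth is [b]. At this supremum, either [O]
    contains a neighbourhood, crossed by one new interval, or the derivative exists and is
    nonpositive, and the slope term pays for the crossing. The recorded intervals have total length
    less than [d], so absolute continuity bounds their contribution. *)
Lemma abs_continuous_nonincr f a b : a <= b -> abs_continuous a b f ->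
  {ae (@lebesgue_measure R), forall t, a < t < b ->
     exists2 d, is_derive t (1 : R) f d & d <= 0} ->
  f b <= f a.
Proof.
move=> ab fac [A [mA muA subA]].
apply/ler_addgt0Pr => e e0.
(* The slope contributes [eta * (b - a)] and the covered part less than [eta], together less than
   [e]. *)
pose eta := e / (b - a + 2).
have ba : 0 < b - a + 2 by lra.
have eta0 : 0 < eta by rewrite divr_gt0.
have [d d0 hd] := fac _ eta0.
(* Derivatives are given only inside []a, b[]; adding the end points to the null set makes [O] cover
   them. *)
pose A' := A `|` ([set a] `|` [set b]).
have mA' : measurable A' by do 2!apply: measurableU => //.
have muA' : @lebesgue_measure R A' = 0%E.
  rewrite measureU0 //; first exact: measurableU.
  by rewrite measureU0 ?lebesgue_measure_set1 //; exact: lebesgue_measure_set1.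
have muAy : (@lebesgue_measure R A' < +oo)%E by rewrite muA' ltry.
have [ O [oO AO muO]] := lebesgue_regularity_outer mA' muAy d0.
have mO : measurable O by exact: measurable_realfun.open_measurable.
have {}muO : (@lebesgue_measure R O < d%:E)%E.
  apply: le_lt_trans muO.
  have mD : measurable (O `\` A') by exact: measurableD.
  have h : (@lebesgue_measure R (A' `|` O `\` A') <=
      @lebesgue_measure R A' + @lebesgue_measure R (O `\` A'))%E.
    exact: measureU2.
  by move: h; rewrite setDUK // muA' add0e.
pose G := [set x | a <= x <= b /\ exists s, covered_growth O a eta f x s].
have Ga : G a.
  split; first by rewrite lexx.
  exists [::]; split => //; first by rewrite big_nil measure_ge0.
  by rewrite big_nil !subrr mulr0 addr0.
have supG : has_sup G.
  by split; [exists a|exists b => x [/andP[]]].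
have aS : a <= sup G by exact: ub_le_sup (proj2 supG) _ Ga.
have Sb : sup G <= b by apply: ge_sup; [exists a|move=> x [/andP[]]].
have [r r0 hr] : exists2 r, 0 < r & forall x y s, a <= x -> x <= sup G ->
    sup G <= y -> y <= b -> sup G - x < r -> y - sup G < r ->
    covered_growth O a eta f x s -> exists s', covered_growth O a eta f y s'.
  have [SO|SO] := pselect (O (sup G)).
    have /= := oO _ SO; rewrite -nbhs_ballE => -[r /= r0 hr].
    exists r => // x y s ax xS Sy yb hx hy cg.
    exists (rcons s (x, y)); apply: covered_growth_rcons => //.
    - exact: le_trans Sy.
    - move=> z /=; rewrite in_itv /= => /andP[xz zy]; apply: hr.
      rewrite /ball /= ltr_norml; lra.
    - exact: ltW.
  have SA : ~ A (sup G) by move=> h; apply: SO; apply: AO; left.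
  have [Sa Sb'] : sup G != a /\ sup G != b.
    split; apply/eqP => h; apply: SO; apply: AO; right; rewrite h;
      [by left|by right].
  have [q hq q0] : exists2 q, is_derive (sup G) (1:R) f q & q <= 0.
    apply: contrapT => h; apply: SA; apply: subA => /= h'; apply: h; apply: h'.
    by rewrite !lt_neqAle aS Sb eq_sym Sa Sb'.
  have [r r0 hr] := derive_le0_straddle eta0 hq q0.
  exists r => // x y s ax xS Sy yb hx hy cg.
  exists s; apply: (@covered_growth_slope _ _ _ _ x) => //; first exact: le_trans Sy.
  exact: hr.
have [x Gx Sx] := sup_adherent r0 supG.
have xS : x <= sup G by exact: ub_le_sup (proj2 supG) _ Gx.
have Gy y : sup G <= y -> y <= b -> y - sup G < r -> G y.
  move=> Sy yb Syr; case: Gx => /andP[ax xb] [s cg]; split.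
    by rewrite yb (le_trans aS).
  by apply: (hr x y s) => //; lra.
have SbE : sup G = b.
  apply/eqP; rewrite eq_le Sb /= leNgt; apply/negP => Sltb.
  pose y := Num.min b (sup G + r / 2).
  have Sy : sup G < y by rewrite lt_min Sltb /= ltrDl divr_gt0.
  have : G y.
    apply: Gy; [exact: ltW|by rewrite ge_min lexx|].
    have : y <= sup G + r / 2 by rewrite ge_min lexx orbT.
    by move: r0; lra.
  by move/(ub_le_sup (proj2 supG)); rewrite leNgt Sy.
have [_ [s [h1 h2 h3 h4]]] : G b by apply: Gy; rewrite ?SbE ?subrr.
have : \sum_(q <- s) `|f q.2 - f q.1| < eta.
  have szb : \sum_(q <- s) (q.2 - q.1) < d.
    rewrite -lte_fin; apply: (le_lt_trans h3); apply: le_lt_trans muO.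
    by apply: le_measure; rewrite ?inE //; apply: measurableI.
  have := hd (size s) (fun i => (tnth (in_tuple s) i).1)
                      (fun i => (tnth (in_tuple s) i).2).
  have E (F : R * R -> R) : \sum_(i < size s) F (tnth (in_tuple s) i) = \sum_(q <- s) F q.
    by rewrite [RHS]big_tnth.
  rewrite (E (fun q => q.2 - q.1)) (E (fun q => `|f q.2 - f q.1|)); apply => //.
    move=> i; apply/and3P; move/allP : h1; apply; exact: mem_tnth.
  move=> i l il.
  have hp (m m' : 'I_(size s)) : (m < m')%N ->
      (tnth (in_tuple s) m).2 <= (tnth (in_tuple s) m').1.
    move=> mm; rewrite !(tnth_nth (0, 0)) /=.
    by move/(pairwiseP (0,0)) : h2; apply => //; rewrite inE.
  case: (ltngtP i l) => h; [by left; exact: hp|by right; exact: hp|].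
  by move: il; rewrite -val_eqE /= h eqxx.
have -> : e = eta * (b - a + 2) by rewrite /eta mulfVK // gt_eqF.
by move: h4 eta0; lra.
Qed.

End AbsCont.

(** * Continuity on subsets of the line and barrier arguments *)

Section WithinContinuity.
Context {R : realType}.

Lemma within_continuousP (W : normedModType R) (A : set R) (f : R -> W) :
  {within A, continuous f} <->
  forall x, A x -> forall e : R, 0 < e -> exists2 d : R, 0 < d &
    forall y, A y -> `|x - y| < d -> `|f x - f y| < e.
Proof.
split=> [/subspace_continuousP cf x Ax e e0|h].
  have /cvgrPdist_lt/(_ _ e0) := cf x Ax.
  rewrite /within /= => -[d /= d0 hd]; exists d => // y Ay xy.
  by apply: hd.
apply/subspace_continuousP => x Ax; apply/cvgrPdist_lt => e e0.
have [d d0 hd] := h x Ax e e0.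
by exists d => //= y xy Ay; apply: hd.
Qed.

Lemma within_continuous_sub (W : normedModType R) (A B : set R) (f : R -> W) :
  A `<=` B -> {within B, continuous f} -> {within A, continuous f}.
Proof. by move=> AB; apply: continuous_subspaceW. Qed.

Lemma within_continuous_lip (W W' : normedModType R) (A : set R) (f : R -> W)
    (g : R -> W') (C : R) :
  (forall x y, A x -> A y -> `|g x - g y| <= C * `|f x - f y|) ->
  {within A, continuous f} -> {within A, continuous g}.
Proof.
move=> gf /within_continuousP cf; apply/within_continuousP => x Ax e e0.
have C0 : 0 < `|C| + 1 by rewrite ltr_wpDl.
have [d d0 hd] := cf x Ax (e / (`|C| + 1)) (divr_gt0 e0 C0).
exists d => // y Ay xy; apply: le_lt_trans (gf _ _ Ax Ay) _.
have := hd y Ay xy; rewrite ltr_pdivlMr //; apply: le_lt_trans.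
rewrite mulrC ler_wpM2l //; have := ler_norm C; lra.
Qed.

Lemma within_le_closed (f : R -> R) (A : set R) (x B : R) : {within A, continuous f} ->
  A x -> (forall d, 0 < d -> exists y, [/\ A y, `|x - y| < d & f y <= B]) -> f x <= B.
Proof.
move=> /within_continuousP cf Ax h; rewrite leNgt; apply/negP => fB.
have [d d0 hd] := cf x Ax (f x - B) ltac:(lra).
have [y [Ay xy fy]] := h d d0.
have := hd y Ay xy; rewrite ltr_norml; lra.
Qed.

Lemma within_bounded (W : normedModType R) (a b : R) (f : R -> W) :
  {within `[a, b], continuous f} -> exists2 C, 0 < C & forall x, a <= x <= b -> `|f x| <= C.
Proof.
move=> cf; case: (leP a b) => ab; last first.
  by exists 1 => // x; lra.
have cg : {within `[a, b], continuous (fun x => `|f x|)}.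
  apply: (within_continuous_lip (C := 1)) cf => x y _ _.
  by rewrite mul1r ler_dist_dist.
have [c _ hc] := EVT_max ab cg.
exists (`|f c| + 1); first by rewrite ltr_wpDl.
move=> x xab; have := hc x; rewrite in_itv /= xab => /(_ isT); lra.
Qed.

(** After the last time at which [f <= B] the function stays above [B], hence is nonincreasing
    there, hence cannot exceed its value at that time. The sign of the derivative is needed only
    where [f] exceeds [B]. *)
Lemma barrier (f : R -> R) (a T B : R) : {within `[a, T], continuous f} -> f a <= B ->
  (forall t, a < t < T -> B < f t -> exists2 d, is_derive t (1 : R) f d & d <= 0) ->
  forall t, a <= t <= T -> f t <= B.
Proof.
move=> cf fa df t1 /andP[at1 t1T]; rewrite leNgt; apply/negP => ft1.
pose G := [set r | a <= r <= t1 /\ f r <= B].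
have Ga : G a by split => //; rewrite lexx.
have supG : has_sup G by split; [exists a|exists t1 => x [/andP[]]].
have aS : a <= sup G by exact: ub_le_sup (proj2 supG) _ Ga.
have St1 : sup G <= t1 by apply: ge_sup; [exists a|move=> x [/andP[]]].
have fS : f (sup G) <= B.
  apply: (within_le_closed cf); first by rewrite /= in_itv /= aS (le_trans St1).
  move=> d d0; have [y Gy Sy] := sup_adherent d0 supG.
  have yS := ub_le_sup (proj2 supG) Gy.
  case: Gy => /andP[ay yt] fy; exists y; split => //.
    by rewrite /= in_itv /= ay (le_trans yt).
  by rewrite ger0_norm; lra.
have gt t : sup G < t -> t <= t1 -> B < f t.
  move=> St tt1; rewrite ltNge; apply/negP => ftB.
  have : G t by split => //; lra.
  by move/(ub_le_sup (proj2 supG)); lra.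
have D x : x \in `](sup G), t1[ -> exists2 d, is_derive x (1 : R) f d & d <= 0.
  rewrite in_itv /= => /andP[Sx xt]; apply: df; first by apply/andP; split; lra.
  by apply: gt => //; exact: ltW.
have : f t1 <= f (sup G).
  apply: (@ler0_derive1_le_cc _ f (sup G) t1) => //.
  - by move=> x /D[d [? _]].
  - by move=> x /D[d hd d0]; rewrite derive1E derive_val.
  - apply: within_continuous_sub cf => x /=; rewrite !in_itv /=; lra.
  - by rewrite in_itv /= lexx St1.
  - by rewrite in_itv /= lexx St1.
lra.
Qed.

Lemma derive_bound_lip (f : R -> R) (a b C : R) : {within `[a, b], continuous f} ->
  (forall t, a < t < b -> exists2 d, is_derive t (1 : R) f d & `|d| <= C) ->
  forall u v, a <= u -> u <= v -> v <= b -> `|f v - f u| <= C * `|v - u|.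
Proof.
move=> cf df u v au uv vb.
have D x : x \in `]u, v[ -> is_derive x (1 : R) f ('D_1 f x).
  rewrite in_itv /= => /andP[ux xv].
  have [|d [? _] _] := df x; first by apply/andP; split; lra.
  exact: derivableP.
move: uv; rewrite le_eqVlt => /predU1P[->|uv].
  by rewrite !subrr normr0 mulr0.
have [|x xuv ->] := MVT uv D.
  apply: within_continuous_sub cf => x /=; rewrite !in_itv /=; lra.
rewrite normrM ler_wpM2r //.
move: xuv; rewrite in_itv /= => /andP[ux xv].
have [|d hd dC] := df x; first by apply/andP; split; lra.
by rewrite (@derive_val _ _ _ _ _ _ _ hd).
Qed.

End WithinContinuity.

(** * Closure properties of absolute continuity and the Gronwall inequality *)

Section AbsContClosure.
Context {R : realType}.
Implicit Types a b : R.

(** Common source of the closure properties: Lipschitz images, sums, products, components of a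
    state. Two dominating functions are allowed because the increment of a product involves both
    factors. *)
Lemma abs_continuous_dom (W W1 W2 : normedModType R) a b (f1 : R -> W1) (f2 : R -> W2)
    (h : R -> W) (C : R) :
  (forall u v, a <= u -> u <= v -> v <= b ->
     `|h v - h u| <= C * (`|f1 v - f1 u| + `|f2 v - f2 u|)) ->
  abs_continuous a b f1 -> abs_continuous a b f2 -> abs_continuous a b h.
Proof.
move=> hC ac1 ac2 e e0.
have C0 : 0 < `|C| + 1 by rewrite ltr_wpDl.
have e1 : 0 < e / (`|C| + 1) / 2 by rewrite !divr_gt0.
have [d1 d10 h1] := ac1 _ e1; have [d2 d20 h2] := ac2 _ e1.
exists (Num.min d1 d2); first by rewrite lt_min d10.
move=> m u v uv dis; rewrite lt_min => /andP[/(h1 _ _ _ uv dis) {}h1 /(h2 _ _ _ uv dis) {}h2].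
apply: (@le_lt_trans _ _ (\sum_(i < m) (`|C| + 1) *
    (`|f1 (v i) - f1 (u i)| + `|f2 (v i) - f2 (u i)|))).
  apply: ler_sum => i _; have [? ? ?] := uv i.
  apply: (le_trans (hC _ _ _ _ _)) => //; apply: ler_wpM2r; first exact: addr_ge0.
  by have := ler_norm C; lra.
rewrite -mulr_sumr big_split /=.
have : \sum_(i < m) `|f1 (v i) - f1 (u i)| + \sum_(i < m) `|f2 (v i) - f2 (u i)|
   < e / (`|C| + 1) by lra.
by rewrite ltr_pdivlMr // mulrC.
Qed.

Lemma abs_continuous_id a b : abs_continuous a b (@id R).
Proof.
move=> e e0; exists e => // m u v uv _ h; apply: le_lt_trans h.
by apply: ler_sum => i _; have [_ uvi _] := uv i; rewrite ger0_norm // subr_ge0.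
Qed.

Lemma abs_continuous_within (W : normedModType R) a b (f : R -> W) :
  abs_continuous a b f -> {within `[a, b], continuous f}.
Proof.
move=> acf; apply/within_continuousP => x; rewrite /= in_itv /= => /andP[ax xb] e e0.
have [d d0 hd] := acf e e0; exists d => // y; rewrite /= in_itv /= => /andP[ay yb] xy.
pose u := Num.min x y; pose v := Num.max x y.
have -> : `|f x - f y| = `|f v - f u|.
  by rewrite /u /v; case: (leP x y) => // _; rewrite distrC.
have := hd 1%N (fun=> u) (fun=> v); rewrite !big_ord1; apply.
- move=> _; rewrite /u /v; split; case: (leP x y) => // h; exact: ltW.
- by move=> i l; rewrite !ord1 eqxx.
- by move: xy; rewrite /u /v; case: (leP x y) => h; rewrite ltr_norml; lra.
Qed.

Lemma abs_continuous_lip (W : normedModType R) a b (h : R -> W) (C : R) :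
  (forall u v, a <= u -> u <= v -> v <= b -> `|h v - h u| <= C * `|v - u|) ->
  abs_continuous a b h.
Proof.
move=> hC; apply: (abs_continuous_dom (C := `|C|)) (@abs_continuous_id a b)
  (@abs_continuous_id a b).
move=> u v au uv vb; apply: (le_trans (hC _ _ au uv vb)).
apply: (@le_trans _ _ (`|C| * `|v - u|)); first by rewrite ler_wpM2r // ler_norm.
by apply: ler_wpM2l => //; rewrite lerDl.
Qed.

Lemma abs_continuousM a b (f g : R -> R) : abs_continuous a b f ->
  abs_continuous a b g -> abs_continuous a b (fun t => f t * g t).
Proof.
move=> acf acg.
have [Cf Cf0 hf] := within_bounded (abs_continuous_within acf).
have [Cg Cg0 hg] := within_bounded (abs_continuous_within acg).
apply: (abs_continuous_dom (C := Cf + Cg)) acf acg => u v au uv vb.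
have -> : f v * g v - f u * g u = (f v - f u) * g v + f u * (g v - g u) by ring.
apply: (le_trans (ler_normD _ _)); rewrite !normrM.
have h1 : `|g v| <= Cg by apply: hg; lra.
have h2 : `|f u| <= Cf by apply: hf; lra.
have := ler_wpM2l (normr_ge0 (f v - f u)) h1.
have := ler_wpM2r (normr_ge0 (g v - g u)) h2.
have := mulr_ge0 (ltW Cg0) (normr_ge0 (g v - g u)).
have := mulr_ge0 (ltW Cf0) (normr_ge0 (f v - f u)).
rewrite mulrDl !mulrDr. lra.
Qed.

Lemma abs_continuousD a b (f g : R -> R) : abs_continuous a b f ->
  abs_continuous a b g -> abs_continuous a b (fun t => f t + g t).
Proof.
apply: (abs_continuous_dom (C := 1)) => u v _ _ _.
by rewrite mul1r opprD addrACA ler_normD.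
Qed.

Lemma abs_continuous_sum a b (I : Type) (r : seq I) (f : I -> R -> R) :
  (forall i, abs_continuous a b (f i)) -> abs_continuous a b (fun t => \sum_(i <- r) f i t).
Proof.
move=> acf; elim: r => [|i r IH].
  apply: (abs_continuous_lip (C := 0)) => u v _ _ _.
  by rewrite !big_nil subrr normr0 mul0r.
have := abs_continuousD (acf i) IH; congr abs_continuous.
by apply/funext => t; rewrite big_cons.
Qed.

Lemma abs_continuous_cst a b (c : R) : abs_continuous a b (fun=> c).
Proof. by apply: (abs_continuous_lip (C := 0)) => u v _ _ _; rewrite subrr normr0 mul0r. Qed.

Lemma is_derive_expR_scale (l t : R) :
  is_derive t (1 : R) (fun t => expR (l * t)) (l * expR (l * t)).
Proof.
have dl : is_derive t (1 : R) (fun t : R => l * t) l.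
  have h := is_deriveZ l (is_derive_id t (1 : R)).
  by apply: (is_derive_eq h); rewrite /GRing.scale /= mulr1.
by rewrite mulrC; exact: (is_derive1_comp (is_derive_expR (l * t)) dl).
Qed.

Lemma ae_imp (A B : R -> Prop) : (forall t, A t -> B t) ->
  {ae (@lebesgue_measure R), forall t, A t} -> {ae (@lebesgue_measure R), forall t, B t}.
Proof. by move=> AB; apply: negligibleS => t nB At; apply: nB; exact: AB. Qed.

(** Multiplication by [expR (l * t)] makes the derivative nonpositive almost everywhere; this factor
    is Lipschitz on the segment, so the product stays absolutely continuous. *)
Lemma abs_continuous_gronwall a b (f : R -> R) (l : R) : a <= b -> abs_continuous a b f ->
  {ae (@lebesgue_measure R), forall t, a < t < b ->
     exists2 d, is_derive t (1 : R) f d & d <= - l * f t} ->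
  f b <= expR (- (l * (b - a))) * f a.
Proof.
move=> ab acf aef.
pose E := fun t : R => expR (l * t).
have dE t : is_derive t (1 : R) E (l * E t) := is_derive_expR_scale l t.
have cE : {within `[a, b], continuous E}.
  apply: continuous_subspaceT => t; apply: differentiable_continuous.
  by apply/derivable1_diffP; case: (dE t).
have [C C0 hC] := within_bounded cE.
have acE : abs_continuous a b E.
  apply: (abs_continuous_lip (C := `|l| * C)); apply: derive_bound_lip => // t tab.
  exists (l * E t); first exact: dE.
  by rewrite normrM ler_wpM2l // hC //; lra.
have := abs_continuous_nonincr ab (abs_continuousM acE acf).
have H : {ae @lebesgue_measure R, forall t : R, a < t < b ->
    exists2 d : R, is_derive t 1 (fun t0 : R => E t0 * f t0) d & d <= 0}.
  apply: ae_imp aef => t ht /ht[d df dl].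
  exists (E t * d + f t * (l * E t)).
    by have := is_deriveM (dE t) df; rewrite /GRing.scale.
  have : E t * (d + l * f t) <= 0.
    by rewrite pmulr_rle0; [lra|exact: expR_gt0].
  by rewrite mulrDr; lra.
move=> /(_ H); rewrite /E mulrC -ler_pdivlMr ?expR_gt0 // => h.
apply: (le_trans h); rewrite -expRN mulrAC -expRD.
by have -> : l * a + - (l * b) = - (l * (b - a)) by ring.
Qed.

End AbsContClosure.

(** * Matrix-valued functions and quadratic forms *)

Section MatrixDerive.
Context {R : realType}.

Lemma is_derive_mxP m n (f : R -> 'M[R]_(m, n)) t df :
  is_derive t (1 : R) f df <->
  forall i j, is_derive t (1 : R) (fun s => f s i j) (df i j).
Proof.
split=> [[dfl dfE] i j|h].
  apply: DeriveDef; first by move/derivable_mxP : dfl; apply.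
  by rewrite -dfE derive_mx // mxE.
have dfl : derivable f t (1 : R) by apply/derivable_mxP => i j; case: (h i j).
apply: DeriveDef => //; rewrite derive_mx //.
by apply/matrixP => i j; rewrite mxE; case: (h i j).
Qed.

(** The algebraic hypothesis on [L] is exactly compatibility with difference quotients; it is
    applied to the projections of a product. *)
Lemma is_derive_lin (W W' : normedModType R) (L : W -> W') (f : R -> W) t df :
  continuous L -> (forall k x y, L (k *: (x - y)) = k *: (L x - L y)) ->
  is_derive t (1 : R) f df -> is_derive t (1 : R) (fun s => L (f s)) (L df).
Proof.
move=> cL linL [dfl dfE].
have h : (fun h => h^-1 *: (((fun s => L (f s)) \o shift t) (h *: (1 : R)) - L (f t))) @ 0^'
    --> L df.
  have c1 : (fun h => h^-1 *: ((f \o shift t) (h *: (1 : R)) - f t)) @ 0^' --> df.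
    by rewrite -dfE; exact: dfl.
  under eq_fun do rewrite /= -linL.
  exact: (cvg_comp _ L c1 (cL df)).
by apply: DeriveDef; [apply/cvg_ex; exists (L df)|exact/cvg_lim].
Qed.

Lemma is_derive_fst (W W' : normedModType R) (f : R -> W * W') t df :
  is_derive t (1 : R) f df -> is_derive t (1 : R) (fun s => (f s).1) df.1.
Proof. by apply: is_derive_lin => // -[x y]; exact: cvg_fst. Qed.

Lemma is_derive_snd (W W' : normedModType R) (f : R -> W * W') t df :
  is_derive t (1 : R) f df -> is_derive t (1 : R) (fun s => (f s).2) df.2.
Proof. by apply: is_derive_lin => // -[x y]; exact: cvg_snd. Qed.

Lemma is_derive_bigsum (I : Type) (r : seq I) (f : I -> R -> R) t (df : I -> R) :
  (forall i, is_derive t (1 : R) (f i) (df i)) ->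
  is_derive t (1 : R) (fun s => \sum_(i <- r) f i s) (\sum_(i <- r) df i).
Proof.
move=> h; elim: r => [|i r IH].
  rewrite big_nil (_ : (fun s => _) = cst 0) //; first exact: is_derive_cst.
  by apply/funext => s; rewrite big_nil.
rewrite big_cons (_ : (fun s => _) = f i + (fun s => \sum_(i <- r) f i s)).
  exact: (is_deriveD (h i) IH).
by apply/funext => s; rewrite big_cons.
Qed.

Lemma is_derive_mul (f g : R -> R) t df dg : is_derive t (1 : R) f df ->
  is_derive t (1 : R) g dg -> is_derive t (1 : R) (fun s => f s * g s) (df * g t + f t * dg).
Proof.
move=> hf hg; apply: (is_derive_eq (is_deriveM hf hg)).
by rewrite /GRing.scale /= addrC (mulrC (g t)).
Qed.

Lemma is_derive_mulmx m n p (f : R -> 'M[R]_(m, n)) (g : R -> 'M[R]_(n, p)) t df dg :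
  is_derive t (1 : R) f df -> is_derive t (1 : R) g dg ->
  is_derive t (1 : R) (fun s => f s *m g s) (df *m g t + f t *m dg).
Proof.
move=> /is_derive_mxP hf /is_derive_mxP hg; apply/is_derive_mxP => i j.
rewrite (_ : (fun s => _) = fun s => \sum_k f s i k * g s k j); last first.
  by apply/funext => s; rewrite mxE.
rewrite !mxE -big_split /=; apply: is_derive_bigsum => k.
exact: is_derive_mul.
Qed.

Lemma is_derive_trmx m n (f : R -> 'M[R]_(m, n)) t df :
  is_derive t (1 : R) f df -> is_derive t (1 : R) (fun s => (f s)^T) df^T.
Proof.
move=> /is_derive_mxP hf; apply/is_derive_mxP => i j.
rewrite (_ : (fun s => _) = fun s => f s j i); first by rewrite mxE.
by apply/funext => s; rewrite mxE.
Qed.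

Lemma is_derive_mxtrace n (f : R -> 'M[R]_n) t df :
  is_derive t (1 : R) f df -> is_derive t (1 : R) (fun s => \tr (f s)) (\tr df).
Proof. by move=> /is_derive_mxP hf; apply: is_derive_bigsum. Qed.

Lemma derivable_bigprod (I : Type) (r : seq I) (f : I -> R -> R) (t : R) :
  (forall i, derivable (f i) t (1 : R)) ->
  derivable (fun s => \prod_(i <- r) f i s) t (1 : R).
Proof.
move=> h; elim: r => [|i r IH].
  rewrite (_ : (fun s => _) = cst 1); first exact: derivable_cst.
  by apply/funext => s; rewrite big_nil.
rewrite (_ : (fun s => _) = f i * (fun s => \prod_(i <- r) f i s)).
  exact: (derivableM (h i) IH).
by apply/funext => s; rewrite big_cons.
Qed.

Lemma derivable_bigsum (I : Type) (r : seq I) (f : I -> R -> R) (t : R) :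
  (forall i, derivable (f i) t (1 : R)) ->
  derivable (fun s => \sum_(i <- r) f i s) t (1 : R).
Proof.
move=> h; elim: r => [|i r IH].
  rewrite (_ : (fun s => _) = cst 0); first exact: derivable_cst.
  by apply/funext => s; rewrite big_nil.
rewrite (_ : (fun s => _) = f i + (fun s => \sum_(i <- r) f i s)).
  exact: (derivableD (h i) IH).
by apply/funext => s; rewrite big_cons.
Qed.

Lemma derivable_det n (f : R -> 'M[R]_n) (t : R) :
  (forall i j, derivable (fun s => f s i j) t (1 : R)) ->
  derivable (fun s => \det (f s)) t (1 : R).
Proof.
move=> h; apply: derivable_bigsum => s.
apply: derivableM; first exact: derivable_cst.
exact: derivable_bigprod.
Qed.

Lemma near_eq_derivable_pt (W : normedModType R) (f g : R -> W) (t : R) :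
  (\near t, f t = g t) -> derivable f t (1 : R) -> derivable g t (1 : R).
Proof. by move=> fg /derivableP/(near_eq_is_derive fg)[]. Qed.

Lemma is_derive_invmx n (f : R -> 'M[R]_n) t df : f t \in unitmx ->
  is_derive t (1 : R) f df ->
  is_derive t (1 : R) (fun s => invmx (f s)) (- (invmx (f t) *m df *m invmx (f t))).
Proof.
move=> ut hf.
have fd i j : derivable (fun s => f s i j) t (1 : R).
  by move/is_derive_mxP : hf => /(_ i j)[].
have dd := derivable_det fd.
have dt0 : \det (f t) != 0 by move: ut; rewrite unitmxE unitfE.
have nearu : \forall s \near t, f s \in unitmx.
  have : {for t, continuous (fun s => \det (f s))}.
    by apply: differentiable_continuous; apply/derivable1_diffP.
  move=> /cvgrPdist_lt /(_ `|\det (f t)|); rewrite normr_gt0 => /(_ dt0).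
  apply: filterS => s hs; rewrite unitmxE unitfE; apply/eqP => d0.
  by move: hs; rewrite d0 subr0 ltxx.
have dI : derivable (fun s => invmx (f s)) t (1 : R).
  apply/derivable_mxP => i j.
  apply: (@near_eq_derivable_pt _ (fun s => (\det (f s))^-1 * \adj (f s) i j)).
    by apply: filterS nearu => s us; rewrite /invmx us [RHS]mxE.
  apply: derivableM; first exact: derivableV.
  rewrite (_ : (fun s => _) = fun s => cofactor (f s) j i); last first.
    by apply/funext => s; rewrite mxE.
  apply: derivableM; first exact: derivable_cst.
  apply: derivable_det => k l.
  rewrite (_ : (fun s => _) = fun s => f s (lift j k) (lift i l)); first exact: fd.
  by apply/funext => s; rewrite !mxE.
have hI := derivableP dI; apply: (is_derive_eq hI).
have h1 : is_derive t (1 : R) (fun s => f s *m invmx (f s)) 0.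
  have hc := is_derive_cst (1%:M : 'M[R]_n) t (1 : R).
  apply: near_eq_is_derive hc.
  by apply: filterS nearu => s us; rewrite mulmxV.
have h2 := is_derive_mulmx hf hI.
have : df *m invmx (f t) + f t *m 'D_1 (fun s => invmx (f s)) t = 0.
  by case: h1 => _ <-; case: h2 => _ <-.
move/(congr1 (mulmx (invmx (f t)))); rewrite mulmxDr mulmx0 mulmxA.
by rewrite (mulmxA _ (f t)) mulVmx // mul1mx => /eqP; rewrite addrC addr_eq0 => /eqP.
Qed.

End MatrixDerive.

Section MatrixNorm.
Context {R : realType}.

Lemma mx_entry_le m n (A : 'M[R]_(m, n)) i j : `|A i j| <= `|A|.
Proof.
by rewrite [leRHS]/Num.Def.normr /= mx_normrE; exact: (le_bigmax _ (fun q => `|A q.1 q.2|) (i, j)).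
Qed.

Lemma mx_norm_le m n (A : 'M[R]_(m, n)) (C : R) : 0 <= C ->
  (forall i j, `|A i j| <= C) -> `|A| <= C.
Proof.
move=> C0 h; rewrite [leLHS]/Num.Def.normr /= mx_normrE.
by apply: bigmax_le => // -[i j] _; exact: h.
Qed.

Lemma mx_norm_mul m n q (A : 'M[R]_(m, n)) (B : 'M[R]_(n, q)) :
  `|A *m B| <= n%:R * (`|A| * `|B|).
Proof.
apply: mx_norm_le => [|i j]; first by rewrite !mulr_ge0.
rewrite mxE; apply: (le_trans (ler_norm_sum _ _ _)).
have -> : n%:R * (`|A| * `|B|) = \sum_(k < n) (`|A| * `|B|).
  by rewrite sumr_const card_ord mulr_natl.
by apply: ler_sum => k _; rewrite normrM ler_pM // mx_entry_le.
Qed.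

Lemma mx_norm_tr m n (A : 'M[R]_(m, n)) : `|A^T| = `|A|.
Proof.
apply/eqP; rewrite eq_le; apply/andP; split; apply: mx_norm_le => // i j.
  by rewrite mxE mx_entry_le.
by have := mx_entry_le A^T j i; rewrite mxE.
Qed.

Lemma mxtrace_le n (A : 'M[R]_n) : `|\tr A| <= n%:R * `|A|.
Proof.
apply: (le_trans (ler_norm_sum _ _ _)).
have -> : n%:R * `|A| = \sum_(k < n) `|A| by rewrite sumr_const card_ord mulr_natl.
by apply: ler_sum => k _; exact: mx_entry_le.
Qed.

End MatrixNorm.

(** * Quadratic forms, with traces as bounds for eigenvalues *)

Section QuadraticForms.
Context {R : realType}.

Lemma dotE m (u v : 'cV[R]_m) : dot u v = \sum_i u i 0 * v i 0.
Proof. by rewrite /dot mxE; apply: eq_bigr => i _; rewrite mxE. Qed.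

Lemma dotC m (u v : 'cV[R]_m) : dot u v = dot v u.
Proof. by rewrite !dotE; apply: eq_bigr => i _; rewrite mulrC. Qed.

Lemma dotDl m (u v w : 'cV[R]_m) : dot (u + v) w = dot u w + dot v w.
Proof. by rewrite /dot raddfD /= mulmxDl mxE. Qed.

Lemma dotDr m (u v w : 'cV[R]_m) : dot u (v + w) = dot u v + dot u w.
Proof. by rewrite /dot mulmxDr mxE. Qed.

Lemma dotZl m c (u v : 'cV[R]_m) : dot (c *: u) v = c * dot u v.
Proof. by rewrite /dot linearZ /= -scalemxAl mxE. Qed.

Lemma dotZr m c (u v : 'cV[R]_m) : dot u (c *: v) = c * dot u v.
Proof. by rewrite /dot -scalemxAr mxE. Qed.

Lemma dotNl m (u v : 'cV[R]_m) : dot (- u) v = - dot u v.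
Proof. by rewrite -scaleN1r dotZl mulN1r. Qed.

Lemma dotNr m (u v : 'cV[R]_m) : dot u (- v) = - dot u v.
Proof. by rewrite -scaleN1r dotZr mulN1r. Qed.

Lemma dotBr m (u v w : 'cV[R]_m) : dot u (v - w) = dot u v - dot u w.
Proof. by rewrite dotDr dotNr. Qed.

Lemma dotBl m (u v w : 'cV[R]_m) : dot (u - v) w = dot u w - dot v w.
Proof. by rewrite dotDl dotNl. Qed.

Lemma dot0r m (u : 'cV[R]_m) : dot u 0 = 0.
Proof. by rewrite /dot mulmx0 mxE. Qed.

Lemma dot_mulmxr m n (A : 'M[R]_(m, n)) u v : dot u (A *m v) = dot (A^T *m u) v.
Proof. by rewrite /dot trmx_mul trmxK mulmxA. Qed.

Lemma dot_gt0 m (u : 'cV[R]_m) : u != 0 -> 0 < dot u u.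
Proof.
by move=> u0; rewrite lt_neqAle dot_ge0 andbT eq_sym; apply: contra_neq u0; exact: dot_eq0.
Qed.

Definition psd m (A : 'M[R]_m) := A^T = A /\ forall u, 0 <= quadform A u.

(** The form is nonnegative at [u + s *: v] for all [s]. If it vanishes at [v], this is affine in
    [s] and the slope must be 0; otherwise [s] is taken to be the minimizer. *)
Lemma psd_cauchy m (A : 'M[R]_m) u v : psd A ->
  dot u (A *m v) ^+ 2 <= quadform A u * quadform A v.
Proof.
move=> [sA pA]; set b := dot u (A *m v).
have qE s : quadform A (u + s *: v) = quadform A u + 2 * s * b + s ^+ 2 * quadform A v.
  rewrite /quadform mulmxDr !dotDl !dotDr -!scalemxAr !dotZl !dotZr.
  by rewrite [dot v _]dot_mulmxr sA [dot (_ *m v) u]dotC -/b; ring.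
have q0 s : 0 <= quadform A u + 2 * s * b + s ^+ 2 * quadform A v by rewrite -qE.
have [v0|v0] := eqVneq (quadform A v) 0.
  rewrite v0 mulr0; have [->|b0] := eqVneq b 0; first by rewrite expr0n.
  have := q0 (- (quadform A u + 1) / (2 * b)).
  rewrite v0 mulr0 addr0 (_ : 2 * _ * b = - (quadform A u + 1)); last first.
    by field.
  by move=> h; exfalso; clear -h; lra.
have vp : 0 < quadform A v by rewrite lt_neqAle eq_sym v0 pA.
have := q0 (- b / quadform A v).
rewrite (_ : _ + _ + _ = quadform A u - b ^+ 2 / quadform A v); last by field.
by rewrite subr_ge0 ler_pdivrMr.
Qed.

Lemma psd1 m : psd (1%:M : 'M[R]_m).
Proof. by split; [rewrite trmx1|move=> u; rewrite /quadform mul1mx dot_ge0]. Qed.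

Lemma dot_cauchy m (u v : 'cV[R]_m) : dot u v ^+ 2 <= dot u u * dot v v.
Proof. by have := psd_cauchy u v (psd1 m); rewrite /quadform !mul1mx. Qed.

Lemma dot_young m (u v : 'cV[R]_m) (s : R) : 0 < s ->
  2 * dot u v <= s * dot u u + s^-1 * dot v v.
Proof.
move=> s0; have := dot_ge0 (s *: u - v).
rewrite dotBl !dotBr !dotZl !dotZr (dotC v u) => h.
have : 0 <= s^-1 * (s * (s * dot u u) - s * dot u v - (s * dot u v - dot v v)).
  by rewrite mulr_ge0 // invr_ge0 ltW.
rewrite (_ : s^-1 * _ = s * dot u u + s^-1 * dot v v - 2 * dot u v) ?subr_ge0 //.
by field; rewrite gt_eqF.
Qed.

Definition unit_col m (i : 'I_m) : 'cV[R]_m := delta_mx i 0.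

Lemma dot_unit_col m (i : 'I_m) (u : 'cV[R]_m) : dot (unit_col i) u = u i 0.
Proof.
rewrite dotE (bigD1 i) //= big1 ?addr0 => [|j ji]; rewrite mxE !eqxx ?mul1r //.
by rewrite (negPf ji) mul0r.
Qed.

Lemma mulmx_unit_col m n (A : 'M[R]_(m, n)) j : A *m unit_col j = col j A.
Proof. by rewrite colE. Qed.

Lemma quadform_unit_col m (A : 'M[R]_m) i : quadform A (unit_col i) = A i i.
Proof. by rewrite /quadform dot_unit_col mulmx_unit_col mxE. Qed.

Lemma psd_diag_ge0 m (A : 'M[R]_m) i : psd A -> 0 <= A i i.
Proof. by move=> [_ h]; rewrite -quadform_unit_col. Qed.

Lemma psd_tr_ge0 m (A : 'M[R]_m) : psd A -> 0 <= \tr A.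
Proof. by move=> h; apply: sumr_ge0 => i _; exact: psd_diag_ge0. Qed.

(** Each coordinate of [A *m u] is a pairing with a basis vector, so Cauchy-Schwarz for [A] bounds
    its square by [A i i] times the form; the trace stands for the largest eigenvalue. *)
Lemma psd_dot_le m (A : 'M[R]_m) u : psd A ->
  dot (A *m u) (A *m u) <= \tr A * quadform A u.
Proof.
move=> pA; rewrite dot_sum /mxtrace mulr_suml; apply: ler_sum => i _.
by have := psd_cauchy (unit_col i) u pA; rewrite dot_unit_col quadform_unit_col.
Qed.

Lemma psd_quadform_le m (A : 'M[R]_m) u : psd A -> quadform A u <= \tr A * dot u u.
Proof.
move=> pA; have [/eqP->|q0] := boolP (quadform A u == 0).
  by rewrite mulr_ge0 ?dot_ge0 ?psd_tr_ge0.
have qp : 0 < quadform A u by case: (pA) => _ h; rewrite lt_neqAle eq_sym q0 h.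
have h1 := dot_cauchy u (A *m u); have h2 := psd_dot_le u pA.
have h3 := ler_wpM2l (dot_ge0 u) h2.
rewrite -(ler_pM2r qp) -expr2; apply: (le_trans h1); apply: (le_trans h3).
by rewrite mulrCA mulrA.
Qed.

Lemma psd_entry_le m (A : 'M[R]_m) i j : psd A -> `|A i j| <= \tr A.
Proof.
move=> pA; have := psd_cauchy (unit_col i) (unit_col j) pA.
rewrite dot_unit_col mulmx_unit_col mxE !quadform_unit_col.
have hk k : A k k <= \tr A.
  rewrite /mxtrace (bigD1 k) //= lerDl; apply: sumr_ge0 => l _; exact: psd_diag_ge0.
have tr0 := psd_tr_ge0 pA => h.
rewrite -(ler_pXn2r (n := 2)) ?nnegrE // real_normK ?num_real //.
by apply: (le_trans h); rewrite expr2 ler_pM // psd_diag_ge0.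
Qed.

Lemma psd_trM_le m (S A : 'M[R]_m) : psd S -> `|\tr (S *m A)| <= m%:R ^+ 2 * `|A| * \tr S.
Proof.
move=> pS; apply: (le_trans (mxtrace_le _)).
rewrite expr2 -!mulrA ler_wpM2l //; apply: (le_trans (mx_norm_mul _ _)).
rewrite ler_wpM2l // mulrC ler_wpM2l //.
by apply: mx_norm_le => [|i j]; [exact: psd_tr_ge0|exact: psd_entry_le].
Qed.

Lemma mxtrace_congr m n (S : 'M[R]_(m, n)) (A : 'M[R]_m) :
  \tr (S^T *m A *m S) = \sum_j quadform A (col j S).
Proof.
apply: eq_bigr => j _; rewrite /quadform /dot mulmxA !mxE.
apply: eq_bigr => k _; rewrite !mxE; congr (_ * _).
by apply: eq_bigr => l _; rewrite !mxE.
Qed.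

Lemma sqr_sum_le (n : nat) (f : 'I_n -> R) : (\sum_i f i) ^+ 2 <= n%:R * \sum_i f i ^+ 2.
Proof.
pose u : 'cV[R]_n := \col_i f i.
have := dot_cauchy (const_mx 1 : 'cV[R]_n) u.
rewrite !dotE; congr (_ ^+ 2 <= _ * _).
- by apply: eq_bigr => i _; rewrite !mxE mul1r.
- by rewrite (eq_bigr (fun=> 1)) ?sumr_const ?card_ord // => i _; rewrite mxE mulr1.
- by apply: eq_bigr => i _; rewrite mxE expr2.
Qed.

(** The trace is the sum of the forms at the columns of [S], each at least [c] times the square of
    the diagonal entry, and these squares sum to at least the square of the trace over [n]. This is
    the quadratic damping in both trace estimates for the Riccati equation. *)
Lemma mxtrace_congr_ge n (S A : 'M[R]_n) (c : R) : 0 <= c ->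
  (forall u, c * dot u u <= quadform A u) ->
  c * (\tr S) ^+ 2 <= n%:R * \tr (S^T *m A *m S).
Proof.
move=> c0 hc; rewrite mxtrace_congr.
apply: (@le_trans _ _ (c * (n%:R * \sum_i S i i ^+ 2))).
  by rewrite ler_wpM2l // sqr_sum_le.
rewrite mulrCA ler_wpM2l // mulr_sumr; apply: ler_sum => i _.
apply: le_trans (hc _); rewrite ler_wpM2l // dot_sum (bigD1 i) //= mxE lerDl.
by apply: sumr_ge0 => k _; exact: sqr_ge0.
Qed.

Definition posdef_ge m (c : R) (A : 'M[R]_m) :=
  [/\ A^T = A, 0 < c & forall u, c * dot u u <= quadform A u].

Lemma posdef_ge_psd m c (A : 'M[R]_m) : posdef_ge c A -> psd A.
Proof.
move=> [sA c0 hA]; split=> // u; apply: le_trans (hA u).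
by rewrite mulr_ge0 ?dot_ge0 // ltW.
Qed.

Lemma pos_def_unit m (A : 'M[R]_m) : pos_def A -> A \in unitmx.
Proof.
move=> [sA pA]; rewrite unitmxE unitfE; apply/det0P => -[v v0 vA].
have /pA : v^T != 0 by apply: contra_neq v0 => /(congr1 trmx); rewrite trmxK trmx0.
by rewrite /quadform dot_mulmxr -trmx_mul vA trmx0 dotC dot0r ltxx.
Qed.

Lemma posdef_ge_pos_def m c (A : 'M[R]_m) : posdef_ge c A -> pos_def A.
Proof.
move=> [sA c0 hA]; split=> // u u0; apply: lt_le_trans (hA u).
by rewrite mulr_gt0 // dot_gt0.
Qed.

Lemma invmx_sym m (A : 'M[R]_m) : A^T = A -> (invmx A)^T = invmx A.
Proof. by move=> sA; rewrite trmx_inv sA. Qed.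

Lemma quadform_invmx m (A : 'M[R]_m) u : A^T = A -> A \in unitmx ->
  quadform (invmx A) u = quadform A (invmx A *m u).
Proof.
by move=> sA uA; rewrite /quadform (mulmxA A) mulmxV // mul1mx dotC.
Qed.

Lemma pos_def_inv_psd m (A : 'M[R]_m) : pos_def A -> psd (invmx A).
Proof.
move=> pA; have uA := pos_def_unit pA; case: pA => sA pA; split; first exact: invmx_sym.
move=> u; rewrite quadform_invmx //; have [->|h] := eqVneq (invmx A *m u) 0.
  by rewrite /quadform mulmx0 dot0r.
exact/ltW/pA.
Qed.

Lemma pos_def_psd m (A : 'M[R]_m) : pos_def A -> psd A.
Proof.
move=> [sA pA]; split => // u; have [->|h] := eqVneq u 0.
  by rewrite /quadform mulmx0 dot0r.
exact/ltW/pA.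
Qed.

(** [psd_dot_le] at [invmx A *m u]: an upper bound on the trace of [A] is a lower bound on its
    inverse. *)
Lemma dot_le_quadform_inv m (A : 'M[R]_m) u : pos_def A ->
  dot u u <= \tr A * quadform (invmx A) u.
Proof.
move=> pA; have uA := pos_def_unit pA.
have := psd_dot_le (invmx A *m u) (pos_def_psd pA).
by rewrite mulmxA mulmxV // mul1mx quadform_invmx //; case: pA.
Qed.

Lemma dot_le_trinv m (A : 'M[R]_m) u : pos_def A ->
  dot u u <= \tr (invmx A) * quadform A u.
Proof.
move=> pA; have uA := pos_def_unit pA.
have := psd_dot_le (A *m u) (pos_def_inv_psd pA).
rewrite mulmxA mulVmx // mul1mx quadform_invmx ?mulmxA ?mulVmx ?mul1mx //.
by case: pA.
Qed.

Lemma quadform_inv_le_dot m (A : 'M[R]_m) u : pos_def A ->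
  quadform (invmx A) u <= \tr A * dot (invmx A *m u) (invmx A *m u).
Proof.
move=> pA; rewrite quadform_invmx ?psd_quadform_le //; first exact: pos_def_psd.
- by case: pA.
- exact: pos_def_unit.
Qed.

Lemma pos_def_ge m (A : 'M[R]_m) : pos_def A -> exists c, posdef_ge c A.
Proof.
move=> pA; have t0 : 0 < \tr (invmx A) + 1.
  by rewrite ltr_wpDl // psd_tr_ge0 //; exact: pos_def_inv_psd.
exists (\tr (invmx A) + 1)^-1; split; [by case: pA|by rewrite invr_gt0|] => u.
rewrite ler_pdivrMl // mulrDl mul1r; have := dot_le_trinv u pA.
by have [_ /(_ u)] := pos_def_psd pA; lra.
Qed.

(** For a diagonal entry [q] of the inverse and its column [w], [c * q^2 <= c * dot w w <= q], so
    [q] is at most [c^-1]. *)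
Lemma posdef_ge_trinv m c (A : 'M[R]_m) : posdef_ge c A -> \tr (invmx A) <= m%:R / c.
Proof.
move=> h; have pA := posdef_ge_pos_def h; have uA := pos_def_unit pA.
have [sA c0 hA] := h.
have -> : m%:R / c = \sum_(i < m) c^-1 by rewrite sumr_const card_ord mulr_natl.
apply: ler_sum => i _; rewrite -quadform_unit_col; set q := quadform _ _.
set w := invmx A *m unit_col i.
have h1 : c * dot w w <= q by rewrite /q quadform_invmx.
have : q ^+ 2 <= dot w w.
  have db : dot (unit_col i) (unit_col i) = 1 :> R by rewrite dot_unit_col mxE !eqxx.
  have := dot_cauchy (unit_col i) w; rewrite db mul1r dot_unit_col.
  by rewrite (_ : w i 0 = q) // /q quadform_unit_col /w mulmx_unit_col mxE.
have q0 : 0 <= q by have [_ /(_ (unit_col i))] := pos_def_inv_psd pA.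
move=> h2; rewrite -(mul1r c^-1) ler_pdivlMr //.
have h3 : c * q ^+ 2 <= q by apply: le_trans h1; rewrite ler_wpM2l // ltW.
have [->|qn] := eqVneq q 0; first by rewrite mul0r.
have qp : 0 < q by rewrite lt_neqAle eq_sym qn.
by rewrite -(ler_pM2r qp) mul1r; move: h3; rewrite expr2; lra.
Qed.

End QuadraticForms.

(** * Bounds on the Riccati solution *)

Section GrowthBounds.
Context {R : realType}.

Lemma within_continuousD (A : set R) (f g : R -> R) : {within A, continuous f} ->
  {within A, continuous g} -> {within A, continuous (fun t => f t + g t)}.
Proof. by move=> cf cg x; apply: continuousD; [exact: cf|exact: cg]. Qed.

Lemma within_continuousM (A : set R) (f g : R -> R) : {within A, continuous f} ->
  {within A, continuous g} -> {within A, continuous (fun t => f t * g t)}.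
Proof. by move=> cf cg x; apply: continuousM; [exact: cf|exact: cg]. Qed.

Lemma within_continuous_cst (A : set R) (c : R) : {within A, continuous (fun=> c)}.
Proof. by move=> x; exact: cvg_cst. Qed.

Lemma within_continuous_sum (A : set R) (I : Type) (r : seq I) (f : I -> R -> R) :
  (forall i, {within A, continuous (f i)}) ->
  {within A, continuous (fun t => \sum_(i <- r) f i t)}.
Proof.
move=> h; elim: r => [|i r IH].
  rewrite (_ : (fun t => _) = fun=> 0); first exact: within_continuous_cst.
  by apply/funext => s; rewrite big_nil.
rewrite (_ : (fun t => _) = fun t => f i t + \sum_(i <- r) f i t).
  exact: within_continuousD.
by apply/funext => s; rewrite big_cons.
Qed.

Lemma within_continuous_entry (A : set R) m n (f : R -> 'M[R]_(m, n)) i j :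
  {within A, continuous f} -> {within A, continuous (fun t => f t i j)}.
Proof.
apply: (within_continuous_lip (C := 1)) => x y _ _.
by have := mx_entry_le (f x - f y) i j; rewrite !mxE mul1r.
Qed.

Lemma within_continuous_expR (A : set R) (l : R) :
  {within A, continuous (fun t => expR (l * t))}.
Proof.
apply: continuous_subspaceT => t; apply: differentiable_continuous.
by apply/derivable1_diffP; case: (is_derive_expR_scale l t).
Qed.

(** The step at [T] has to give the property at [T] itself and a little beyond; for [T = a] its
    premise is empty, which is the base case. *)
Lemma real_induction (G : R -> Prop) (a b : R) :
  (forall T, a <= T <= b -> (forall t, a <= t < T -> G t) ->
     exists2 d, 0 < d & forall t, T <= t -> t < T + d -> t <= b -> G t) ->
  forall t, a <= t <= b -> G t.
Proof.
move=> step t1 /andP[at1 t1b].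
pose S := [set T | a <= T <= t1 /\ forall t, a <= t < T -> G t].
have Sa : S a by split; [rewrite lexx|move=> t; lra].
have supS : has_sup S by split; [exists a|exists t1 => x [/andP[]]].
have aS : a <= sup S by exact: ub_le_sup (proj2 supS) _ Sa.
have St1 : sup S <= t1 by apply: ge_sup; [exists a|move=> x [/andP[]]].
have GS t : a <= t < sup S -> G t.
  move=> /andP[a_t tS]; have St0 : 0 < sup S - t by lra.
  have [T [_ GT] ?] := sup_adherent St0 supS.
  by apply: GT; rewrite a_t /=; lra.
have [||d d0 hd] := step (sup S); [by rewrite aS (le_trans St1)|exact: GS|].
apply: (hd t1) => //.
rewrite ltNge; apply/negP => h.
have : S (sup S + d / 2).
  split; first by apply/andP; split; lra.
  move=> t /andP[a_t tS]; case: (ltP t (sup S)) => tS'; first by apply: GS; rewrite a_t.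
  by apply: (hd t) => //; lra.
by move/(ub_le_sup (proj2 supS)); lra.
Qed.

(** The product of [f] with [expR (- K * t)] has nonpositive derivative, so [barrier] applies at
    level 0. *)
Lemma gronwall_zero (f : R -> R) (T K : R) : {within `[0, T], continuous f} -> f 0 <= 0 ->
  (forall t, 0 < t < T -> exists2 d, is_derive t (1 : R) f d & d <= K * f t) ->
  forall t, 0 <= t <= T -> f t <= 0.
Proof.
move=> cf f0 df t tT.
have : expR (- K * t) * f t <= 0.
  apply: (barrier (a := 0) (T := T) (f := fun t => expR (- K * t) * f t)) tT.
  - by apply: within_continuousM => //; exact: within_continuous_expR.
  - by rewrite mulr0 expR0 mul1r.
  - move=> s sT _; have [d hd dK] := df s sT.
    exists (- K * expR (- K * s) * f s + expR (- K * s) * d).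
      exact: (is_derive_mul (is_derive_expR_scale (- K) s) hd).
    have := ler_wpM2l (ltW (expR_gt0 (- K * s))) dK; lra.
by rewrite pmulr_rle0 // expR_gt0.
Qed.

Lemma quadform_norm_le m (A : 'M[R]_m) u : `|quadform A u| <= m%:R * `|A| * dot u u.
Proof.
have -> : quadform A u = \sum_i \sum_j u i 0 * A i j * u j 0.
  rewrite /quadform dotE; apply: eq_bigr => i _; rewrite mxE mulr_sumr.
  by apply: eq_bigr => j _; rewrite mulrA.
apply: (@le_trans _ _ (`|A| * (\sum_i `|u i 0|) ^+ 2)).
  apply: (le_trans (ler_norm_sum _ _ _)).
  rewrite expr2 mulrCA mulr_suml; apply: ler_sum => i _.
  apply: (le_trans (ler_norm_sum _ _ _)).
  rewrite !mulr_sumr; apply: ler_sum => j _; rewrite !normrM -mulrA.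
  by rewrite ler_wpM2l // ler_wpM2r // mx_entry_le.
rewrite (mulrC m%:R) -mulrA ler_wpM2l //.
apply: (le_trans (sqr_sum_le _)); rewrite ler_wpM2l // dot_sum.
by apply: ler_sum => i _; rewrite real_normK ?num_real.
Qed.

Lemma mx_norm_sqr_le m n (A : 'M[R]_(m, n)) : `|A| ^+ 2 <= \tr (A^T *m A).
Proof.
have E : \tr (A^T *m A) = \sum_j \sum_i A i j ^+ 2.
  apply: eq_bigr => j _; rewrite mxE; apply: eq_bigr => i _.
  by rewrite mxE expr2.
have ge i j : A i j ^+ 2 <= \tr (A^T *m A).
  rewrite E (bigD1 j) //= (bigD1 i) //= -addrA lerDl addr_ge0 //.
    by apply: sumr_ge0 => k _; exact: sqr_ge0.
  by apply: sumr_ge0 => k _; apply: sumr_ge0 => l _; exact: sqr_ge0.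
have tr0 : 0 <= \tr (A^T *m A).
  by rewrite E; apply: sumr_ge0 => k _; apply: sumr_ge0 => l _; exact: sqr_ge0.
rewrite -(sqr_sqrtr tr0) ler_pXn2r ?nnegrE ?sqrtr_ge0 //.
apply: mx_norm_le => [|i j]; first exact: sqrtr_ge0.
by rewrite -sqrtr_sqr ler_wsqrtr.
Qed.

Lemma mxtrace_skew_sym m (O X : 'M[R]_m) : O^T = - O -> X^T = X -> \tr (O *m X) = 0.
Proof.
move=> sO sX; have : \tr (O *m X) = - \tr (O *m X).
  rewrite -[LHS]mxtrace_tr trmx_mul sX sO mxtrace_mulC mulNmx.
  exact: (raddfN (@mxtrace R m)).
move=> h; have : \tr (O *m X) *+ 2 = 0 by rewrite mulr2n {1}h addNr.
by move/eqP; rewrite mulrn_eq0 /= => /eqP.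
Qed.

End GrowthBounds.

(** [S] is not assumed symmetric; the quadratic terms are arranged so that [S - S^T] is a factor of
    each, which makes the skew part of a solution obey a linear equation. *)
Lemma riccati_rhs_skew (R : realType) m (A S G V : 'M[R]_m) : G^T = G -> V^T = V ->
  let F := A *m S + S *m A^T - S *m G *m S + V in
  F - F^T = A *m (S - S^T) + (S - S^T) *m A^T -
    ((S - S^T) *m G *m S + S^T *m G *m (S - S^T)).
Proof.
move=> Gs Vs F; rewrite /F.
have -> : (A *m S + S *m A^T - S *m G *m S + V)^T =
    S^T *m A^T + A *m S^T - S^T *m G *m S^T + V.
  by rewrite !(raddfD, raddfN) /= !trmx_mul !trmxK Gs Vs !mulmxA.
rewrite !mulmxBr !mulmxBl.
by apply/matrixP => i j; rewrite !mxE; ring.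
Qed.

(** Right-hand side of the equation of the inverse: [G] becomes a source and [V] a quadratic
    damping, so a lower bound on [P] can be read off the trace of its inverse. *)
Lemma riccati_rhs_inv (R : realType) m (A S G V : 'M[R]_m) : S \in unitmx ->
  - (invmx S *m (A *m S + S *m A^T - S *m G *m S + V) *m invmx S) =
  - (invmx S *m A) - A^T *m invmx S + G - invmx S *m V *m invmx S.
Proof.
move=> uS; rewrite !(mulmxDr, mulmxDl, mulmxBl, mulmxBr, mulmxN, mulNmx).
rewrite -!mulmxA !mulmxV // !mulmx1 !(mulKmx uS).
by apply/matrixP => i j; rewrite !mxE; ring.
Qed.

Definition output_gram (R : realType) (Q : R -> 'M[R]_3) (t : R) : 'M[R]_6 :=
  CC^T *m Q t *m CC.

Section Riccati.
Context {R : realType}.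
Variables (omega : R -> 'cV[R]_3) (Q : R -> 'M[R]_3) (V P : R -> 'M[R]_6).
Hypotheses (hA : bounded_mx (AA omega)) (hQ : unif_pos_def Q) (hQb : bounded_mx Q)
  (hV : unif_pos_def V) (hVb : bounded_mx V) (hP0 : pos_def (P 0))
  (hP : riccati omega Q V P).

Local Notation A := (AA omega).
Local Notation G := (output_gram Q).
Local Notation F t S := (A t *m S + S *m (A t)^T - S *m G t *m S + V t).

Lemma riccati_derive (t : R) : 0 < t -> is_derive t (1 : R) P (F t (P t)).
Proof.
by move=> t0; have [_ /(_ t t0)] := hP; rewrite /output_gram !mulmxA.
Qed.

Lemma riccati_continuous (T : R) : {within `[0, T], continuous P}.
Proof.
case: hP => cP _; apply: within_continuous_sub cP => x /=.
by rewrite !in_itv /= => /andP[-> _].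
Qed.

Lemma bounded_mx_gt0 m n (B : R -> 'M[R]_(m.+1, n.+1)) : bounded_mx B ->
  exists2 C : R, 0 < C & forall t, 0 <= t -> `|B t| <= C.
Proof.
move=> [C hC]; exists (`|C| + 1); first by rewrite ltr_wpDl.
by move=> t t0; have := hC t t0; have := ler_norm C; lra.
Qed.

Lemma output_gram_sym (t : R) : 0 <= t -> (G t)^T = G t.
Proof.
by move=> t0; rewrite /output_gram !trmx_mul trmxK (proj1 hQ t t0) mulmxA.
Qed.

Lemma output_gram_bound : exists2 C : R, 0 < C & forall t, 0 <= t -> `|G t| <= C.
Proof.
have [q q0 hq] := bounded_mx_gt0 hQb.
pose c : R := `|CC^T : 'M[R]_(6, 3)|; pose d : R := `|CC : 'M[R]_(3, 6)|.
have cd0 : 0 <= c /\ 0 <= d by split; exact: normr_ge0.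
exists (3 * ((3 * (c * q)) * d) + 1).
  by case: cd0 => c0 d0; rewrite ltr_wpDl // !mulr_ge0 // ltW.
move=> t t0; apply: (le_trans (mx_norm_mul _ _)).
rewrite -[leLHS]addr0 lerD // ler_wpM2l // ler_wpM2r //.
apply: (le_trans (mx_norm_mul _ _)).
by rewrite ler_wpM2l // ler_wpM2l // hq.
Qed.

(** Symmetry is given at time 0. The difference of [P] and its transpose obeys a linear equation
    with zero initial value, and its squared Frobenius norm [f] is 0 by Gronwall on [[0, t]], where
    [P] is bounded. *)
Lemma riccati_sym (t : R) : 0 <= t -> (P t)^T = P t.
Proof.
move=> t0.
have [a a0 ha] := bounded_mx_gt0 hA.
have [s s0 hs] := output_gram_bound.
have [b b0 hb] := within_bounded (@riccati_continuous t).
pose D u := P u - (P u)^T.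
pose f u := \tr ((D u)^T *m D u).
suff : f t <= 0.
  move=> ft; have : `|D t| ^+ 2 <= 0 by apply: le_trans ft; exact: mx_norm_sqr_le.
  have [/eqP|Dn] := boolP (D t == 0).
    by rewrite /D => /eqP; rewrite subr_eq0 => /eqP.
  by rewrite le_eqVlt ltNge sqr_ge0 orbF sqrf_eq0 normr_eq0 (negPf Dn).
(* The bracket bounds the norm of [dD] by a multiple of that of [D u]. The factor 12 is 2 for two
   equal traces times 6 for a trace against the sup norm; the last 6 is for a matrix product. *)
pose K := 12 * (6 * a + 6 * a + (6 * (6 * s * b) + 6 * (6 * b * s))) * 6.
apply: (@gronwall_zero _ f t K); last by rewrite t0 lexx.
- rewrite (_ : f = fun u => \sum_j \sum_i (D u i j * D u i j)); last first.
    apply/funext => u; apply: eq_bigr => j _; rewrite mxE; apply: eq_bigr => i _.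
    by rewrite mxE.
  apply: within_continuous_sum => j; apply: within_continuous_sum => i.
  have cD : {within `[0, t], continuous (fun u => D u i j)}.
    apply: (within_continuous_lip (C := 2)) (@riccati_continuous t) => x y _ _.
    rewrite (_ : D x i j - D y i j = (P x - P y) i j - (P x - P y) j i); last first.
      by rewrite !mxE; ring.
    apply: (le_trans (ler_normB _ _)).
    by have := mx_entry_le (P x - P y) i j; have := mx_entry_le (P x - P y) j i; lra.
  exact: within_continuousM.
- by rewrite /f /D (proj1 hP0) subrr trmx0 mul0mx mxtrace0.
move=> u /andP[u0 ut]; pose dD := F u (P u) - (F u (P u))^T.
have hD : is_derive u (1 : R) D dD.
  exact: (is_deriveB (riccati_derive u0) (is_derive_trmx (riccati_derive u0))).
exists (\tr (dD^T *m D u + (D u)^T *m dD)).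
  exact: (is_derive_mxtrace (is_derive_mulmx (is_derive_trmx hD) hD)).
have dDE : dD = A u *m D u + D u *m (A u)^T
    - (D u *m G u *m P u + (P u)^T *m G u *m D u).
  apply: riccati_rhs_skew; first exact: output_gram_sym (ltW u0).
  by apply: (proj1 hV); exact: ltW.
set d := `|D u|; have d0 : 0 <= d by exact: normr_ge0.
have trD : `|(D u)^T| = d by exact: mx_norm_tr.
have nA : `|A u| <= a by apply: ha; exact: ltW.
have nAT : `|(A u)^T| <= a by rewrite mx_norm_tr.
have nG : `|G u| <= s by apply: hs; exact: ltW.
have nP : `|P u| <= b by apply: hb; rewrite !ltW.
have nPT : `|(P u)^T| <= b by rewrite mx_norm_tr.
have M2 (X Y : 'M[R]_6) (x y : R) : `|X| <= x -> `|Y| <= y -> `|X *m Y| <= 6 * (x * y).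
  move=> hX hY; apply: (le_trans (mx_norm_mul _ _)); rewrite ler_wpM2l //.
  by rewrite ler_pM.
have hDd : `|D u| <= d by [].
have ndD : `|dD| <= (6 * a + 6 * a + (6 * (6 * s * b) + 6 * (6 * b * s))) * d.
  rewrite dDE; apply: (le_trans (ler_normB _ _)); rewrite mulrDl; apply: lerD.
    apply: (le_trans (ler_normD _ _)).
    by have := M2 _ _ _ _ nA hDd; have := M2 _ _ _ _ hDd nAT; lra.
  apply: (le_trans (ler_normD _ _)).
  have := M2 _ _ _ _ (M2 _ _ _ _ hDd nG) nP.
  by have := M2 _ _ _ _ (M2 _ _ _ _ nPT nG) hDd; lra.
have tr1 : \tr (dD^T *m D u + (D u)^T *m dD) = 2 * \tr ((D u)^T *m dD).
  rewrite mxtraceD -(mxtrace_tr (dD^T *m D u)) trmx_mul trmxK; ring.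
rewrite tr1; apply: (@le_trans _ _ (K * d ^+ 2)).
  have h1 := mxtrace_le ((D u)^T *m dD).
  have h2 := M2 _ _ _ _ (lexx `|(D u)^T|) ndD.
  have h3 := ler_norm (\tr ((D u)^T *m dD)).
  rewrite trD in h2; rewrite /K expr2.
  clear -h1 h2 h3; lra.
rewrite ler_wpM2l //; last exact: mx_norm_sqr_le.
by rewrite /K !mulr_ge0 // ?addr_ge0 ?mulr_ge0 // ltW.
Qed.

Lemma riccati_inv_derive (t : R) : 0 < t -> P t \in unitmx ->
  is_derive t (1 : R) (fun u => invmx (P u))
    (- (invmx (P t) *m A t) - (A t)^T *m invmx (P t) + G t
     - invmx (P t) *m V t *m invmx (P t)).
Proof.
move=> t0 uP; apply: (is_derive_eq (is_derive_invmx uP (riccati_derive t0))).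
exact: riccati_rhs_inv.
Qed.

(** The difference of two inverses is a product with the difference of the matrices in the middle,
    and both inverses are bounded by [6 / c]. *)
Lemma within_continuous_inv (B : set R) (c : R) : {within B, continuous P} ->
  (forall t, B t -> posdef_ge c (P t)) -> {within B, continuous (fun t => invmx (P t))}.
Proof.
move=> cB hB.
apply: (within_continuous_lip (C := 6 * (6 * (6 / c) * (6 / c)))) cB => x y Bx By.
have nS t : B t -> `|invmx (P t)| <= 6 / c.
  move=> /hB h; have pS := pos_def_inv_psd (posdef_ge_pos_def h).
  have tS := posdef_ge_trinv h.
  apply: mx_norm_le => [|i j]; first by apply: le_trans tS; exact: psd_tr_ge0.
  by apply: le_trans tS; exact: psd_entry_le.
have ux := pos_def_unit (posdef_ge_pos_def (hB _ Bx)).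
have uy := pos_def_unit (posdef_ge_pos_def (hB _ By)).
have -> : invmx (P x) - invmx (P y) = - (invmx (P x) *m (P x - P y) *m invmx (P y)).
  by rewrite mulmxBr mulVmx // mulmxBl mul1mx -mulmxA mulmxV // mulmx1 opprB.
have k0 : 0 <= 6 / c by apply: le_trans (nS _ Bx).
have {nS} := (nS _ Bx, nS _ By); move: (6 / c) k0 => k k0 [nx ny].
rewrite normrN; apply: (le_trans (mx_norm_mul _ _)).
have h := mx_norm_mul (invmx (P x)) (P x - P y).
apply: (@le_trans _ _ (6 * ((6 * (k * `|P x - P y|)) * k))); last by lra.
rewrite ler_wpM2l // ler_pM // (le_trans h) // ler_wpM2l //.
by rewrite ler_wpM2r.
Qed.

(* While P >= c I, the trace of P^-1 obeys a logistic inequality and stays below [B];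
   this gives back the stronger bound P >= B^-1 I = 2 c I, which continuity
   propagates as P >= c I a little further. *)
Lemma riccati_lower : exists c : R, forall t, 0 <= t -> posdef_ge c (P t).
Proof.
have [a a0 ha] := bounded_mx_gt0 hA.
have [s s0 hs] := output_gram_bound.
have [Vs [v v0 hv]] := hV.
(* For the trace [x] of the inverse, [l * x] bounds the growth when [1 <= x]: [36 * a] for each of
   the two terms with [A], and [6 * s] for [G]. The summands of [B] give in turn [1 <= x], the
   dominance of the damping [v / 6 * x ^+ 2] over [l * x] above [B], and the initial value. *)
pose l := 72 * a + 6 * s.
pose B := 1 + 6 * l / v + \tr (invmx (P 0)).
have l0 : 0 < l by rewrite addr_gt0 // mulr_gt0.
have trS0 : 0 <= \tr (invmx (P 0)) by apply: psd_tr_ge0; exact: pos_def_inv_psd.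
have lv0 : 0 < 6 * l / v by rewrite divr_gt0 // mulr_gt0.
have B1 : 1 <= B by rewrite /B; lra.
have B0 : 0 < B by apply: lt_le_trans B1.
pose c := (2 * B)^-1.
have c0 : 0 < c by rewrite invr_gt0 mulr_gt0.
have cB : B^-1 = 2 * c by rewrite /c; field; rewrite gt_eqF.
have lower t : (P t)^T = P t -> pos_def (P t) -> \tr (invmx (P t)) <= B ->
    forall u, 2 * c * dot u u <= quadform (P t) u.
  move=> sP pP trB u; rewrite -cB ler_pdivrMl //.
  apply: (le_trans (dot_le_trinv u pP)); rewrite ler_wpM2r //.
  by have [_ /(_ u)] := pos_def_psd pP.
exists c => t1 t10.
have t1t1 : 0 <= t1 <= t1 by rewrite t10 lexx.
apply: (@real_induction _ (fun t => posdef_ge c (P t)) 0 t1 _ t1 t1t1).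
move=> T /andP[T0 Tt1] good.
have sT : (P T)^T = P T by exact: riccati_sym.
have [d d0 hd] : exists2 d : R, 0 < d & forall t, T <= t -> t < T + d -> 
    6 * `|P T - P t| < c.
  have /within_continuousP := proj1 hP => /(_ T _ (c / 6)) [||d d0 hd].
  - by rewrite /= in_itv /= T0.
  - by rewrite divr_gt0.
  exists d => // t Tt tT.
  rewrite mulrC -ltr_pdivlMr //; apply: hd.
    by rewrite /= in_itv /= (le_trans T0).
  by rewrite distrC ger0_norm; lra.
suff trT : pos_def (P T) /\ \tr (invmx (P T)) <= B.
  exists d => // t Tt tT _; split => //.
    by apply: riccati_sym; exact: le_trans Tt.
  (* The margin: [2 * c] at [T], of which the variation of [P] on the short interval consumes at
     most [c]. *)
  move=> u; have h1 := lower T sT trT.1 trT.2 u.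
  have h2 := quadform_norm_le (P T - P t) u.
  have h3 : 6 * `|P T - P t| * dot u u <= c * dot u u.
    by rewrite ler_wpM2r ?dot_ge0 // ltW // hd.
  have E : quadform (P T - P t) u = quadform (P T) u - quadform (P t) u.
    by rewrite /quadform mulmxBl dotBr.
  have h4 := ler_norm (quadform (P T - P t) u).
  by rewrite E in h2 h4; clear sT; lra.
have [T0'|T0'] := eqVneq T 0.
  by rewrite T0'; split => //; rewrite /B; clear sT; lra.
have Tp : 0 < T by rewrite lt_neqAle eq_sym T0'.
(* The bound passes to [T] itself as a limit from the left. *)
have goodT t : 0 <= t <= T -> posdef_ge c (P t).
  move=> /andP[t0]; rewrite le_eqVlt => /predU1P[->|tT]; last by apply: good; rewrite t0.
  split=> // u; rewrite -lerN2.
  apply: (within_le_closed (A := `[0, T]) (f := fun t => - quadform (P t) u)).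
  - apply: (within_continuous_lip (C := 6 * dot u u)) (@riccati_continuous T) => x y _ _.
    have -> : - quadform (P x) u - - quadform (P y) u = - quadform (P x - P y) u.
      by rewrite /quadform mulmxBl dotBr; ring.
    rewrite normrN; apply: (le_trans (quadform_norm_le _ _)).
    by rewrite mulrAC.
  - by rewrite /= in_itv /= T0 lexx.
  move=> e e0; exists (Num.max 0 (T - e / 2)).
  have mT : Num.max 0 (T - e / 2) < T by rewrite gt_max Tp /=; lra.
  have m0 : 0 <= Num.max 0 (T - e / 2) by rewrite le_max lexx.
  have mT' : T - e / 2 <= Num.max 0 (T - e / 2) by rewrite le_max lexx orbT.
  split; first by rewrite /= in_itv /= m0 ltW.
    by rewrite ger0_norm; lra.
  rewrite lerN2; have [|_ _] := good (Num.max 0 (T - e / 2)); first by rewrite m0.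
  by apply.
have pT : posdef_ge c (P T) by apply: goodT; rewrite T0 lexx.
split; first exact: posdef_ge_pos_def pT.
apply: (@barrier _ (fun t => \tr (invmx (P t))) 0 T B); last by rewrite T0 lexx.
- apply: within_continuous_sum => i; apply: within_continuous_entry.
  apply: (@within_continuous_inv _ c); first exact: riccati_continuous.
  by move=> t; rewrite /= in_itv /=; exact: goodT.
- by rewrite /B; clear sT; lra.
move=> t /andP[t0 tT] Bt.
have gt : posdef_ge c (P t) by apply: goodT; rewrite !ltW.
have ut := pos_def_unit (posdef_ge_pos_def gt).
have pS := pos_def_inv_psd (posdef_ge_pos_def gt).
exists (\tr (- (invmx (P t) *m A t) - (A t)^T *m invmx (P t) + G t
     - invmx (P t) *m V t *m invmx (P t))).
  exact: (is_derive_mxtrace (riccati_inv_derive t0 ut)).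
set S := invmx (P t) in Bt pS *; set x := \tr S in Bt *.
rewrite !(raddfD, raddfN) /= -[\tr ((A t)^T *m S)]mxtrace_tr trmx_mul trmxK (proj1 pS).
have h1 := psd_trM_le (A t) pS.
have h2 := mxtrace_le (G t).
have hvV u : v * dot u u <= quadform (V t) u by apply: hv; exact: ltW.
have := mxtrace_congr_ge S (ltW v0) hvV.
rewrite (proj1 pS) -/x => h3.
have nA : `|A t| <= a by apply: ha; exact: ltW.
have nG : `|G t| <= s by apply: hs; exact: ltW.
have x0 : 0 < x by apply: lt_trans Bt.
have x1 : 1 <= x by apply: ltW; apply: le_lt_trans Bt.
have h4 : 6 ^+ 2 * `|A t| * x <= 36 * a * x.
  rewrite (_ : 6 ^+ 2 = 36 :> R); last by ring.
  by rewrite ler_wpM2r ?(ltW x0) // ler_wpM2l.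
have h5 : 6 * l * x <= v * x ^+ 2.
  rewrite expr2 mulrA ler_wpM2r ?(ltW x0) // -ler_pdivrMl // mulrC.
  by apply: ltW; apply: le_lt_trans Bt; rewrite /B; clear sT; lra.
have h6 : 6 * s <= 6 * s * x by rewrite ler_peMr // mulr_ge0 // ltW.
have h7 := ler_norm (- \tr (S *m A t)); have h8 := ler_norm (\tr (G t)).
rewrite normrN -/x in h1 h7.
rewrite /l in h5.
clear sT; lra.
Qed.

End Riccati.

(** * Upper bound on the Riccati solution *)

Section RiccatiUpper.
Context {R : realType}.

(* This is the trace of [X] against [[1, -1/2], [-1/2, 1]] (x) I, which commutes with
   diag(omega^x, omega^x): the rotation rate disappears from its derivative along
   the Riccati equation. *)
Definition block_trace m (X : 'M[R]_(m + m)) : R :=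
  \tr (ulsubmx X) - \tr (ursubmx X) + \tr (drsubmx X).

Lemma block_trace_block m (A B C D : 'M[R]_m) :
  block_trace (block_mx A B C D) = \tr A - \tr B + \tr D.
Proof. by rewrite /block_trace block_mxKul block_mxKur block_mxKdr. Qed.

Lemma block_traceE m (X : 'M[R]_(m + m)) : block_trace X =
  \sum_i (X (lshift m i) (lshift m i) - X (lshift m i) (rshift m i)
          + X (rshift m i) (rshift m i)).
Proof.
rewrite /block_trace /mxtrace !big_split /= sumrN.
by congr (_ - _ + _); apply: eq_bigr => i _; rewrite !mxE.
Qed.

Lemma block_traceD m (X Y : 'M[R]_(m + m)) : block_trace (X + Y) = block_trace X + block_trace Y.
Proof.
rewrite !block_traceE -big_split; apply: eq_bigr => i _ /=; rewrite !mxE; ring.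
Qed.

Lemma block_traceB m (X Y : 'M[R]_(m + m)) : block_trace (X - Y) = block_trace X - block_trace Y.
Proof.
rewrite !block_traceE -sumrB; apply: eq_bigr => i _ /=; rewrite !mxE; ring.
Qed.

Lemma block_trace_sym m (X : 'M[R]_(m + m)) : X^T = X ->
  X = block_mx (ulsubmx X) (ursubmx X) (ursubmx X)^T (drsubmx X) /\
  (ulsubmx X)^T = ulsubmx X /\ (drsubmx X)^T = drsubmx X.
Proof.
move=> sX; have : X^T = X by []. 
rewrite -{1 2}(submxK X) tr_block_mx => /eq_block_mx[h1 h2 h3 h4].
by split=> //; rewrite h3 submxK.
Qed.

(** The unit block of [A] feeds [P12] into [P11] and [P22] into [P12]; the latter enters with weight
    -1 and becomes the damping [- \tr P22], although [C] does not see the second block. The terms in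
    [O] vanish as traces of skew times symmetric matrices, or cancel in the off-diagonal block. *)
Lemma block_trace_rhs m (O P11 P12 P22 Q : 'M[R]_m) (V : 'M[R]_(m + m)) :
  O^T = - O -> P11^T = P11 -> P22^T = P22 ->
  let X := block_mx P11 P12 P12^T P22 in
  let A := block_mx (- O) 1%:M 0 (- O) in
  let C := row_mx 1%:M 0 : 'M[R]_(m, m + m) in
  block_trace (A *m X + X *m A^T - X *m (C^T *m Q *m C) *m X + V) =
  2 * \tr P12 - \tr P22 - (\tr (P11^T *m Q *m P11) - \tr (P11^T *m Q *m P12)
    + \tr (P12^T *m Q *m P12)) + block_trace V.
Proof.
move=> sO s1 s2 X A C; rewrite block_traceD block_traceB block_traceD.
have sX : X^T = X by rewrite /X tr_block_mx s1 s2 trmxK.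
have -> : X *m A^T = (A *m X)^T by rewrite trmx_mul sX.
have XC : X *m C^T = col_mx P11 P12^T.
  by rewrite /X /C tr_row_mx trmx1 trmx0 mul_block_col !mulmx1 !mulmx0 !addr0.
have -> : X *m (C^T *m Q *m C) *m X = (X *m C^T) *m Q *m (X *m C^T)^T.
  by rewrite trmx_mul trmxK sX !mulmxA.
rewrite XC tr_col_mx s1 trmxK (mul_col_mx P11) mul_col_row block_trace_block.
have -> : A *m X = block_mx (- O *m P11 + P12^T) (- O *m P12 + P22) (- O *m P12^T) (- O *m P22).
  by rewrite /A /X mulmx_block !mul1mx !mul0mx !add0r.
rewrite tr_block_mx !block_trace_block !mxtrace_tr !mxtraceD !mulNmx.
rewrite !(raddfN (@mxtrace R m)) /= mxtrace_tr.
have z1 : \tr (O *m P11) = 0 by exact: mxtrace_skew_sym.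
have z2 : \tr (O *m P22) = 0 by exact: mxtrace_skew_sym.
have z3 : \tr (O *m P12^T) = - \tr (O *m P12).
  rewrite -[LHS]mxtrace_tr trmx_mul trmxK sO mulmxN (raddfN (@mxtrace R m)) /=.
  by rewrite mxtrace_mulC.
rewrite z1 z2 z3; ring.
Qed.

Lemma crossmx_skew (x : 'cV[R]_3) : (crossmx x)^T = - crossmx x.
Proof.
apply/matrixP => i j; rewrite !mxE.
by case: i => [[|[|[|//]]] ?]; case: j => [[|[|[|//]]] ?] /=; rewrite ?opprK ?oppr0.
Qed.

Variables (omega : R -> 'cV[R]_3) (Q : R -> 'M[R]_3) (V P : R -> 'M[R]_6).
Hypotheses (hA : bounded_mx (AA omega)) (hQ : unif_pos_def Q) (hQb : bounded_mx Q)
  (hV : unif_pos_def V) (hVb : bounded_mx V) (hP0 : pos_def (P 0))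
  (hP : riccati omega Q V P).

(** The derivative of [f] is at most [B - f], so [f] stays below the maximum of [f 0] and [B]: the
    quadratic term dominates any linear term in the traces of [P11] and [P12], and the trace of
    [P22] is damped linearly. *)
Lemma riccati_upper : exists p : R, forall t, 0 <= t -> \tr (P t) <= p.
Proof.
have [c hc] := riccati_lower hA hQ hQb hV hP0 hP.
have [w w0 hw] := bounded_mx_gt0 hVb.
have [Qs [q q0 hq]] := hQ.
pose f t := block_trace (P t : 'M[R]_(3 + 3)).
(* The difference of the two sides is the sum of the forms of [P t] at the vectors e_i - e_(i+3),
   hence nonnegative. *)
have geF t : 0 <= t -> \tr (P t) <= 2 * f t.
  move=> t0; have pP := posdef_ge_psd (hc t t0).
  have -> : \tr (P t) = \tr (block_mx
      (ulsubmx (P t : 'M[R]_(3 + 3))) (ursubmx (P t : 'M[R]_(3 + 3)))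
      (dlsubmx (P t : 'M[R]_(3 + 3))) (drsubmx (P t : 'M[R]_(3 + 3)))).
    by rewrite submxK.
  rewrite mxtrace_block /f block_traceE -subr_ge0 /mxtrace -big_split /= mulr_sumr -sumrB.
  apply: sumr_ge0 => i _; rewrite !mxE.
  set l := lshift 3 i; set r := rshift 3 i.
  have := pP.2 (unit_col (l : 'I_6) - unit_col (r : 'I_6)).
  rewrite /quadform mulmxBr dotBl !dotBr !dot_unit_col !mulmx_unit_col !mxE.
  have -> : P t r l = P t l r by rewrite -{1}(proj1 pP) mxE.
  by lra.
pose B := 3 / q + 9 * w.
pose M := Num.max (f 0) B.
exists (2 * M) => t t0; apply: (le_trans (geF t t0)); rewrite ler_wpM2l //.
apply: (@barrier _ f 0 t M); last by rewrite t0 lexx.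
- rewrite (_ : f = fun u => \sum_(i < 3) (P u (lshift 3 i) (lshift 3 i) +
    ((-1) * P u (lshift 3 i) (rshift 3 i)) + P u (rshift 3 i) (rshift 3 i))); last first.
    by apply/funext => u; rewrite /f block_traceE; apply: eq_bigr => i _; rewrite mulN1r.
  have cP : {within `[0, t], continuous P}.
    by apply: within_continuous_sub (proj1 hP) => x /=; rewrite !in_itv /= => /andP[->].
  apply: within_continuous_sum => i.
  apply: within_continuousD; last exact: within_continuous_entry.
  apply: within_continuousD; first exact: within_continuous_entry.
  apply: within_continuousM; first exact: within_continuous_cst.
  exact: within_continuous_entry.
- by rewrite /M le_max lexx.
move=> s /andP[s0 st]; rewrite /M gt_max => /andP[_ Bf].
have hd := (proj2 hP) s s0.
set dP := (X in is_derive _ _ _ X) in hd.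
exists (block_trace (dP : 'M[R]_(3 + 3))).
  rewrite block_traceE (_ : f = fun u => \sum_(i < 3) (P u (lshift 3 i) (lshift 3 i)
      - P u (lshift 3 i) (rshift 3 i) + P u (rshift 3 i) (rshift 3 i))); last first.
    by apply/funext => u; rewrite /f block_traceE.
  move/is_derive_mxP : hd => hd.
  exact: (is_derive_bigsum (index_enum 'I_3) (fun i => is_deriveD
    (is_deriveB (hd (lshift 3 i) (lshift 3 i)) (hd (lshift 3 i) (rshift 3 i)))
    (hd (rshift 3 i) (rshift 3 i)))).
have pP := posdef_ge_psd (hc s (ltW s0)).
have [PE [s1 s2]] := @block_trace_sym 3 (P s) (proj1 pP).
set P11 := ulsubmx (P s : 'M[R]_(3 + 3)) in PE s1.
set P12 := ursubmx (P s : 'M[R]_(3 + 3)) in PE.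
set P22 := drsubmx (P s : 'M[R]_(3 + 3)) in PE s2.
have := @block_trace_rhs 3 (crossmx (omega s)) P11 P12 P22 (Q s) (V s) (crossmx_skew _) s1 s2.
have -> : dP = AA omega s *m P s + P s *m (AA omega s)^T
   - P s *m (CC^T *m Q s *m CC) *m P s + V s by rewrite /dP !mulmxA.
have fE : f s = \tr P11 - \tr P12 + \tr P22 by rewrite /f.
rewrite /= -PE => E.
have E2 : block_trace (AA omega s *m P s + P s *m (AA omega s)^T
   - P s *m (CC^T *m Q s *m CC) *m P s + V s : 'M[R]_(3 + 3)) =
   2 * \tr P12 - \tr P22 - (\tr (P11^T *m Q s *m P11) - \tr (P11^T *m Q s *m P12)
    + \tr (P12^T *m Q s *m P12)) + block_trace (V s : 'M[R]_(3 + 3)) := E.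
rewrite E2 {E E2 PE hd dP}.
have vb : block_trace (V s : 'M[R]_(3 + 3)) <= 9 * w.
  have hVs := hw s (ltW s0).
  have hb i j : `|V s i j| <= w by apply: le_trans hVs; exact: mx_entry_le.
  rewrite block_traceE.
  have -> : 9 * w = \sum_(i < 3) (3 * w) by rewrite sumr_const card_ord mulr_natl; ring.
  apply: ler_sum => i _.
  have := hb (lshift 3 i) (lshift 3 i); have := hb (lshift 3 i) (rshift 3 i).
  have := hb (rshift 3 i) (rshift 3 i); rewrite !ler_norml; lra.
have qs u : q * dot u u <= quadform (Q s) u by apply: hq; exact: ltW.
have a2 := mxtrace_congr_ge P11 (ltW q0) qs.
have b2 := mxtrace_congr_ge P12 (ltW q0) qs.
have qp u : 0 <= quadform (Q s) u by apply: le_trans (qs u); rewrite mulr_ge0 ?dot_ge0 ?ltW.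
(* This absorbs the mixed term: at least half of the sum of the two squares survives. *)
have : 0 <= \tr ((P11 - P12)^T *m Q s *m (P11 - P12)).
  by rewrite mxtrace_congr; apply: sumr_ge0.
have -> : (P11 - P12)^T = P11^T - P12^T by rewrite raddfB.
rewrite mulmxBr !mulmxBl !(raddfB (@mxtrace R 3)) /=.
have -> : \tr (P12^T *m Q s *m P11) = \tr (P11^T *m Q s *m P12).
  by rewrite -mxtrace_tr !trmx_mul trmxK Qs ?mulmxA // ltW.
move: a2 b2 fE Bf; rewrite /B.
move: (\tr (P11^T *m Q s *m P11)) (\tr (P12^T *m Q s *m P12)) (\tr (P11^T *m Q s *m P12)).
move: (\tr P11) (\tr P12) (\tr P22) (block_trace _) vb => a b d v vb x y z a2 b2 fE Bf xyz.
(* Tangent line of the parabola at [3 / q]; with this slope the linear terms add up to exactly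
   [- f s]. *)
have sq e : 6 * e - 9 / q <= q * e ^+ 2.
  have : 0 <= q^-1 * (q * e - 3) ^+ 2 by rewrite mulr_ge0 ?sqr_ge0 // invr_ge0 ltW.
  rewrite (_ : q^-1 * _ = q * e ^+ 2 - (6 * e - 9 / q)) ?subr_ge0 //.
  by field; rewrite gt_eqF.
have := sq a; have := sq b.
rewrite (_ : 9 / q = 3 * (3 / q)); last by field; rewrite gt_eqF.
move: (3 / q) Bf fE (f s) => k Bf fE F; move: Bf; rewrite fE.
clear -a2 b2 xyz vb; lra.
Qed.

End RiccatiUpper.

Section RiccatiInverse.
Context {R : realType}.
Variables (omega : R -> 'cV[R]_3) (Q : R -> 'M[R]_3) (V P : R -> 'M[R]_6).
Hypotheses (hA : bounded_mx (AA omega)) (hQ : unif_pos_def Q) (hQb : bounded_mx Q)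
  (hV : unif_pos_def V) (hVb : bounded_mx V) (hP0 : pos_def (P 0))
  (hP : riccati omega Q V P).

(** [lo] comes from the trace bound on [P], [hi] from its lower bound. The last inequality compares
    the damping by [V], a form at [invmx (P t) *m u], with the form of [invmx (P t)] at [u]. *)
Lemma riccati_inverse_bounds : exists lo hi : R, 0 < lo /\ 0 < hi /\ forall t, 0 <= t ->
  [/\ P t \in unitmx, (invmx (P t))^T = invmx (P t),
      forall u, lo * dot u u <= quadform (invmx (P t)) u,
      forall u, quadform (invmx (P t)) u <= hi * dot u u &
      forall u, lo * quadform (invmx (P t)) u <= dot (invmx (P t) *m u) (invmx (P t) *m u)].
Proof.
have [c hc] := riccati_lower hA hQ hQb hV hP0 hP.
have [p hp] := riccati_upper hA hQ hQb hV hVb hP0 hP.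
have [_ c0 _] := hc 0 (lexx _).
have q0 : 0 < `|p| + 1 by rewrite ltr_wpDl.
exists (`|p| + 1)^-1, (6 / c); split; first by rewrite invr_gt0.
split; first by rewrite divr_gt0.
move=> t t0; have hct := hc t t0; have pP := posdef_ge_pos_def hct.
have pS := pos_def_inv_psd pP.
have trP : \tr (P t) <= `|p| + 1 by have := hp t t0; have := ler_norm p; lra.
split; [exact: pos_def_unit|exact: (proj1 pS)|move=> u|move=> u|move=> u].
- rewrite ler_pdivrMl //; apply: (le_trans (dot_le_quadform_inv u pP)).
  by rewrite ler_wpM2r //; case: pS.
- apply: (le_trans (psd_quadform_le u pS)); rewrite ler_wpM2r ?dot_ge0 //.
  exact: posdef_ge_trinv.
- rewrite ler_pdivrMl //; apply: (le_trans (quadform_inv_le_dot u pP)).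
  by rewrite ler_wpM2r // dot_ge0.
Qed.

(** Serves the absolute continuity of the Lyapunov function along a solution. By the lower bound on
    [P], the right-hand side of the equation of the inverse is bounded uniformly in time. *)
Lemma riccati_inverse_lip : exists L : R, forall x y i j, 0 <= x -> x <= y ->
  `|invmx (P y) i j - invmx (P x) i j| <= L * `|y - x|.
Proof.
have [c hc] := riccati_lower hA hQ hQb hV hP0 hP.
have [_ c0 _] := hc 0 (lexx _).
have [a a0 ha] := bounded_mx_gt0 hA.
have [w w0 hw] := bounded_mx_gt0 hVb.
have [s s0 hs] := output_gram_bound hQb.
have M2 (X Y : 'M[R]_6) (x y : R) : `|X| <= x -> `|Y| <= y -> `|X *m Y| <= 6 * (x * y).
  move=> hX hY; apply: (le_trans (mx_norm_mul _ _)); rewrite ler_wpM2l //.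
  by rewrite ler_pM.
pose k := 6 / c.
exists (6 * (k * a) + 6 * (a * k) + s + 6 * (6 * (k * w) * k)) => x y i j x0 xy.
have cS : {within `[0, y], continuous (fun t => invmx (P t))}.
  apply: (@within_continuous_inv _ P _ c (@riccati_continuous _ _ _ _ _ hP y)).
  by move=> t /=; rewrite in_itv /= => /andP[t0 _]; exact: hc.
apply: (@derive_bound_lip _ (fun t => invmx (P t) i j) 0 y) => //.
  exact: within_continuous_entry.
move=> t /andP[t0 ty]; have hct := hc t (ltW t0); have pP := posdef_ge_pos_def hct.
have hd := riccati_inv_derive hP t0 (pos_def_unit pP).
move/is_derive_mxP : (hd) => /(_ i j) hd'; eexists; first exact: hd'.
apply: (le_trans (mx_entry_le _ i j)).
have nA : `|AA omega t| <= a by apply: ha; exact: ltW.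
have nAT : `|(AA omega t)^T| <= a by rewrite mx_norm_tr.
have nS : `|invmx (P t)| <= k.
  have tS := posdef_ge_trinv hct; have pS := pos_def_inv_psd pP.
  apply: mx_norm_le => [|i' j']; first by rewrite /k divr_ge0 // ltW.
  by apply: le_trans tS; exact: psd_entry_le.
have nG : `|output_gram Q t| <= s by apply: hs; exact: ltW.
have nV : `|V t| <= w by apply: hw; exact: ltW.
apply: (le_trans (ler_normB _ _)); apply: lerD; last exact: M2 (M2 _ _ _ _ nS nV) nS.
apply: (le_trans (ler_normD _ _)); apply: lerD => //.
apply: (le_trans (ler_normB _ _)); apply: lerD; last exact: M2.
by rewrite normrN; exact: M2.
Qed.

End RiccatiInverse.

(** * The attitude potential on SO(3) *)

Section Dim3.
Context {R : realType}.

Lemma ord3P (i : 'I_3) : [\/ i = 0, i = 1 | i = 2].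
Proof. by case: i => [[|[|[|//]]] ?]; [apply: Or31|apply: Or32|apply: Or33]; exact: val_inj. Qed.

Lemma sum3E (T : nmodType) (f : 'I_3 -> T) : \sum_i f i = f 0 + f 1 + f 2.
Proof.
rewrite !big_ord_recl big_ord0 addr0 addrA.
by congr (_ + f _ + f _); exact: val_inj.
Qed.

Lemma matrix3P (A B : 'M[R]_3) :
  [/\ A 0 0 = B 0 0, A 0 1 = B 0 1 & A 0 2 = B 0 2] ->
  [/\ A 1 0 = B 1 0, A 1 1 = B 1 1 & A 1 2 = B 1 2] ->
  [/\ A 2 0 = B 2 0, A 2 1 = B 2 1 & A 2 2 = B 2 2] -> A = B.
Proof.
move=> [? ? ?] [? ? ?] [? ? ?]; apply/matrixP => i j.
by have [->|->|->] := ord3P i; have [->|->|->] := ord3P j.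
Qed.

Lemma mulmx3E m n (A : 'M[R]_(m, 3)) (B : 'M[R]_(3, n)) i j :
  (A *m B) i j = A i 0 * B 0 j + A i 1 * B 1 j + A i 2 * B 2 j.
Proof. by rewrite mxE sum3E. Qed.

Lemma mxtrace3E (A : 'M[R]_3) : \tr A = A 0 0 + A 1 1 + A 2 2.
Proof. exact: sum3E. Qed.

Lemma dot3E (u v : 'cV[R]_3) : dot u v = u 0 0 * v 0 0 + u 1 0 * v 1 0 + u 2 0 * v 2 0.
Proof. by rewrite dotE sum3E. Qed.

Lemma crossmxE (x : 'cV[R]_3) :
  ((crossmx x 0 0 = 0) * (crossmx x 0 1 = - x 2 0) * (crossmx x 0 2 = x 1 0)) *
  ((crossmx x 1 0 = x 2 0) * (crossmx x 1 1 = 0) * (crossmx x 1 2 = - x 0 0)) *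
  ((crossmx x 2 0 = - x 1 0) * (crossmx x 2 1 = x 0 0) * (crossmx x 2 2 = 0)).
Proof. by rewrite /crossmx; do !split; rewrite mxE. Qed.

Lemma scalar3E (a : R) :
  (((a%:M : 'M[R]_3) 0 0 = a) * ((a%:M : 'M[R]_3) 0 1 = 0) * ((a%:M : 'M[R]_3) 0 2 = 0)) *
  (((a%:M : 'M[R]_3) 1 0 = 0) * ((a%:M : 'M[R]_3) 1 1 = a) * ((a%:M : 'M[R]_3) 1 2 = 0)) *
  (((a%:M : 'M[R]_3) 2 0 = 0) * ((a%:M : 'M[R]_3) 2 1 = 0) * ((a%:M : 'M[R]_3) 2 2 = a)).
Proof. by do !split; rewrite mxE. Qed.

Lemma det3E (A : 'M[R]_3) : \det A =
  A 0 0 * (A 1 1 * A 2 2 - A 1 2 * A 2 1) - A 0 1 * (A 1 0 * A 2 2 - A 1 2 * A 2 0) +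
  A 0 2 * (A 1 0 * A 2 1 - A 1 1 * A 2 0).
Proof.
have d2 (B : 'M[R]_2) : \det B = B 0 0 * B 1 1 - B 0 1 * B 1 0.
  rewrite (expand_det_row _ 0) !big_ord_recl big_ord0 addr0 /cofactor !det_mx11 !mxE /=.
  have -> : lift 0 (0 : 'I_1) = 1 :> 'I_2 by exact: val_inj.
  have -> : lift 1 (0 : 'I_1) = 0 :> 'I_2 by exact: val_inj.
  by rewrite expr0 mul1r expr1 mulN1r mulrN.
rewrite (expand_det_row _ 0) sum3E /cofactor !d2 !mxE /=.
have -> : lift 0 (0 : 'I_2) = 1 :> 'I_3 by exact: val_inj.
have -> : lift 0 (1 : 'I_2) = 2 :> 'I_3 by exact: val_inj.
have -> : lift 1 (0 : 'I_2) = 0 :> 'I_3 by exact: val_inj.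
have -> : lift 1 (1 : 'I_2) = 2 :> 'I_3 by exact: val_inj.
have -> : lift 2 (0 : 'I_2) = 0 :> 'I_3 by exact: val_inj.
have -> : lift 2 (1 : 'I_2) = 1 :> 'I_3 by exact: val_inj.
rewrite /= expr0 mul1r; ring.
Qed.

(** Orthonormality of columns and rows, and equality of a rotation with its cofactor matrix. The
    relations are linear in the monomials of the entries, so that identities on SO(3) can be left to
    linear arithmetic. *)
Record SO3_relations (A : 'M[R]_3) : Prop := SO3Relations {
  so3_c00 : A 0 0 ^+ 2 + A 1 0 ^+ 2 + A 2 0 ^+ 2 = 1;
  so3_c11 : A 0 1 ^+ 2 + A 1 1 ^+ 2 + A 2 1 ^+ 2 = 1;
  so3_c22 : A 0 2 ^+ 2 + A 1 2 ^+ 2 + A 2 2 ^+ 2 = 1;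
  so3_c01 : A 0 0 * A 0 1 + A 1 0 * A 1 1 + A 2 0 * A 2 1 = 0;
  so3_c02 : A 0 0 * A 0 2 + A 1 0 * A 1 2 + A 2 0 * A 2 2 = 0;
  so3_c12 : A 0 1 * A 0 2 + A 1 1 * A 1 2 + A 2 1 * A 2 2 = 0;
  so3_r00 : A 0 0 ^+ 2 + A 0 1 ^+ 2 + A 0 2 ^+ 2 = 1;
  so3_r11 : A 1 0 ^+ 2 + A 1 1 ^+ 2 + A 1 2 ^+ 2 = 1;
  so3_r22 : A 2 0 ^+ 2 + A 2 1 ^+ 2 + A 2 2 ^+ 2 = 1;
  so3_r01 : A 0 0 * A 1 0 + A 0 1 * A 1 1 + A 0 2 * A 1 2 = 0;
  so3_r02 : A 0 0 * A 2 0 + A 0 1 * A 2 1 + A 0 2 * A 2 2 = 0;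
  so3_r12 : A 1 0 * A 2 0 + A 1 1 * A 2 1 + A 1 2 * A 2 2 = 0;
  so3_00 : A 0 0 = A 1 1 * A 2 2 - A 1 2 * A 2 1;
  so3_01 : A 0 1 = A 1 2 * A 2 0 - A 1 0 * A 2 2;
  so3_02 : A 0 2 = A 1 0 * A 2 1 - A 1 1 * A 2 0;
  so3_10 : A 1 0 = A 0 2 * A 2 1 - A 0 1 * A 2 2;
  so3_11 : A 1 1 = A 0 0 * A 2 2 - A 0 2 * A 2 0;
  so3_12 : A 1 2 = A 0 1 * A 2 0 - A 0 0 * A 2 1;
  so3_20 : A 2 0 = A 0 1 * A 1 2 - A 0 2 * A 1 1;
  so3_21 : A 2 1 = A 0 2 * A 1 0 - A 0 0 * A 1 2;
  so3_22 : A 2 2 = A 0 0 * A 1 1 - A 0 1 * A 1 0 }.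

Lemma SO3P (A : 'M[R]_3) : SO3 A -> SO3_relations A.
Proof.
move=> [AtA dA].
have AAt : A *m A^T = 1%:M by exact: mulmx1C.
(* The cofactor matrix, with indices modulo 3, so that no signs occur; [A *m C^T = 1] gives
   [C = A]. *)
pose C : 'M[R]_3 := \matrix_(i, j)
  (A (i + 1) (j + 1) * A (i + 2) (j + 2) - A (i + 1) (j + 2) * A (i + 2) (j + 1)).
have n1 : 1 + 1 = 2 :> 'I_3 by exact: val_inj.
have n2 : 1 + 2 = 0 :> 'I_3 by exact: val_inj.
have n3 : 2 + 1 = 0 :> 'I_3 by exact: val_inj.
have n4 : 2 + 2 = 1 :> 'I_3 by exact: val_inj.
have AC : A *m C^T = 1%:M.
  rewrite det3E in dA.
  apply: matrix3P; split; rewrite mulmx3E scalar3E !mxE !(add0r, n1, n2, n3, n4) -?dA; ring.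
have CE : C = A.
  apply: trmx_inj; rewrite -[LHS]mul1mx -AtA -mulmxA AC mulmx1 //.
have e1 i j : (A^T *m A) i j = (1%:M : 'M[R]_3) i j by rewrite AtA.
have e2 i j : (A *m A^T) i j = (1%:M : 'M[R]_3) i j by rewrite AAt.
have e3 i j : A i j = C i j by rewrite CE.
split.
- by have := e1 0 0; rewrite mulmx3E !mxE /= !expr2.
- by have := e1 1 1; rewrite mulmx3E !mxE /= !expr2.
- by have := e1 2 2; rewrite mulmx3E !mxE /= !expr2.
- by have := e1 0 1; rewrite mulmx3E !mxE /=.
- by have := e1 0 2; rewrite mulmx3E !mxE /=.
- by have := e1 1 2; rewrite mulmx3E !mxE /=.
- by have := e2 0 0; rewrite mulmx3E !mxE /= !expr2.
- by have := e2 1 1; rewrite mulmx3E !mxE /= !expr2.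
- by have := e2 2 2; rewrite mulmx3E !mxE /= !expr2.
- by have := e2 0 1; rewrite mulmx3E !mxE /=.
- by have := e2 0 2; rewrite mulmx3E !mxE /=.
- by have := e2 1 2; rewrite mulmx3E !mxE /=.
- by have := e3 0 0; rewrite mxE !(add0r, n1, n2, n3, n4).
- by have := e3 0 1; rewrite mxE !(add0r, n1, n2, n3, n4).
- by have := e3 0 2; rewrite mxE !(add0r, n1, n2, n3, n4).
- by have := e3 1 0; rewrite mxE !(add0r, n1, n2, n3, n4) (mulrC (A 2 1)) (mulrC (A 2 2)).
- by have := e3 1 1; rewrite mxE !(add0r, n1, n2, n3, n4) (mulrC (A 2 2)) (mulrC (A 2 0)).
- by have := e3 1 2; rewrite mxE !(add0r, n1, n2, n3, n4) (mulrC (A 2 0)) (mulrC (A 2 1)).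
- by have := e3 2 0; rewrite mxE !(add0r, n1, n2, n3, n4).
- by have := e3 2 1; rewrite mxE !(add0r, n1, n2, n3, n4).
- by have := e3 2 2; rewrite mxE !(add0r, n1, n2, n3, n4).
Qed.

End Dim3.

Section RotationAxis.
Context {R : realType}.

(** The column through a positive diagonal entry, divided by the root of this entry, is the factor.
    Without such an entry the trace condition makes the diagonal 0, and the minor relations then
    make [Z] 0. *)
Lemma rank1_factor n (Z : 'M[R]_n) : (forall i j, Z i j = Z j i) ->
  (forall i j k, Z i k * Z k j = Z i j * Z k k) -> 0 <= \tr Z ->
  exists e : 'cV[R]_n, Z = e *m e^T.
Proof.
move=> sZ mZ tZ.
have [[k zk]|h] := pselect (exists k, 0 < Z k k).
  exists ((Num.sqrt (Z k k))^-1 *: col k Z); apply/matrixP => i j.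
  rewrite mxE big_ord1 !mxE mulrACA -expr2 exprVn sqr_sqrtr ?ltW //.
  by rewrite (sZ j k) mZ mulrC mulfK // gt_eqF.
have Z0 k : Z k k = 0.
  apply/eqP; apply: contrapT => /negP zk.
  have {}zk : Z k k < 0.
    by rewrite lt_neqAle zk leNgt; apply/negP => h'; apply: h; exists k.
  have : \tr Z < 0.
    have : \sum_(i | i != k) Z i i <= 0.
      rewrite -oppr_ge0 -sumrN; apply: sumr_ge0 => i _; rewrite oppr_ge0.
      by rewrite leNgt; apply/negP => h'; apply: h; exists i.
    have -> : \tr Z = Z k k + \sum_(i | i != k) Z i i by rewrite /mxtrace (bigD1 k).
    by move: (\sum_(i | _) _) => y; lra.
  by rewrite ltNge tZ.
exists 0; apply/matrixP => i j; rewrite mul0mx mxE; apply/eqP.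
by rewrite -sqrf_eq0 expr2 {2}sZ mZ Z0 mul0r.
Qed.

(* If (eta, e) is a unit quaternion of [A], then x = 2 eta e; only the vector part
   [e] is built, from the rank-one matrix (A + A^T + (1 - tr A) I) / 4 = e e^T. *)
Lemma SO3_axis (A : 'M[R]_3) : SO3 A -> exists e x : 'cV[R]_3,
  [/\ A = (1 - 2 * dot e e)%:M + 2 *: (e *m e^T) + crossmx x,
      x *m x^T = (4 * (1 - dot e e)) *: (e *m e^T) & dot e e <= 1].
Proof.
move=> /SO3P h; case: (h) => c00 c11 c22 c01 c02 c12 r00 r11 r22 r01 r02 r12.
move=> f00 f01 f02 f10 f11 f12 f20 f21 f22.
pose Z := 4^-1 *: (A + A^T + (1 - \tr A)%:M).
have ZE i j : Z i j = 4^-1 * (A i j + A j i + (1 - \tr A) *+ (i == j)).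
  by rewrite /Z !mxE.
have tA : \tr A = A 0 0 + A 1 1 + A 2 2 by exact: mxtrace3E.
have sZ i j : Z i j = Z j i by rewrite !ZE (addrC (A i j)) (eq_sym i).
have mZ i j k : Z i k * Z k j = Z i j * Z k k.
  have [->|ki] := eqVneq k i; first by rewrite mulrC.
  have [->//|kj] := eqVneq k j; move: ki kj.
  have [->|->|->] := ord3P i; have [->|->|->] := ord3P j; have [->|->|->] := ord3P k;
   rewrite ?eqxx //= => _ _; rewrite !ZE /= tA ?mulr1n ?mulr0n; lra.
have tZ : \tr Z = 4^-1 * (3 - \tr A).
  by rewrite (mxtrace3E Z) !ZE /= !mulr1n tA; field.
(* Coordinates of unit vectors are at most 1, hence [\tr A <= 3] and [0 <= \tr Z]. *)
have ub (x y z : R) : x ^+ 2 + y ^+ 2 + z ^+ 2 = 1 -> z <= 1.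
  move=> e; rewrite leNgt; apply/negP => z1.
  have := sqr_ge0 x; have := sqr_ge0 y; have : 1 < z ^+ 2 by rewrite exprn_egt1.
  lra.
have a0 : A 0 0 <= 1 by apply: (ub (A 1 0) (A 2 0)); lra.
have a1 : A 1 1 <= 1 by apply: (ub (A 0 1) (A 2 1)); lra.
have a2 : A 2 2 <= 1 by apply: (ub (A 0 2) (A 1 2)); lra.
have [|e eZ] := rank1_factor sZ mZ.
  by rewrite tZ tA; lra.
have de : dot e e = \tr Z by rewrite eZ mxtrace_mulC /dot trace_mx11.
(* The axial vector of the antisymmetric part of [A]. *)
pose x : 'cV[R]_3 := \col_i nth 0 [:: 2^-1 * (A 2 1 - A 1 2); 2^-1 * (A 0 2 - A 2 0);
   2^-1 * (A 1 0 - A 0 1)] i.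
have x0 : x 0 0 = 2^-1 * (A 2 1 - A 1 2) by rewrite mxE.
have x1 : x 1 0 = 2^-1 * (A 0 2 - A 2 0) by rewrite mxE.
have x2 : x 2 0 = 2^-1 * (A 1 0 - A 0 1) by rewrite mxE.
have xx : x *m x^T = (4 * (1 - dot e e)) *: Z.
  have E i j : (x *m x^T) i j = x i 0 * x j 0 by rewrite mxE big_ord1 !mxE.
  have E' i j : ((4 * (1 - dot e e)) *: Z) i j =
     (1 + \tr A) * (4^-1 * (A i j + A j i + (1 - \tr A) *+ (i == j))).
    by rewrite [LHS]mxE ZE de tZ; field.
  apply: matrix3P; split; rewrite E E' ?x0 ?x1 ?x2 /= ?mulr1n ?mulr0n tA; lra.
clear c00 c11 c22 c01 c02 c12 r00 r11 r22 r01 r02 r12.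
clear f00 f01 f02 f10 f11 f12 f20 f21 f22 a0 a1 a2 ub.
exists e, x; rewrite -eZ; split => //.
  have AE i j : ((1 - 2 * \tr Z)%:M + 2 *: Z + crossmx x) i j =
      ((1 - 2 * \tr Z)%:M : 'M[R]_3) i j + 2 * Z i j + crossmx x i j.
    by rewrite mxE [X in X + _]mxE [X in _ + X + _]mxE.
  by rewrite de; apply: matrix3P; split;
    rewrite AE scalar3E crossmxE ZE ?x0 ?x1 ?x2 ?tZ tA /= ?mulr1n ?mulr0n; field.
(* The trace of [x *m x^T] is nonnegative, which bounds [dot e e] by 1. *)
have [e0|e0] := leP (dot e e) 0; first by apply: le_trans e0 _.
have : 0 <= (4 * (1 - dot e e)) * dot e e.
  have -> : (4 * (1 - dot e e)) * dot e e = dot x x.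
    have -> : dot x x = \tr (x *m x^T) by rewrite mxtrace_mulC /dot trace_mx11.
    by rewrite xx mxtraceZ -de.
  exact: dot_ge0.
by rewrite pmulr_lge0 //; lra.
Qed.

End RotationAxis.

Section AttitudePotential.
Context {R : realType}.

Lemma crossmx_sqr (u : 'cV[R]_3) :
  crossmx u *m crossmx u = u *m u^T - (dot u u)%:M.
Proof.
have E i j : (u *m u^T - (dot u u)%:M : 'M[R]_3) i j =
    u i 0 * u j 0 - ((dot u u)%:M : 'M[R]_3) i j.
  by rewrite mxE [X in X + _]mxE big_ord1 mxE [X in _ + X]mxE.
by apply: matrix3P; split; rewrite E mulmx3E !crossmxE scalar3E ?dot3E; ring.
Qed.

Lemma mxtrace_outer n (B : 'M[R]_n) (u : 'cV[R]_n) : \tr (B *m (u *m u^T)) = quadform B u.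
Proof. by rewrite mulmxA mxtrace_mulC /quadform /dot trace_mx11. Qed.

Lemma mxtrace_cross_sym (u : 'cV[R]_3) (N : 'M[R]_3) : N^T = N -> \tr (crossmx u *m N) = 0.
Proof. exact: mxtrace_skew_sym (crossmx_skew u). Qed.

(** Against the symmetric [N] the skew part of the rotation drops out. For N = M_v the form on the
    right is the one that defines [DeltaMstar]. *)
Lemma mxtrace_Ra (theta : R) (u : 'cV[R]_3) (N : 'M[R]_3) : N^T = N -> dot u u = 1 ->
  \tr ((Ra theta u - 1%:M) *m N) = (cos theta - 1) * quadform ((\tr N)%:M - N) u.
Proof.
move=> sN u1; rewrite /Ra crossmx_sqr u1.
have -> : 1%:M + sin theta *: crossmx u + (1 - cos theta) *: (u *m u^T - 1%:M) - 1%:M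
  = sin theta *: crossmx u + (1 - cos theta) *: (u *m u^T - 1%:M) :> 'M[R]_3.
  by apply/matrixP => i j; rewrite !mxE; ring.
rewrite mulmxDl -!scalemxAl mxtraceD !mxtraceZ mxtrace_cross_sym // mulr0 add0r.
rewrite mulmxBl mul1mx raddfB /= (mxtrace_mulC _ N) mxtrace_outer.
rewrite /quadform mulmxBl mul_scalar_mx dotBr dotZr u1; ring.
Qed.

(** By Cayley-Hamilton the matrix on the right is the adjugate of [M]; the identity reflects that
    [M *m crossmx x *m M] is the cross matrix of [\adj M *m x]. *)
Lemma mxtrace_cross_congr (M : 'M[R]_3) (x : 'cV[R]_3) : M^T = M ->
  \tr (M *m crossmx x *m M *m crossmx x) = - 2 * \tr ((M *m M - \tr M *: M +
    (2^-1 * (\tr M ^+ 2 - \tr (M *m M)))%:M) *m (x *m x^T)).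
Proof.
move=> sM; have sE i j : M i j = M j i by rewrite -{1}sM mxE.
have xE i j : (x *m x^T) i j = x i 0 * x j 0 by rewrite mxE big_ord1 mxE.
set t := \tr M; set q := 2^-1 * (t ^+ 2 - \tr (M *m M)).
have BE i j : (M *m M - t *: M + q%:M) i j = (M *m M) i j - t * M i j + (q%:M : 'M[R]_3) i j.
  by rewrite !mxE.
rewrite -mulmxA !mxtrace3E !mulmx3E !crossmxE !BE !xE !scalar3E !mulmx3E.
rewrite /q /t !mxtrace3E !mulmx3E.
by rewrite (sE 1 0) (sE 2 0) (sE 2 1); field.
Qed.

Variable M : 'M[R]_3.
Hypothesis sM : M^T = M.
Let W := (\tr M)%:M - M.

Definition att_potential (A : 'M[R]_3) : R := \tr ((1%:M - A) *m M).

(** Squared Frobenius norm of an antisymmetric matrix, in the form in which the derivative of the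
    potential produces it. *)
Definition att_dissipation (A : 'M[R]_3) : R :=
  - \tr (antisym (M *m A) *m antisym (M *m A)).

Lemma quadform_bar e : quadform W e = \tr M * dot e e - quadform M e.
Proof. by rewrite /quadform mulmxBl mul_scalar_mx dotBr dotZr. Qed.

Variables (A : 'M[R]_3) (e x : 'cV[R]_3).
Hypotheses (AE : A = (1 - 2 * dot e e)%:M + 2 *: (e *m e^T) + crossmx x)
  (xx : x *m x^T = (4 * (1 - dot e e)) *: (e *m e^T)).

Lemma att_potential_axis : att_potential A = 2 * quadform W e.
Proof.
rewrite /att_potential AE.
have -> : 1%:M - ((1 - 2 * dot e e)%:M + 2 *: (e *m e^T) + crossmx x) =
    (2 * dot e e)%:M - 2 *: (e *m e^T) - crossmx x.
  by apply/matrixP => i j; rewrite !mxE; case: (i == j); rewrite ?mulr1n ?mulr0n; ring.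
rewrite !mulmxBl !(raddfB (@mxtrace R 3)) /= mxtrace_cross_sym // subr0.
rewrite mul_scalar_mx -scalemxAl !mxtraceZ (mxtrace_mulC _ M) mxtrace_outer.
rewrite quadform_bar; ring.
Qed.

Lemma attnorm2_axis : attnorm2 A = dot e e.
Proof.
have ce : \tr (crossmx x) = 0 by rewrite mxtrace3E !crossmxE; ring.
have te : \tr (e *m e^T) = dot e e by rewrite mxtrace_mulC /dot trace_mx11.
by rewrite /attnorm2 AE raddfB /= !mxtraceD mxtraceZ !mxtrace_scalar ce te; field.
Qed.

(** As [A] is orthogonal, the left-hand side is half the difference of the traces of the squares of
    [M] and of [M *m A]. In the second square the products of skew and symmetric parts of [A] have
    zero trace, and the skew square is given by the adjugate identity; what remains is polynomial in
    [m1], [m2], [d], [t], [t2]. *)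
Lemma att_dissipation_axis : A *m A^T = 1%:M ->
  att_dissipation A = 2 * (dot (W *m e) (W *m e) - quadform W e ^+ 2).
Proof.
move=> AAt; have AtA : A^T *m A = 1%:M by exact: mulmx1C.
have sW : W^T = W by rewrite /W raddfB /= tr_scalar_mx sM.
set m1 := quadform M e; set m2 := dot (M *m e) (M *m e); set d := dot e e.
set t := \tr M; set t2 := \tr (M *m M).
have dWW : dot (W *m e) (W *m e) = t ^+ 2 * d - 2 * t * m1 + m2.
  rewrite /W !mulmxBl !mul_scalar_mx dotBl !dotBr !dotZl !dotZr.
  by rewrite (dotC (M *m e) e) -[dot e (M *m e)]/m1 -/m2 -/d -/t; ring.
have q2 : quadform (M *m M) e = m2 by rewrite /quadform -mulmxA dot_mulmxr sM.
have MKMK : \tr (M *m crossmx x *m M *m crossmx x) =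
   - 2 * (4 * (1 - d)) * (m2 - t * m1 + 2^-1 * (t ^+ 2 - t2) * d).
  rewrite mxtrace_cross_congr // xx -scalemxAr mxtraceZ mxtrace_outer /quadform.
  rewrite mulmxDl mulmxBl -scalemxAl mul_scalar_mx dotDr dotBr !dotZr.
  by rewrite -[dot e (M *m M *m e)]/(quadform _ _) q2 -/t -/t2 -/d -[dot e (M *m e)]/m1; ring.
have MAMA : \tr (M *m A *m (M *m A)) = (1 - 2 * d) ^+ 2 * t2 + 4 * m1 ^+ 2
    + 4 * (1 - 2 * d) * m2 + \tr (M *m crossmx x *m M *m crossmx x).
  pose E := e *m e^T; pose K := crossmx x.
  have -> : M *m A = (1 - 2 * d) *: M + 2 *: (M *m E) + M *m K.
    by rewrite AE !mulmxDr mul_mx_scalar -scalemxAr.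
  have trE2 : \tr (M *m E *m (M *m E)) = m1 ^+ 2.
    have -> : M *m E *m (M *m E) = m1 *: (M *m E).
      have ee : e^T *m (M *m (e *m e^T)) = m1 *: e^T.
        by rewrite (mulmxA M) mulmxA [e^T *m (M *m e)]mx11_scalar mul_scalar_mx.
      by rewrite /E -!mulmxA ee -!scalemxAr.
    by rewrite mxtraceZ mxtrace_outer expr2.
  have trMK : \tr (M *m (M *m K)) = 0.
    by rewrite mulmxA mxtrace_mulC mxtrace_cross_sym // trmx_mul sM.
  have trEK : \tr (M *m E *m (M *m K)) = 0.
    rewrite mulmxA mxtrace_mulC mxtrace_cross_sym //.
    by rewrite !trmx_mul trmxK sM !mulmxA.
  have trKE : \tr (M *m K *m (M *m E)) = 0 by rewrite mxtrace_mulC.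
  have trKM : \tr (M *m K *m M) = 0 by rewrite mxtrace_mulC.
  have trME : \tr (M *m (M *m E)) = m2 by rewrite mulmxA mxtrace_outer q2.
  have trEM : \tr (M *m E *m M) = m2 by rewrite mxtrace_mulC.
  rewrite !mulmxDl !mulmxDr -!scalemxAl -!scalemxAr !mxtraceD !mxtraceZ.
  rewrite -/t2 trE2 trMK trEK trKE trKM trME trEM mulmxA; ring.
have -> : att_dissipation A = 2^-1 * (t2 - \tr (M *m A *m (M *m A))).
  rewrite /att_dissipation /antisym trmx_mul sM -scalemxAl -scalemxAr !mxtraceZ.
  rewrite mulmxBl !mulmxBr !(raddfB (@mxtrace R 3)) /=.
  have -> : M *m A *m (A^T *m M) = M *m M by rewrite -mulmxA (mulmxA A) AAt mul1mx.
  have -> : \tr (A^T *m M *m (M *m A)) = t2.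
    by rewrite mxtrace_mulC !mulmxA -(mulmxA M) AAt mulmx1.
  have -> : \tr (A^T *m M *m (A^T *m M)) = \tr (M *m A *m (M *m A)).
    by rewrite -mxtrace_tr !trmx_mul !trmxK sM.
  by rewrite -/t2; field.
by rewrite MAMA MKMK dWW quadform_bar -/t -/d -/m1; field.
Qed.

End AttitudePotential.

Section EntrywiseContinuity.
Context {R : realType} {T : topologicalType}.

(** Entrywise, so that continuity of polynomial maps reduces to sums and products of real
    functions. *)
Definition mx_continuous m n (f : T -> 'M[R]_(m, n)) : Prop :=
  forall i j, continuous (fun v => f v i j).

Lemma continuous_bigsum (I : Type) (r : seq I) (f : I -> T -> R) :
  (forall i, continuous (f i)) -> continuous (fun v => \sum_(i <- r) f i v).
Proof.
move=> h; elim: r => [|i r IH] v.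
  rewrite (_ : (fun v => _) = fun=> 0); first exact: cvg_cst.
  by apply/funext => w; rewrite big_nil.
rewrite (_ : (fun v => _) = fun v => f i v + \sum_(i <- r) f i v).
  by apply: continuousD; [exact: h|exact: IH].
by apply/funext => w; rewrite big_cons.
Qed.

Lemma mx_continuous_cst m n (A : 'M[R]_(m, n)) : mx_continuous (fun=> A).
Proof. by move=> i j v; exact: cvg_cst. Qed.

Lemma mx_continuousM m n p (f : T -> 'M[R]_(m, n)) (g : T -> 'M[R]_(n, p)) :
  mx_continuous f -> mx_continuous g -> mx_continuous (fun v => f v *m g v).
Proof.
move=> cf cg i j; rewrite (_ : (fun v => _) = fun v => \sum_k f v i k * g v k j).
  apply: continuous_bigsum => k v; exact: (continuousM (cf i k v) (cg k j v)).
by apply/funext => v; rewrite mxE.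
Qed.

Lemma mx_continuousB m n (f g : T -> 'M[R]_(m, n)) :
  mx_continuous f -> mx_continuous g -> mx_continuous (fun v => f v - g v).
Proof.
move=> cf cg i j; rewrite (_ : (fun v => _) = fun v => f v i j - g v i j).
  move=> v; exact: (continuousB (cf i j v) (cg i j v)).
by apply/funext => v; rewrite !mxE.
Qed.

Lemma mx_continuousZ m n (c : R) (f : T -> 'M[R]_(m, n)) :
  mx_continuous f -> mx_continuous (fun v => c *: f v).
Proof.
move=> cf i j; rewrite (_ : (fun v => _) = fun v => c * f v i j).
  move=> v; apply: continuousM; [exact: cvg_cst|exact: cf].
by apply/funext => v; rewrite mxE.
Qed.

Lemma mx_continuous_tr m n (f : T -> 'M[R]_(m, n)) :
  mx_continuous f -> mx_continuous (fun v => (f v)^T).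
Proof.
move=> cf i j; rewrite (_ : (fun v => _) = fun v => f v j i); first exact: cf.
by apply/funext => v; rewrite mxE.
Qed.

Lemma continuous_mxtrace n (f : T -> 'M[R]_n) :
  mx_continuous f -> continuous (fun v => \tr (f v)).
Proof. by move=> cf; apply: continuous_bigsum. Qed.

Lemma continuous_det3 (f : T -> 'M[R]_3) :
  mx_continuous f -> continuous (fun v => \det (f v)).
Proof.
move=> cf; rewrite (_ : (fun v => _) = fun v =>
  f v 0 0 * (f v 1 1 * f v 2 2 - f v 1 2 * f v 2 1)
  - f v 0 1 * (f v 1 0 * f v 2 2 - f v 1 2 * f v 2 0)
  + f v 0 2 * (f v 1 0 * f v 2 1 - f v 1 1 * f v 2 0)); last first.
  by apply/funext => v; rewrite det3E.
have minor i j k l i' j' k' l' : continuous (fun v => f v i j * f v k l - f v i' j' * f v k' l').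
  move=> v; exact: (continuousB (continuousM (cf i j v) (cf k l v))
    (continuousM (cf i' j' v) (cf k' l' v))).
move=> v; exact: (continuousD (continuousB (continuousM (cf 0 0 v) (minor 1 1 2 2 1 2 2 1 v))
  (continuousM (cf 0 1 v) (minor 1 0 2 2 1 2 2 0 v)))
  (continuousM (cf 0 2 v) (minor 1 0 2 1 1 1 2 0 v))).
Qed.

Lemma closed_continuous_le (f : T -> R) (c : R) : continuous f -> closed [set v | f v <= c].
Proof. by move=> cf; exact: (closed_comp (fun v _ => cf v) (@closed_le R c)). Qed.

Lemma closed_continuous_eq (f : T -> R) (c : R) : continuous f -> closed [set v | f v = c].
Proof. by move=> cf; exact: (closed_comp (fun v _ => cf v) (@closed_eq R c)). Qed.

Lemma closed_SO3 (f : T -> 'M[R]_3) : mx_continuous f -> closed [set v | SO3 (f v)].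
Proof.
move=> cf.
have -> : [set v | SO3 (f v)] =
   (\bigcap_(q in [set: 'I_3 * 'I_3]) [set v | ((f v)^T *m f v) q.1 q.2 = (1%:M : 'M[R]_3) q.1 q.2])
   `&` [set v | \det (f v) = 1].
  apply/seteqP; split => v /=.
    by move=> [fv dv]; split => // q _ /=; rewrite fv.
  move=> [fv dv]; split => //; apply/matrixP => i j; exact: (fv (i, j)).
apply: closedI; last by apply: closed_continuous_eq; exact: continuous_det3.
apply: closed_bigI => q _; apply: closed_continuous_eq.
by apply: mx_continuousM => //; exact: mx_continuous_tr.
Qed.

End EntrywiseContinuity.

(** * Decay rate of the potential on the flow set *)

Section AttitudeDecay.
Context {R : realType}.

Lemma SO3_entry_le (A : 'M[R]_3) i j : SO3 A -> `|A i j| <= 1.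
Proof.
move=> [AtA _]; rewrite -(ler_pXn2r (n := 2)) ?nnegrE // real_normK ?num_real // expr1n.
have := congr1 (fun B : 'M[R]_3 => B j j) AtA; rewrite [RHS]mxE eqxx mulr1n => <-.
rewrite mxE (bigD1 i) //= mxE -expr2 lerDl; apply: sumr_ge0 => k _.
by rewrite mxE -expr2 sqr_ge0.
Qed.

(* Matrices are reshaped into row vectors, for which bounded closed sets are known
   to be compact. *)
Lemma SO3_EVT_min (f : 'M[R]_3 -> R) (C : set 'M[R]_3) :
  continuous (fun v : 'rV[R]_(3 * 3) => f (vec_mx v)) ->
  closed [set v : 'rV[R]_(3 * 3) | C (vec_mx v)] -> C `<=` SO3 ->
  C !=set0 -> exists2 A, C A & forall B, C B -> f A <= f B.
Proof.
move=> cf cC CS [A0 CA0].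
have ccC : compact [set v : 'rV[R]_(3 * 3) | C (vec_mx v)].
  apply: bounded_closed_compact => //.
  exists 1; split => // y y1 v /= /CS Sv; apply: le_trans (ltW y1).
  apply: mx_norm_le => // i j; rewrite (ord1 i).
  by case/mxvec_indexP: j => i' j'; rewrite -[v]vec_mxK mxvecE; exact: SO3_entry_le.
have [|v Cv hv] := EVT_min_rV _ ccC (continuous_subspaceT cf).
  by exists (mxvec A0); rewrite /= mxvecK.
exists (vec_mx v) => // [|B CB]; first by rewrite inE in Cv.
by have := hv (mxvec B); rewrite mxvecK inE /= mxvecK; exact.
Qed.

Lemma mx_continuous_vec_mx : mx_continuous (fun v : 'rV[R]_(3 * 3) => vec_mx v : 'M[R]_3).
Proof.
move=> i j; rewrite (_ : (fun v => _) = fun v : 'rV[R]_(3 * 3) => v 0 (mxvec_index i j)).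
  exact: coord_continuous.
by apply/funext => v; rewrite mxE.
Qed.

Variables (M : 'M[R]_3) (w : R).
Hypothesis hW : posdef_ge w ((\tr M)%:M - M).

Let M_sym : M^T = M.
Proof.
have [sW _ _] := hW; move: sW; rewrite raddfB /= tr_scalar_mx.
by move/addrI/oppr_inj.
Qed.

Lemma att_potential_bounds : exists lo hi : R, 0 < lo /\ 0 < hi /\ forall A, SO3 A ->
  [/\ lo * attnorm2 A <= att_potential M A, att_potential M A <= hi * attnorm2 A
    & 0 <= attnorm2 A <= 1].
Proof.
have [_ w0 hw] := hW; have pW := posdef_ge_psd hW.
exists (2 * w), (2 * (\tr ((\tr M)%:M - M) + 1)).
have t0 := psd_tr_ge0 pW.
split; first by rewrite mulr_gt0.
split; first by rewrite mulr_gt0 // ltr_wpDl.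
move=> A SA; have [e [x [AE xx e1]]] := SO3_axis SA.
rewrite (att_potential_axis M_sym AE) (attnorm2_axis AE) dot_ge0 e1.
have h1 := hw e; have h2 := psd_quadform_le e pW; have h3 := dot_ge0 e.
split => //; rewrite -mulrA ler_wpM2l // (le_trans h2) // ler_wpM2r //.
by rewrite lerDl.
Qed.

(** With q = e^T W e, Cauchy-Schwarz and |e|^2 <= 1/2 give q^2 <= |W e|^2 / 2, so the dissipation is
    at least |W e|^2, which is at least [w * q]. *)
Lemma att_potential_le_small (A : 'M[R]_3) : SO3 A -> attnorm2 A <= 2^-1 ->
  w / 2 * att_potential M A <= att_dissipation M A.
Proof.
have [sW w0 hw] := hW; have pW := posdef_ge_psd hW.
move=> SA; have [e [x [AE xx e1]]] := SO3_axis SA.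
have AAt : A *m A^T = 1%:M by case: SA => h _; exact: mulmx1C.
rewrite (att_potential_axis M_sym AE) (attnorm2_axis AE) (att_dissipation_axis M_sym AE xx AAt).
set W := (\tr M)%:M - M in hw sW pW *.
move=> e2; set q := quadform W e; set y := dot (W *m e) (W *m e); set d := dot e e in e1 e2.
have cs : q ^+ 2 <= d * y by exact: dot_cauchy.
have wd : w * d <= q by exact: hw.
have q0 : 0 <= q by case: pW => _; exact.
have y0 : 0 <= y by exact: dot_ge0.
have wq : w * q <= y.
  have [/eqP ->|qn] := boolP (q == 0); first by rewrite mulr0.
  have qp : 0 < q by rewrite lt_neqAle eq_sym qn.
  rewrite -(ler_pM2r qp) -mulrA -expr2.
  have := ler_wpM2l (ltW w0) cs; have := ler_wpM2r y0 wd.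
  by move=> h1 h2; apply: (le_trans h2); rewrite mulrA (mulrC y).
have : d * y <= 2^-1 * y by rewrite ler_wpM2r.
clear sW AE xx AAt; lra.
Qed.

Local Notation Mv v := (M *m (1%:M - 2 *: (v *m v^T))).
Variables (theta delta D : R) (U : set 'cV[R]_3).
Hypotheses (hD : forall v, unit_eigenvectors M v -> exists u,
    [/\ U u, dot u u = 1 & D <= quadform ((\tr (Mv v))%:M - Mv v) u])
  (hdelta : delta < (1 - cos theta) * D).

(** Without dissipation there is equality in q^2 <= |e|^2 |W e|^2 <= |W e|^2: then |e| = 1 and [e]
    is an eigenvector, so [A] is the half turn about [e] and [M *m A = - Mv e]. The direction [u]
    given by [hD] then violates the flow condition. *)
Lemma att_dissipation_gt0 (A : 'M[R]_3) : SO3 A -> 2^-1 <= attnorm2 A ->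
  (forall u, U u -> \tr ((Ra theta u - 1%:M) *m (M *m A)) <= delta) ->
  0 < att_dissipation M A.
Proof.
have [sW w0 hw] := hW; have pW := posdef_ge_psd hW.
move=> SA; have [e [x [AE xx e1]]] := SO3_axis SA.
have AAt : A *m A^T = 1%:M by case: SA => h _; exact: mulmx1C.
rewrite (attnorm2_axis AE) (att_dissipation_axis M_sym AE xx AAt) => e2 hU.
rewrite ltNge; apply/negP => h.
set W := (\tr M)%:M - M in hw sW pW h *.
set q := quadform W e in h; set y := dot (W *m e) (W *m e) in h.
have q0 : 0 < q by apply: lt_le_trans (hw e); rewrite mulr_gt0 //; lra.
have cs : q ^+ 2 <= dot e e * y by exact: dot_cauchy.
have y0 : 0 < y.
  rewrite lt_neqAle dot_ge0 andbT eq_sym; apply/negP => /eqP y0.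
  by move: cs; rewrite -/y y0 mulr0 leNgt exprn_gt0.
have ee : dot e e = 1.
  apply/eqP; rewrite eq_le e1 /= -(ler_pM2r y0) mul1r.
  by apply: le_trans cs; clear sW AE xx AAt; lra.
have x0 : x = 0.
  apply: dot_eq0; have -> : dot x x = \tr (x *m x^T) by rewrite mxtrace_mulC /dot trace_mx11.
  by rewrite xx ee subrr mulr0 scale0r mxtrace0.
(* The squared distance between the two sides is [y - q ^+ 2], which is nonpositive by [h]. *)
have We : W *m e = q *: e.
  apply/eqP; rewrite -subr_eq0; apply/eqP/dot_eq0/eqP.
  rewrite eq_le dot_ge0 andbT dotBl !dotBr !dotZl !dotZr ee (dotC (W *m e) e).
  by rewrite -[dot e (W *m e)]/q -/y; clear sW AE xx AAt x0; lra.
have Me : M *m e = (\tr M - q) *: e.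
  rewrite scalerBl -We /W mulmxBl mul_scalar_mx; apply/esym.
  by rewrite opprB addrC subrK.
have [u [Uu u1 Du]] : exists u, [/\ U u, dot u u = 1
    & D <= quadform ((\tr (Mv e))%:M - Mv e) u].
  by apply: hD; split; [rewrite /enorm ee sqrtr1|exists (\tr M - q)].
have MA : M *m A = - Mv e.
  rewrite AE ee x0 (_ : crossmx 0 = 0); last first.
    by apply: matrix3P; split; rewrite !crossmxE !mxE ?oppr0.
  rewrite addr0 -mulmxN opprB; congr (_ *m _); rewrite addrC; congr (_ + _).
  by apply/matrixP => i j; rewrite !mxE; case: (i == j); rewrite ?mulr1n ?mulr0n; ring.
(* This rests on [e] being an eigenvector: [M *m (e *m e^T)] is a multiple of [e *m e^T]. *)
have sMv : (Mv e)^T = Mv e.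
  rewrite mulmxBr mulmx1 -scalemxAr mulmxA Me -scalemxAl scalerA.
  by rewrite raddfB /= M_sym linearZ /= trmx_mul trmxK.
have := hU u Uu; rewrite MA mulmxN raddfN /= mxtrace_Ra //.
have c1 : 0 <= 1 - cos theta by rewrite subr_ge0 cos_le1.
have := ler_wpM2l c1 Du; move: hdelta.
clear sW AE xx AAt x0 We Me MA sMv; lra.
Qed.

(** The compact set [C] leaves out a neighbourhood of the identity, where both sides vanish. On [C]
    the dissipation has a positive minimum and the potential is at most [hi]; the rate is the
    smaller of their quotient and the rate near the identity. *)
Lemma att_potential_decay : exists2 c, 0 < c & forall A, SO3 A ->
  (forall u, U u -> \tr ((Ra theta u - 1%:M) *m (M *m A)) <= delta) ->
  c * att_potential M A <= att_dissipation M A.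
Proof.
have [sW w0 hw] := hW; have pW := posdef_ge_psd hW.
have [lo [hi [lo0 [hi0 lohi]]]] := att_potential_bounds.
pose C := [set A : 'M[R]_3 | [/\ SO3 A, 2^-1 <= attnorm2 A &
  forall u, U u -> \tr ((Ra theta u - 1%:M) *m (M *m A)) <= delta]].
have w2 : 0 < w / 2 by rewrite divr_gt0.
have pot_ge0 A : SO3 A -> 0 <= att_potential M A.
  move=> SA; have [h _ /andP[h0 _]] := lohi A SA.
  by apply: le_trans h; rewrite mulr_ge0 // ltW.
have [C0|C0] := pselect (C !=set0); last first.
  exists (w / 2) => // A SA hA; apply: att_potential_le_small => //.
  rewrite leNgt; apply/negP => h; apply: C0; exists A; split => //; exact: ltW.
have cv := mx_continuous_vec_mx.
have H1 : continuous (fun v : 'rV[R]_(3 * 3) => att_dissipation M (vec_mx v)).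
  suff ct : continuous (fun v : 'rV[R]_(3 * 3) =>
      \tr (antisym (M *m vec_mx v) *m antisym (M *m vec_mx v))).
    by move=> v; exact: (cvgN (ct v)).
  apply: continuous_mxtrace.
  have ca : mx_continuous (fun v : 'rV[R]_(3 * 3) => antisym (M *m vec_mx v)).
    apply: mx_continuousZ; apply: mx_continuousB.
      by apply: mx_continuousM => //; exact: mx_continuous_cst.
    by apply: mx_continuous_tr; apply: mx_continuousM => //; exact: mx_continuous_cst.
  exact: mx_continuousM.
have H2 : closed [set v : 'rV[R]_(3 * 3) | C (vec_mx v)].
  have -> : [set v : 'rV[R]_(3 * 3) | C (vec_mx v)] =
     [set v | SO3 (vec_mx v)] `&` [set v : 'rV[R]_(3 * 3) | - attnorm2 (vec_mx v) <= - 2^-1] `&`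
     \bigcap_(u in U) [set v | \tr ((Ra theta u - 1%:M) *m (M *m vec_mx v)) <= delta].
    apply/seteqP; split => v /=.
      by move=> [h1 h2 h3]; split; [split=> //; rewrite lerN2|].
    by move=> [[h1]]; rewrite lerN2 => h2 h3; split.
  apply: closedI; first apply: closedI.
  + exact: closed_SO3.
  + suff ct : continuous (fun v : 'rV[R]_(3 * 3) => \tr (1%:M - vec_mx v : 'M[R]_3)).
      by apply: closed_continuous_le => v; exact: (cvgN (cvgM (cvg_cst _) (ct v))).
    by apply: continuous_mxtrace; apply: mx_continuousB => //; exact: mx_continuous_cst.
  + apply: closed_bigI => u Uu; apply: closed_continuous_le; apply: continuous_mxtrace.
    apply: mx_continuousM; first exact: mx_continuous_cst.
    by apply: mx_continuousM => //; exact: mx_continuous_cst.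
have [|A [SA nA hA] minA] := SO3_EVT_min H1 H2 _ C0; first by move=> A [].
have m0 := att_dissipation_gt0 SA nA hA.
exists (Num.min (w / 2) (att_dissipation M A / hi)).
  by rewrite lt_min w2 divr_gt0.
move=> B SB hB; have [h1 h2 /andP[h3 h4]] := lohi B SB.
case: (leP (attnorm2 B) 2^-1) => hBn.
  apply: le_trans (att_potential_le_small SB hBn).
  by rewrite ler_wpM2r ?pot_ge0 // ge_min lexx.
have hAB : att_dissipation M A <= att_dissipation M B by apply: minA; split => //; exact: ltW.
apply: le_trans hAB; apply: (@le_trans _ _ (att_dissipation M A / hi * att_potential M B)).
  by rewrite ler_wpM2r ?pot_ge0 // ge_min lexx orbT.
rewrite mulrAC ler_pdivrMr // ler_wpM2l ?(ltW m0) // (le_trans h2) //.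
by rewrite ler_piMr // ltW.
Qed.

End AttitudeDecay.

(** * Error dynamics *)

Section BlockMatrices.
Context {R : realType} {m : nat}.
Implicit Types (A B : 'M[R]_m) (v w p q : 'cV[R]_m).

(** The size is kept as [m + 1 + 1], the form in which block lemmas apply; the 5 x 5 statements
    follow by conversion. *)
Definition block_tangent A v p : 'M[R]_(m + 1 + 1) :=
  block_mx (block_mx A v 0 0) (col_mx p 0) 0 0.
Definition block_TT A v p : 'M[R]_(m + 1 + 1) :=
  block_mx (block_mx A v 0 1%:M) (col_mx p 0) 0 1%:M.
Definition block_emb p : 'cV[R]_(m + 1 + 1) := col_mx (col_mx p 0) 0.

Lemma block_tangentD A v p B w q :
  block_tangent A v p + block_tangent B w q = block_tangent (A + B) (v + w) (p + q).
Proof. by rewrite /block_tangent !add_block_mx add_col_mx !addr0. Qed.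

Lemma block_tangent_TT A v p B w q : block_tangent A v p *m block_TT B w q =
  block_tangent (A *m B) (A *m w + v) (A *m q + p).
Proof.
rewrite /block_tangent /block_TT !mulmx_block !mul_block_col.
by rewrite !(mulmx0, mul0mx, mulmx1, addr0, add0r) add_col_mx add0r.
Qed.

Lemma block_TT_mul A v p B w q : block_TT A v p *m block_TT B w q =
  block_TT (A *m B) (A *m w + v) (A *m q + p).
Proof.
rewrite /block_TT !mulmx_block !mul_block_col.
by rewrite !(mulmx0, mul0mx, mulmx1, addr0, add0r) add_col_mx add0r.
Qed.

Lemma block_TT1 : block_TT 1%:M 0 0 = 1%:M.
Proof. by rewrite /block_TT col_mx0 -!scalar_mx_block. Qed.

Lemma block_TT_emb A v p q : block_TT A v p *m block_emb q = block_emb (A *m q).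
Proof.
by rewrite /block_TT /block_emb !mul_block_col !(mulmx0, mul0mx, addr0).
Qed.

Lemma dot_block_emb p : dot (block_emb p) (block_emb p) = dot p p.
Proof.
by rewrite /dot /block_emb !tr_col_mx !mul_row_col !mulmx0 !addr0.
Qed.

End BlockMatrices.

Section GroupSE23.
Context {R : realType}.
Implicit Types (A B : 'M[R]_3) (v p w q x y : 'cV[R]_3) (X Y : 'M[R]_5).

Lemma rotmx_TT A v p : rotmx (TT A v p) = A.
Proof. by rewrite /rotmx /TT !block_mxKul. Qed.
Lemma velmx_TT A v p : velmx (TT A v p) = v.
Proof. by rewrite /velmx /TT block_mxKul block_mxKur. Qed.
Lemma posmx_TT A v p : posmx (TT A v p) = p.
Proof. by rewrite /posmx /TT block_mxKur col_mxKu. Qed.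
Lemma rotmx_tangent A v p : rotmx (tangent A v p) = A.
Proof. by rewrite /rotmx /tangent !block_mxKul. Qed.
Lemma velmx_tangent A v p : velmx (tangent A v p) = v.
Proof. by rewrite /velmx /tangent block_mxKul block_mxKur. Qed.
Lemma posmx_tangent A v p : posmx (tangent A v p) = p.
Proof. by rewrite /posmx /tangent block_mxKur col_mxKu. Qed.

Lemma rotmxE X i j : rotmx X i j = X (lshift 1 (lshift 1 i)) (lshift 1 (lshift 1 j)).
Proof. by rewrite !mxE. Qed.
Lemma velmxE X i j : velmx X i j = X (lshift 1 (lshift 1 i)) (lshift 1 (rshift 3 j)).
Proof. by rewrite !mxE. Qed.
Lemma posmxE X i j : posmx X i j = X (lshift 1 (lshift 1 i)) (rshift 4 j).
Proof. by rewrite !mxE. Qed.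

Lemma tangentD A v p B w q : tangent A v p + tangent B w q = tangent (A + B) (v + w) (p + q).
Proof. exact: (@block_tangentD R 3). Qed.

Lemma tangent_TT A v p B w q :
  tangent A v p *m TT B w q = tangent (A *m B) (A *m w + v) (A *m q + p).
Proof. exact: (@block_tangent_TT R 3). Qed.

Lemma TT_mul A v p B w q : TT A v p *m TT B w q = TT (A *m B) (A *m w + v) (A *m q + p).
Proof. exact: (@block_TT_mul R 3). Qed.

Lemma TT1 : TT 1%:M 0 0 = 1%:M :> 'M[R]_5.
Proof. exact: (@block_TT1 R 3). Qed.

Lemma SE23P X : SE23 X -> X = TT (rotmx X) (velmx X) (posmx X) /\ SO3 (rotmx X).
Proof. by move=> [A [v [p [SA ->]]]]; rewrite rotmx_TT velmx_TT posmx_TT. Qed.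

Lemma SO3_mulV A : SO3 A -> A *m A^T = 1%:M.
Proof. by case=> h _; exact: mulmx1C. Qed.

Lemma SO3_tr A : SO3 A -> SO3 A^T.
Proof. by move=> h; split; [rewrite trmxK SO3_mulV|rewrite det_tr; case: h]. Qed.

Lemma SO3_mul A B : SO3 A -> SO3 B -> SO3 (A *m B).
Proof.
move=> [a1 a2] [b1 b2]; split; last by rewrite det_mulmx a2 b2 mulr1.
by rewrite trmx_mul -mulmxA (mulmxA A^T) a1 mul1mx b1.
Qed.

(** The inverse is not computed: [Y] is factored as [TT A 0 p] times the right-hand side. *)
Lemma invmx_TT_mul A p Y : SO3 A -> SE23 Y -> invmx (TT A 0 p) *m Y =
  TT (A^T *m rotmx Y) (A^T *m velmx Y) (A^T *m (posmx Y - p)).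
Proof.
move=> SA SY; have AAt := SO3_mulV SA.
have uX : TT A 0 p \in unitmx.
  have := mulmx1_unit (_ : TT A 0 p *m TT A^T 0 (- (A^T *m p)) = 1%:M).
  by case=> //; rewrite TT_mul AAt mulmx0 addr0 mulmxN mulmxA AAt mul1mx addNr TT1.
rewrite [in LHS](SE23P SY).1.
have -> : TT (rotmx Y) (velmx Y) (posmx Y) = TT A 0 p *m
    TT (A^T *m rotmx Y) (A^T *m velmx Y) (A^T *m (posmx Y - p)).
  by rewrite TT_mul !mulmxA AAt !mul1mx addr0 subrK.
by rewrite mulKmx.
Qed.

(** For a unit axis the cross matrix satisfies K^3 = - K, which reduces orthogonality to sin^2 +
    cos^2 = 1; the determinant is expanded. *)
Lemma SO3_Ra (theta : R) (u : 'cV[R]_3) : dot u u = 1 -> SO3 (Ra theta u).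
Proof.
move=> u1; have cs := cos2Dsin2 theta.
have uu : u 0 0 * u 0 0 + u 1 0 * u 1 0 + u 2 0 * u 2 0 = 1 by rewrite -dot3E.
set s := sin theta in cs *; set c := cos theta in cs *.
have RaE i j : Ra theta u i j = (1%:M : 'M[R]_3) i j + s * crossmx u i j +
   (1 - c) * ((u *m u^T) i j - (1%:M : 'M[R]_3) i j).
  by rewrite /Ra crossmx_sqr u1 -/s -/c !mxE.
have oE i j : (u *m u^T) i j = u i 0 * u j 0 by rewrite mxE big_ord1 mxE.
have K3 : crossmx u *m crossmx u *m crossmx u = - crossmx u.
  rewrite crossmx_sqr u1 mulmxBl mul1mx.
  have -> : u *m u^T *m crossmx u = 0; last by rewrite sub0r.
  rewrite -mulmxA; have -> : u^T *m crossmx u = 0; last by rewrite mulmx0.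
  apply/matrixP => i j; rewrite ord1 mulmx3E !mxE -/(crossmx u _ _).
  by have [->|->|->] := ord3P j => /=; ring.
split.
  rewrite /Ra -/s -/c; have := crossmx_skew u; move: (crossmx u) K3 => K K3 KT.
  have -> : (1%:M + s *: K + (1 - c) *: (K *m K))^T = 1%:M - s *: K + (1 - c) *: (K *m K).
    by rewrite !raddfD /= !linearZ /= trmx_mul KT mulmxN mulNmx opprK tr_scalar_mx scalerN.
  have K4 : K *m K *m (K *m K) = - (K *m K) by rewrite mulmxA K3 mulNmx.
  have K3' : K *m (K *m K) = - K by rewrite mulmxA.
  rewrite !mulmxDl !mulmxDr !mul1mx !mulmx1 !mulNmx -!scalemxAl -!scalemxAr ?mulmxN.
  rewrite K3 K3' K4 !scalerA.
  have sc : s * s = 1 - c * c by rewrite -cs -!expr2; ring.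
  apply/matrixP => i j; move: (K *m K) => K2; rewrite !mxE.
  move: (K i j) (K2 i j) => k k2.
ring: sc.
rewrite det3E !RaE !scalar3E !crossmxE !oE.
have sc : s ^+ 2 = 1 - c ^+ 2 by rewrite -cs; ring.
have uu2 : u 2 0 * u 2 0 = 1 - u 0 0 * u 0 0 - u 1 0 * u 1 0 by rewrite -uu; ring.
ring: sc uu2.
Qed.

End GroupSE23.

(** * Landmark quantities in terms of the estimation errors *)

Section Landmarks.
Context {R : realType}.
Variables (n : nat) (p : 'I_n -> 'cV[R]_3) (k : 'I_n -> R).
Hypotheses (hk : forall i, 0 < k i) (hkc : kc k != 0).
Local Notation M := (MM p k).
Local Notation pc := (pc p k).
Local Notation q i := (p i - pc).

Lemma wcenterB m (x : 'I_n -> 'cV[R]_m) : \sum_i k i *: (x i - wcenter k x) = 0.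
Proof.
rewrite (eq_bigr (fun i => k i *: x i - k i *: wcenter k x)); last first.
  by move=> i _; rewrite scalerBr.
rewrite sumrB -scaler_suml -/(kc k) /wcenter scalerA mulfV // scale1r.
exact: subrr.
Qed.

(** Centring removes translations: this is why [Upsilon] depends on the attitudes only. *)
Lemma wcenter_affine m m' (x : 'I_n -> 'cV[R]_m) (A : 'M[R]_(m', m)) (c : 'cV[R]_m') i :
  A *m x i + c - wcenter k (fun i => A *m x i + c) = A *m (x i - wcenter k x).
Proof.
have -> : wcenter k (fun i => A *m x i + c) = A *m wcenter k x + c.
  rewrite /wcenter (eq_bigr (fun i => A *m (k i *: x i) + k i *: c)); last first.
    by move=> j _; rewrite scalerDr -scalemxAr.
  rewrite big_split /= -scaler_suml -/(kc k) -mulmx_sumr scalerDr scalerA mulVf //.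
  by rewrite scale1r -scalemxAr.
by rewrite mulmxBr opprD addrACA subrr addr0.
Qed.

Lemma MM_sym : M^T = M.
Proof.
rewrite /MM raddf_sum /=; apply: eq_bigr => i _.
by rewrite linearZ /= trmx_mul trmxK.
Qed.

Lemma mxtrace_MM (B : 'M[R]_3) : \tr (B *m M) = \sum_i k i * quadform B (q i).
Proof.
rewrite /MM mulmx_sumr raddf_sum /=; apply: eq_bigr => i _.
by rewrite -scalemxAr mxtraceZ mxtrace_outer.
Qed.

Definition emb_mx : 'M[R]_(5, 3) := (col_mx (col_mx 1%:M 0) 0 : 'M[R]_(3 + 1 + 1, 3)).

Lemma homogE (x : 'cV[R]_3) : homog x = emb_mx *m x + homog 0.
Proof.
have E : (col_mx (col_mx x 0) 1%:M : 'cV[R]_(3 + 1 + 1)) =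
    (col_mx (col_mx 1%:M 0) 0 : 'M[R]_(3 + 1 + 1, 3)) *m x + col_mx (col_mx 0 0) 1%:M.
  by rewrite !mul_col_mx mul1mx !mul0mx !add_col_mx !addr0 add0r.
exact: E.
Qed.

Lemma emb_mxE (x : 'cV[R]_3) : emb_mx *m x = @block_emb R 3 x.
Proof.
have E : (col_mx (col_mx 1%:M 0) 0 : 'M[R]_(3 + 1 + 1, 3)) *m x = @block_emb R 3 x.
  by rewrite /block_emb !mul_col_mx mul1mx !mul0mx.
exact: E.
Qed.

Lemma TT_emb A v w (x : 'cV[R]_3) : TT A v w *m (emb_mx *m x) = emb_mx *m (A *m x).
Proof. rewrite !emb_mxE; exact: (@block_TT_emb R 3). Qed.

Lemma dot_emb (x : 'cV[R]_3) : dot (emb_mx *m x) (emb_mx *m x) = dot x x.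
Proof. rewrite emb_mxE; exact: (@dot_block_emb R 3). Qed.

Lemma homog_center m (x : 'I_n -> 'cV[R]_m) (A : 'M[R]_(3, m)) c i :
  homog (A *m x i + c) - wcenter k (fun i => homog (A *m x i + c)) =
  emb_mx *m (A *m (x i - wcenter k x)).
Proof.
have E j : homog (A *m x j + c) = (emb_mx *m A) *m x j + (emb_mx *m c + homog 0).
  by rewrite homogE mulmxDr mulmxA addrA.
have -> : (fun i => homog (A *m x i + c)) =
    fun i => (emb_mx *m A) *m x i + (emb_mx *m c + homog 0) by apply/funext.
by rewrite E wcenter_affine mulmxA.
Qed.

(** Centring leaves the residuals [q i - T *m q i] with [T] orthogonal, and the squared norm of such
    a residual is twice the form of [1%:M - T] at [q i]. *)
Lemma Upsilon_att (X : 'M[R]_5) (B : 'M[R]_3) (v w : 'cV[R]_3) : SO3 (rotmx X) -> SO3 B ->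
  Upsilon k (TT B v w) (rvec p) (bvec (landmark_meas p X)) =
  att_potential M (rotmx X *m B^T).
Proof.
move=> SR SB; set A := rotmx X.
have BBt := SO3_mulV SB; have AAt := SO3_mulV SR; have AtA := proj1 SR.
pose T := B *m A^T.
have TT1 : T^T *m T = 1%:M.
  by rewrite /T trmx_mul trmxK -mulmxA (mulmxA B^T) (proj1 SB) mul1mx.
rewrite /Upsilon.
have E i : (rvec p i - wcenter k (rvec p)) -
    TT B v w *m (bvec (landmark_meas p X) i - wcenter k (bvec (landmark_meas p X))) =
    emb_mx *m (q i - T *m q i).
  have -> : rvec p i - wcenter k (rvec p) = emb_mx *m q i.
    have := homog_center p 1%:M 0 i; rewrite mul1mx addr0 mul1mx.
    rewrite (_ : (fun i => homog (1%:M *m p i + 0)) = rvec p) //.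
    by apply/funext => j; rewrite mul1mx addr0.
  have -> : bvec (landmark_meas p X) i - wcenter k (bvec (landmark_meas p X)) =
      emb_mx *m (A^T *m q i).
    have := homog_center p A^T (- (A^T *m posmx X)) i; rewrite -mulmxBr.
    rewrite (_ : (fun i => homog _) = bvec (landmark_meas p X)) //.
    by apply/funext => j; rewrite -mulmxBr.
  by rewrite TT_emb -mulmxBr mulmxA.
under eq_bigr do rewrite E enorm_sqr dot_emb.
rewrite /att_potential.
have -> : A *m B^T = T^T by rewrite /T trmx_mul trmxK.
rewrite mxtrace_MM mulr_sumr; apply: eq_bigr => i _.
rewrite mulrCA; congr (_ * _); move: (q i) => y.
rewrite dotBl !dotBr /quadform mulmxBl mul1mx dotBr.
have -> : dot (T *m y) (T *m y) = dot y y by rewrite dot_mulmxr mulmxA TT1 mul1mx.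
by rewrite (dot_mulmxr T^T) trmxK (dotC y (T *m y)); field.
Qed.

Variable X Xh : 'M[R]_5.
Hypotheses (SX : SE23 X) (SXh : SE23 Xh).

Lemma Rtilde_SO3 : SO3 (Rtilde X Xh).
Proof.
by apply: SO3_mul; [case: (SE23P SX)|apply: SO3_tr; case: (SE23P SXh)].
Qed.

Lemma Upsilon_est : Upsilon k Xh (rvec p) (bvec (landmark_meas p X)) =
  att_potential M (Rtilde X Xh).
Proof.
have [XhE SRh] := SE23P SXh; have [_ SR] := SE23P SX.
by rewrite {1}XhE Upsilon_att.
Qed.

Lemma Upsilon_jump_att (theta : R) (u : 'cV[R]_3) : dot u u = 1 ->
  Upsilon_jump p k Xh (landmark_meas p X) (TT (Ra theta u) 0 ((1%:M - Ra theta u) *m pc)) =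
  att_potential M (Rtilde X Xh *m Ra theta u).
Proof.
move=> u1; have SRa := SO3_Ra theta u1; have [_ SRh] := SE23P SXh; have [_ SR] := SE23P SX.
rewrite /Upsilon_jump invmx_TT_mul // Upsilon_att //; last exact: SO3_mul (SO3_tr SRa) SRh.
by rewrite trmx_mul trmxK mulmxA.
Qed.

(** The residual is a rotation term in the centred landmark plus a translation term common to all
    landmarks. Weighting by [(q i)^T] removes the second and plain weighted summation the first,
    which separates attitude from translation. *)
Lemma ytildeE i : ytilde p Xh (landmark_meas p X) i =
  (1%:M - (Rtilde X Xh)^T) *m q i + (Rtilde X Xh)^T *m ptilde_e p k X Xh.
Proof.
have [_ SRh] := SE23P SXh; have [_ SR] := SE23P SX.
have T1 : (Rtilde X Xh)^T *m Rtilde X Xh = 1%:M by case: Rtilde_SO3.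
rewrite /ptilde_e /ptilde /ytilde /landmark_meas.
have -> : rotmx Xh *m ((rotmx X)^T *m (p i - posmx X)) = (Rtilde X Xh)^T *m (p i - posmx X).
  by rewrite mulmxA /Rtilde trmx_mul trmxK.
move: (Rtilde X Xh) T1 => T T1.
rewrite !(mulmxBr, mulmxBl) !mul1mx !mulmxA T1 !mul1mx.
by apply/matrixP => i' j'; rewrite !mxE; ring.
Qed.

Lemma DeltaRE : DeltaR p k Xh (landmark_meas p X) = (1%:M - (Rtilde X Xh)^T) *m M.
Proof.
rewrite /DeltaR /MM mulmx_sumr.
have z : \sum_i k i *: (((Rtilde X Xh)^T *m ptilde_e p k X Xh) *m (q i)^T) = 0.
  rewrite (eq_bigr (fun i => ((Rtilde X Xh)^T *m ptilde_e p k X Xh) *m (k i *: q i)^T)).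
    rewrite -mulmx_sumr.
    have -> : \sum_i (k i *: q i)^T = (\sum_i k i *: q i)^T by rewrite raddf_sum.
    by rewrite wcenterB trmx0 mulmx0.
  move=> i _; have -> : (k i *: q i)^T = k i *: (q i)^T by rewrite linearZ.
  by rewrite -scalemxAr.
transitivity (\sum_i ((1%:M - (Rtilde X Xh)^T) *m (k i *: (q i *m (q i)^T)) +
    k i *: (((Rtilde X Xh)^T *m ptilde_e p k X Xh) *m (q i)^T))); last first.
  by rewrite big_split /= z addr0.
by apply: eq_bigr => i _; rewrite ytildeE mulmxDl scalerDr -scalemxAr mulmxA.
Qed.

Lemma DeltapE : Deltap p k Xh (landmark_meas p X) =
  kc k *: ((Rtilde X Xh)^T *m ptilde_e p k X Xh).
Proof.
rewrite /Deltap (eq_bigr (fun i => (1%:M - (Rtilde X Xh)^T) *m (k i *: q i) +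
    k i *: ((Rtilde X Xh)^T *m ptilde_e p k X Xh))); last first.
  by move=> i _; rewrite ytildeE scalerDr -scalemxAr.
by rewrite big_split /= -mulmx_sumr wcenterB mulmx0 add0r -scaler_suml.
Qed.

Lemma antisym_DeltaR : antisym (DeltaR p k Xh (landmark_meas p X)) = antisym (M *m Rtilde X Xh).
Proof.
rewrite DeltaRE; move: (Rtilde X Xh) => T; rewrite /antisym !trmx_mul MM_sym.
have -> : (1%:M - T^T)^T = 1%:M - T.
  by rewrite linearB /= trmxK trmx1.
rewrite mulmxBl mulmxBr mul1mx mulmx1.
by congr (_ *: _); apply/matrixP => i j; rewrite !mxE; ring.
Qed.

End Landmarks.

Section ErrorDynamics.
Context {R : realType}.

Lemma is_derive_rotmx (f : R -> 'M[R]_5) s df :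
  is_derive s (1 : R) f df -> is_derive s (1 : R) (fun u => rotmx (f u)) (rotmx df).
Proof.
move=> /is_derive_mxP h; apply/is_derive_mxP => i j; rewrite rotmxE.
by rewrite (_ : (fun u => _) = fun u => f u (lshift 1 (lshift 1 i)) (lshift 1 (lshift 1 j)));
   [exact: h|apply/funext => u; rewrite rotmxE].
Qed.

Lemma is_derive_velmx (f : R -> 'M[R]_5) s df :
  is_derive s (1 : R) f df -> is_derive s (1 : R) (fun u => velmx (f u)) (velmx df).
Proof.
move=> /is_derive_mxP h; apply/is_derive_mxP => i j; rewrite velmxE.
by rewrite (_ : (fun u => _) = fun u => f u (lshift 1 (lshift 1 i)) (lshift 1 (rshift 3 j)));
   [exact: h|apply/funext => u; rewrite velmxE].
Qed.

Lemma is_derive_posmx (f : R -> 'M[R]_5) s df :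
  is_derive s (1 : R) f df -> is_derive s (1 : R) (fun u => posmx (f u)) (posmx df).
Proof.
move=> /is_derive_mxP h; apply/is_derive_mxP => i j; rewrite posmxE.
by rewrite (_ : (fun u => _) = fun u => f u (lshift 1 (lshift 1 i)) (rshift 4 j));
   [exact: h|apply/funext => u; rewrite posmxE].
Qed.

Lemma is_derive_col_mx (f g : R -> 'cV[R]_3) s df dg :
  is_derive s (1 : R) f df -> is_derive s (1 : R) g dg ->
  is_derive s (1 : R) (fun u => col_mx (f u) (g u) : 'cV[R]_6) (col_mx df dg).
Proof.
move=> /is_derive_mxP hf /is_derive_mxP hg; apply/is_derive_mxP => i j.
have [[i' iE]|[i' iE]] : (exists i' : 'I_3, i = lshift 3 i') \/ (exists i' : 'I_3, i = rshift 3 i').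
  by rewrite -(@fintype.splitK 3 3 i); case: (@fintype.split 3 3 i) => i'; [left|right]; exists i'.
- rewrite iE (_ : (fun u => _) = fun u => f u i' j); last by apply/funext => u; exact: col_mxEu.
  by apply: (is_derive_eq (hf i' j)); apply/esym; exact: col_mxEu.
- rewrite iE (_ : (fun u => _) = fun u => g u i' j); last by apply/funext => u; exact: col_mxEd.
  by apply: (is_derive_eq (hg i' j)); apply/esym; exact: col_mxEd.
Qed.

Lemma antisym_tr (A : 'M[R]_3) : (antisym A)^T = - antisym A.
Proof.
apply/matrixP => i j; rewrite !mxE; ring.
Qed.

Variables (n : nat) (g : 'cV[R]_3) (p : 'I_n -> 'cV[R]_3) (k : 'I_n -> R).
Variables (omega a : R -> 'cV[R]_3) (kR : R) (Q : R -> 'M[R]_3) (P : R -> 'M[R]_6).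
Hypothesis hkc : kc k != 0.
Local Notation M := (MM p k).

(** [s] is the parameter of differentiation and [t] the system time. They are kept apart because the
    time component of a solution may start at any value; [X] will be the true trajectory shifted
    accordingly. *)
Variables (X Xh : R -> 'M[R]_5) (s t : R).
Hypotheses (SX : SE23 (X s)) (SXh : SE23 (Xh s))
  (dX : is_derive s (1 : R) X (insf g (X s) (omega t) (a t)))
  (dXh : is_derive s (1 : R) Xh
     (observer_flow g p k omega a kR Q P t (Xh s) (landmark_meas p (X s)))).

Let Rt := Rtilde (X s) (Xh s).
Let S := antisym (M *m Rt).
Let Om := crossmx (omega t).
Let L1 : 'M[R]_3 := usubmx (LL Q P t).
Let L2 : 'M[R]_3 := dsubmx (LL Q P t).
Let x1 := (rotmx (X s))^T *m ptilde_e p k (X s) (Xh s).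
Let x2 := (rotmx (X s))^T *m vtilde (X s) (Xh s).

Let dR : is_derive s (1 : R) (fun u => rotmx (X u)) (rotmx (X s) *m Om).
Proof. by have := is_derive_rotmx dX; rewrite /insf rotmx_tangent. Qed.
Let dv : is_derive s (1 : R) (fun u => velmx (X u)) (g + rotmx (X s) *m a t).
Proof. by have := is_derive_velmx dX; rewrite /insf velmx_tangent. Qed.
Let dp : is_derive s (1 : R) (fun u => posmx (X u)) (velmx (X s)).
Proof. by have := is_derive_posmx dX; rewrite /insf posmx_tangent. Qed.

(** Conjugating the gain by the estimated rotation turns the inertial innovation into the body-frame
    error [x1], on which [L] acts directly. *)
Let gain_Deltap (L : 'M[R]_3) : (kc k)^-1 *: (rotmx (Xh s) *m L *m (rotmx (Xh s))^T)
   *m Deltap p k (Xh s) (landmark_meas p (X s)) = rotmx (Xh s) *m (L *m x1).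
Proof.
have [_ SRh] := SE23P SXh.
rewrite DeltapE // -scalemxAl -scalemxAr scalerA mulVf // scale1r.
rewrite -!mulmxA; congr (_ *m (_ *m _)); rewrite /x1 !mulmxA; congr (_ *m _).
by rewrite /Rtilde trmx_mul trmxK mulmxA (proj1 SRh) mul1mx.
Qed.

Let flowE : observer_flow g p k omega a kR Q P t (Xh s) (landmark_meas p (X s)) =
  tangent (rotmx (Xh s) *m Om + kR *: S *m rotmx (Xh s))
    (g + rotmx (Xh s) *m a t + (kR *: S *m velmx (Xh s) + rotmx (Xh s) *m (L2 *m x1)))
    (velmx (Xh s) + (kR *: S *m posmx (Xh s) +
       (rotmx (Xh s) *m (L1 *m x1) - kR *: S *m pc p k))).
Proof.
rewrite /observer_flow /insf /innovation mulNmx opprK antisym_DeltaR //.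
rewrite [X in _ + tangent _ _ _ *m X](proj1 (SE23P SXh)) tangent_TT tangentD.
by rewrite /Kp /Kv !gain_Deltap.
Qed.

Let dRh : is_derive s (1 : R) (fun u => rotmx (Xh u))
  (rotmx (Xh s) *m Om + kR *: S *m rotmx (Xh s)).
Proof. by have := is_derive_rotmx dXh; rewrite flowE rotmx_tangent. Qed.
Let dvh : is_derive s (1 : R) (fun u => velmx (Xh u))
  (g + rotmx (Xh s) *m a t + (kR *: S *m velmx (Xh s) + rotmx (Xh s) *m (L2 *m x1))).
Proof. by have := is_derive_velmx dXh; rewrite flowE velmx_tangent. Qed.
Let dph : is_derive s (1 : R) (fun u => posmx (Xh u))
  (velmx (Xh s) + (kR *: S *m posmx (Xh s) +
       (rotmx (Xh s) *m (L1 *m x1) - kR *: S *m pc p k))).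
Proof. by have := is_derive_posmx dXh; rewrite flowE posmx_tangent. Qed.

(** The body rate multiplies both rotations on the right and cancels in their quotient. *)
Lemma rotation_error_derive :
  is_derive s (1 : R) (fun u => Rtilde (X u) (Xh u)) (- (kR *: (Rt *m S))).
Proof.
apply: (is_derive_eq (is_derive_mulmx dR (is_derive_trmx dRh))).
have KT : S^T = - S by exact: antisym_tr.
have OT : Om^T = - Om by exact: crossmx_skew.
rewrite /Rt /Rtilde; move: (S) (Om) KT OT => K O KT OT.
have -> : (rotmx (Xh s) *m O + kR *: K *m rotmx (Xh s))^T =
   - (O *m (rotmx (Xh s))^T) - kR *: ((rotmx (Xh s))^T *m K).
  rewrite linearD /= !trmx_mul (_ : (kR *: K)^T = - (kR *: K)); last first.
    by rewrite linearZ /= KT scalerN.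
  by rewrite OT mulNmx mulmxN -scalemxAr.
by rewrite mulmxBr mulmxN !mulmxA addNKr -scalemxAr mulmxA.
Qed.

(** The acceleration cancels because [Rt] carries the estimated rotation to the true one, and the
    attitude correction cancels because it turns the estimate about [pc], the centre used in the
    position error. Gravity, fixed in the inertial frame, leaves the last term. *)
Lemma translation_error_derive :
  is_derive s (1 : R) (fun u => xerr p k (X u) (Xh u))
    (AA omega t *m xerr p k (X s) (Xh s) - LL Q P t *m CC *m xerr p k (X s) (Xh s)
     + (col_mx 0 ((rotmx (X s))^T *m ((1%:M - Rt) *m g)) : 'cV[R]_(3 + 3))).
Proof.
have [_ SR] := SE23P SX; have [_ SRh] := SE23P SXh.
have dRt := rotation_error_derive.
have RRh : Rt *m rotmx (Xh s) = rotmx (X s).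
  by rewrite /Rt /Rtilde -mulmxA (proj1 SRh) mulmx1.
have dvt : is_derive s (1 : R) (fun u => vtilde (X u) (Xh u))
    ((1%:M - Rt) *m g - rotmx (X s) *m (L2 *m x1)).
  apply: (is_derive_eq (is_deriveB dv (is_derive_mulmx dRt dvh))).
  rewrite -/Rt; move: (Rt) RRh (S) (x1) => T RRh K z.
  rewrite !mulmxDr mulmxBl mul1mx mulNmx -!scalemxAl -scalemxAr !mulmxA RRh.
  move: (rotmx (X s) *m a t) (rotmx (X s) *m L2 *m z) (T *m g) => A1 A2 A3.
  move: (kR *: (T *m K *m velmx (Xh s))) => A4.
  apply/matrixP => i j; rewrite !mxE; ring.
have dpt : is_derive s (1 : R) (fun u => ptilde_e p k (X u) (Xh u))
    (vtilde (X s) (Xh s) - rotmx (X s) *m (L1 *m x1)).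
  have d1 := is_deriveB dp (is_derive_mulmx dRt dph).
  have d2 := is_derive_mulmx (is_deriveB (is_derive_cst (1%:M : 'M[R]_3) s (1 : R)) dRt)
     (is_derive_cst (pc p k) s (1 : R)).
  apply: (is_derive_eq (is_deriveB d1 d2)).
  rewrite -/Rt mulmx0 addr0 sub0r opprK /vtilde -/Rt.
  move: (Rt) RRh (S) (x1) => T RRh K z.
  rewrite !mulmxDr !mulmxN !mulNmx -!scalemxAl -!scalemxAr !mulmxA RRh.
  move: (rotmx (X s) *m L1 *m z) (T *m velmx (Xh s)) => A1 A2.
  move: (kR *: (T *m K *m posmx (Xh s))) (kR *: (T *m K *m pc p k)) => A3 A4.
  apply/matrixP => i j; rewrite !mxE; ring.
have OT : Om^T = - Om by exact: crossmx_skew.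
have dx1 : is_derive s (1 : R) (fun u => (rotmx (X u))^T *m ptilde_e p k (X u) (Xh u))
    (- (Om *m x1) + x2 - L1 *m x1).
  apply: (is_derive_eq (is_derive_mulmx (is_derive_trmx dR) dpt)).
  have RR y : (rotmx (X s))^T *m (rotmx (X s) *m y) = y :> 'cV[R]_3.
    by rewrite mulmxA (proj1 SR) mul1mx.
  by rewrite trmx_mul OT !mulNmx -mulmxA -/x1 mulmxBr -/x2 RR addrA.
have dx2 : is_derive s (1 : R) (fun u => (rotmx (X u))^T *m vtilde (X u) (Xh u))
    (- (Om *m x2) + (rotmx (X s))^T *m ((1%:M - Rt) *m g) - L2 *m x1).
  apply: (is_derive_eq (is_derive_mulmx (is_derive_trmx dR) dvt)).
  have RR y : (rotmx (X s))^T *m (rotmx (X s) *m y) = y :> 'cV[R]_3.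
    by rewrite mulmxA (proj1 SR) mul1mx.
  by rewrite trmx_mul OT !mulNmx -mulmxA -/x2 mulmxBr RR addrA.
apply: (is_derive_eq (is_derive_col_mx dx1 dx2)).
have E : (block_mx (- Om) 1%:M 0 (- Om) : 'M[R]_(3 + 3)) *m col_mx x1 x2
    - LL Q P t *m (row_mx 1%:M 0 : 'M[R]_(3, 3 + 3)) *m col_mx x1 x2
    + col_mx 0 ((rotmx (X s))^T *m ((1%:M - Rt) *m g)) =
   col_mx (- (Om *m x1) + x2 - L1 *m x1)
     (- (Om *m x2) + (rotmx (X s))^T *m ((1%:M - Rt) *m g) - L2 *m x1).
  rewrite -[LL Q P t]vsubmxK -/L1 -/L2 -mulmxA mul_row_col mul1mx mul0mx addr0 (mul_col_mx L1).
  rewrite mul_block_col mul1mx mul0mx add0r !mulNmx.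
  rewrite opp_col_mx !add_col_mx addr0; congr (col_mx _ _).
  by rewrite addrAC.
by rewrite -E.
Qed.

End ErrorDynamics.

(** * The hybrid closed loop *)

Section LandmarkGeometry.
Context {R : realType}.
Variables (n : nat) (p : 'I_n -> 'cV[R]_3) (k : 'I_n -> R).
Hypothesis hk : forall i, 0 < k i.
Local Notation M := (MM p k).
Local Notation q i := (p i - pc p k).

Lemma kc_gt0 : (0 < n)%N -> 0 < kc k.
Proof.
move=> n0; rewrite /kc (bigD1 (Ordinal n0)) //= ltr_pwDl //.
by apply: sumr_ge0 => i _; exact: ltW.
Qed.

(** The form is a weighted sum of Cauchy-Schwarz defects of [q i] and [x]. If it vanishes, every
    landmark lies on the line through [pc p k] with direction [x]. *)
Lemma barM_pos_def (hp : exists i j l : 'I_n, ~ collinear (p i) (p j) (p l)) :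
  pos_def ((\tr M)%:M - M).
Proof.
split; first by rewrite linearB /= tr_scalar_mx MM_sym.
move=> x x0; have xx := dot_gt0 x0.
have E : quadform ((\tr M)%:M - M) x =
    \sum_i k i * (dot (q i) (q i) * dot x x - dot (q i) x ^+ 2).
  rewrite quadform_bar.
  have -> : \tr M = \sum_i k i * dot (q i) (q i).
    have := mxtrace_MM p k 1%:M; rewrite mul1mx => ->.
    by apply: eq_bigr => i _; rewrite /quadform mul1mx.
  have -> : quadform M x = \sum_i k i * dot (q i) x ^+ 2.
    rewrite -mxtrace_outer mxtrace_mulC mxtrace_MM; apply: eq_bigr => i _.
    congr (_ * _); rewrite /quadform -mulmxA [x^T *m _]mx11_scalar -/(dot x (q i)).
    by rewrite mul_mx_scalar dotZr (dotC x) expr2.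
  rewrite mulr_suml -sumrB; apply: eq_bigr => i _; ring.
have ge0 i : 0 <= k i * (dot (q i) (q i) * dot x x - dot (q i) x ^+ 2).
  by rewrite mulr_ge0 ?(ltW (hk i)) // subr_ge0 dot_cauchy.
rewrite lt_neqAle E sumr_ge0 // andbT eq_sym; apply/negP => /eqP.
move/psumr_eq0P => h; case: hp => i [j [l]]; apply.
have line i' : p i' = pc p k + (dot (q i') x / dot x x) *: x.
  have /eqP := h (fun i _ => ge0 i) i' isT.
  rewrite mulf_eq0 gt_eqF ?hk //= subr_eq0 => /eqP e.
  suff : q i' = (dot (q i') x / dot x x) *: x by move=> <-; rewrite addrC subrK.
  move: (p i' - pc p k) e => y e.
  apply/eqP; rewrite -subr_eq0; apply/eqP/dot_eq0.
  rewrite dotBl !dotBr !dotZl !dotZr (dotC x y).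
  have -> : dot y y = dot y x ^+ 2 / dot x x by rewrite -e mulfK // gt_eqF.
  by field; rewrite gt_eqF.
exists (pc p k), x => y; rewrite !inE => /or3P[]/eqP ->; eexists; exact: line.
Qed.

Lemma Upsilon_ge0 (Xh : 'M[R]_5) (r b : 'I_n -> 'cV[R]_5) : 0 <= Upsilon k Xh r b.
Proof.
rewrite mulr_ge0 ?invr_ge0 //; apply: sumr_ge0 => i _.
by rewrite mulr_ge0 ?sqr_ge0 // ltW.
Qed.

(* Positivity excludes the junk value 0 of [inf] and [sup] on unbounded or empty sets. *)
Lemma DeltaMstar_adherent (U : set 'cV[R]_3) (e : R) : U `<=` sphere2 ->
  0 < DeltaMstar p k U -> 0 < e ->
  forall v, unit_eigenvectors M v -> exists u, [/\ U u, dot u u = 1 &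
    DeltaMstar p k U - e <= quadform ((\tr (Mv p k v))%:M - Mv p k v) u].
Proof.
move=> US D0 e0 v hv.
set f := fun v u => quadform ((\tr (Mv p k v))%:M - Mv p k v) u.
have D1 : DeltaMstar p k U <= sup [set f v u | u in U].
  apply: ge_inf; last by exists v.
  apply: contrapT => h; move: D0; rewrite /DeltaMstar inf_out ?ltxx // => -[_ h'].
  exact: h.
have hs : has_sup [set f v u | u in U].
  apply: contrapT => h; move: (lt_le_trans D0 D1); rewrite sup_out ?ltxx //.
have [_ [u Uu <-] fu] := sup_adherent e0 hs.
exists u; split => //; last by rewrite -/(f v u); lra.
by have := US u Uu; rewrite /sphere2 /= => u1; rewrite -enorm_sqr u1 expr1n.
Qed.

Variables (theta delta : R) (U : set 'cV[R]_3) (X Xh : 'M[R]_5).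
Hypotheses (hkc : kc k != 0) (US : U `<=` sphere2) (SX : SE23 X) (SXh : SE23 Xh).
Local Notation y := (landmark_meas p X).

Lemma sphere2_dot (u : 'cV[R]_3) : U u -> dot u u = 1.
Proof.
by move=> /US; rewrite /sphere2 /= => u1; rewrite -enorm_sqr u1 expr1n.
Qed.

(** The trace is the drop of the potential under the jump along [u]; it is at most the largest such
    drop, [muQ], which the flow set bounds by [delta]. *)
Lemma Fo_att : Fo p k theta U delta y Xh -> forall u, U u ->
  \tr ((Ra theta u - 1%:M) *m (M *m Rtilde X Xh)) <= delta.
Proof.
move=> [_ mu] u Uu; have u1 := sphere2_dot Uu.
pose Xq := TT (Ra theta u) 0 ((1%:M - Ra theta u) *m pc p k).
have hinf : inf [set Upsilon_jump p k Xh y Xq | Xq in QQ p k theta U] <= Upsilon_jump p k Xh y Xq.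
  apply: ge_inf; last by exists Xq => //; exists u.
  by exists 0 => _ [Y _ <-]; exact: Upsilon_ge0.
move: mu; rewrite /muQ Upsilon_est //.
move: hinf; rewrite Upsilon_jump_att // /att_potential.
have -> : \tr ((Ra theta u - 1%:M) *m (M *m Rtilde X Xh)) =
   \tr ((1%:M - Rtilde X Xh) *m M) - \tr ((1%:M - Rtilde X Xh *m Ra theta u) *m M).
  rewrite mulmxBl !(mulmxBl, raddfB) /= !mul1mx.
  rewrite (mxtrace_mulC M) -[_ *m Ra theta u *m M]mulmxA.
  rewrite (mxtrace_mulC (Rtilde X Xh) (Ra theta u *m M)) mulmxA; ring.
move: (inf _) => i; lra.
Qed.

(** A minimizer attains the infimum in [muQ], so its drop is at least [delta]. *)
Lemma jump_att (z1 : 'M[R]_5) : Jo p k theta U delta y Xh -> gamma_min p k theta U y Xh z1 ->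
  SO3 (rotmx z1) /\
  att_potential M (Rtilde X Xh *m rotmx z1) + delta <= att_potential M (Rtilde X Xh).
Proof.
move=> [_ mu] [[u Uu ->] min]; have u1 := sphere2_dot Uu.
rewrite rotmx_TT; split; first exact: SO3_Ra.
move: mu min; set Xq := TT _ _ _ => mu min.
have hinf : Upsilon_jump p k Xh y Xq <= inf [set Upsilon_jump p k Xh y Xq | Xq in QQ p k theta U].
  apply: lb_le_inf; first by exists (Upsilon_jump p k Xh y Xq); exists Xq => //; exists u.
  by move=> _ [Y QY <-]; exact: min.
move: mu hinf; rewrite /muQ Upsilon_est // Upsilon_jump_att //.
move: (inf _) => i; lra.
Qed.

End LandmarkGeometry.

(** * Derivatives of the two parts of the Lyapunov function *)

Section LyapunovDerivative.
Context {R : realType}.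

Lemma is_derive_shift_left (W : normedModType R) (f : R -> W) (c s : R) df :
  is_derive (c + s) (1 : R) f df -> is_derive s (1 : R) (fun u => f (c + u)) df.
Proof.
move=> [dfl dfE].
have E : (fun h => h^-1 *: (((fun u => f (c + u)) \o shift s) (h *: (1 : R)) - f (c + s))) =
    (fun h => h^-1 *: ((f \o shift (c + s)) (h *: (1 : R)) - f (c + s))).
  by apply/funext => h /=; rewrite addrCA.
by apply: DeriveDef; rewrite /derivable /derive E.
Qed.

Lemma is_derive_dot m (f g : R -> 'cV[R]_m) s df dg :
  is_derive s (1 : R) f df -> is_derive s (1 : R) g dg ->
  is_derive s (1 : R) (fun u => dot (f u) (g u)) (dot df (g s) + dot (f s) dg).
Proof.
move=> hf hg; have /is_derive_mxP/(_ 0 0) := is_derive_mulmx (is_derive_trmx hf) hg.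
by rewrite mxE.
Qed.

(** Only the antisymmetric part of [M *m T s] pairs with the antisymmetric correction under the
    trace. *)
Lemma att_potential_derive (M : 'M[R]_3) (T : R -> 'M[R]_3) (kR s : R) : M^T = M ->
  is_derive s (1 : R) T (- (kR *: (T s *m antisym (M *m T s)))) ->
  is_derive s (1 : R) (fun u => att_potential M (T u)) (- (kR * att_dissipation M (T s))).
Proof.
move=> sM dT.
have d1 := is_deriveB (is_derive_cst (1%:M : 'M[R]_3) s (1 : R)) dT.
have d2 := is_derive_mxtrace (is_derive_mulmx d1 (is_derive_cst M s (1 : R))).
apply: (is_derive_eq d2).
rewrite mulmx0 addr0 sub0r opprK -scalemxAl mxtraceZ -mulmxA mxtrace_mulC -mulmxA.
rewrite /att_dissipation mulrN opprK; congr (_ * _).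
set S := antisym _.
have -> : M *m T s = S + 2^-1 *: (M *m T s + (M *m T s)^T).
  rewrite /S /antisym; move: (M *m T s) => B.
  by apply/matrixP => i j; rewrite !mxE; field.
rewrite mulmxDr mxtraceD [X in _ + X]mxtrace_skew_sym ?addr0 //; first exact: antisym_tr.
by rewrite linearZ /= linearD /= trmxK addrC.
Qed.

(** The terms in [A] cancel between the two equations. The condition [S *m L *m C = G], met by the
    Kalman gain, turns the correction into twice the form of [- G], of which the source [G] in the
    equation of [Sf] gives back one. *)
Lemma translation_quadform_derive (A S G V : 'M[R]_6) (L : 'M[R]_(6, 3)) (C : 'M[R]_(3, 6))
    (d : 'cV[R]_6) (x : R -> 'cV[R]_6) (Sf : R -> 'M[R]_6) s :
  S^T = S -> V^T = V -> S *m L *m C = G -> Sf s = S ->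
  is_derive s (1 : R) x (A *m x s - L *m C *m x s + d) ->
  is_derive s (1 : R) Sf (- (S *m A) - A^T *m S + G - S *m V *m S) ->
  is_derive s (1 : R) (fun u => quadform (Sf u) (x u))
    (- quadform G (x s) - quadform V (S *m x s) + 2 * dot (S *m x s) d).
Proof.
move=> sS sV SLC SfE dx dS.
apply: (is_derive_eq (is_derive_dot dx (is_derive_mulmx dS dx))).
rewrite SfE; set y := x s.
have h1 : dot y (S *m A *m y) = dot (S *m y) (A *m y) by rewrite -mulmxA dot_mulmxr sS.
have h2 : dot y (A^T *m S *m y) = dot (S *m y) (A *m y).
  by rewrite -mulmxA dot_mulmxr trmxK dotC.
have h3 : dot y (S *m V *m S *m y) = quadform V (S *m y).
  by rewrite /quadform -!mulmxA dot_mulmxr sS mulmxA.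
have h4 : dot y (S *m (L *m C *m y)) = quadform G y.
  by rewrite /quadform -SLC !mulmxA.
have h4' : dot (L *m C *m y) (S *m y) = quadform G y.
  by rewrite dotC -h4 [RHS]dot_mulmxr sS.
have h5 : dot y (S *m d) = dot (S *m y) d by rewrite dot_mulmxr sS.
have h6 : dot y (S *m (A *m y)) = dot (S *m y) (A *m y) by rewrite dot_mulmxr sS.
have -> : dot (A *m y - L *m C *m y + d) (S *m y) =
    dot (S *m y) (A *m y) - quadform G y + dot (S *m y) d.
  by rewrite dotDl dotBl h4' (dotC (A *m y)) (dotC d).
have -> : (- (S *m A) - A^T *m S + G - S *m V *m S) *m y =
    - (S *m A *m y) - A^T *m S *m y + G *m y - S *m V *m S *m y.
  by rewrite !mulmxDl !mulNmx.
have -> : S *m (A *m y - L *m C *m y + d) = S *m (A *m y) - S *m (L *m C *m y) + S *m d.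
  by rewrite mulmxDr mulmxBr.
rewrite !(dotDr, dotNr) h1 h2 h3 h4 h5 h6 -/(quadform G y); ring.
Qed.

(** Orthogonality gives |(I - T) g|^2 = 2 g^T (I - T) g, and the axis form of [T] makes this 4
    (|e|^2 |g|^2 - (e^T g)^2). *)
Lemma disturbance_le (T A : 'M[R]_3) (g : 'cV[R]_3) : SO3 T -> SO3 A ->
  dot (col_mx 0 (A^T *m ((1%:M - T) *m g)) : 'cV[R]_(3 + 3))
    (col_mx 0 (A^T *m ((1%:M - T) *m g))) <= 4 * dot g g * attnorm2 T.
Proof.
move=> ST SA; set d := col_mx _ _.
have -> : dot d d = dot ((1%:M - T) *m g) ((1%:M - T) *m g).
  rewrite /d {1}/dot tr_col_mx mul_row_col trmx0 mul0mx add0r -/(dot _ _).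
  by rewrite dot_mulmxr trmxK mulmxA (SO3_mulV SA) mul1mx.
have -> : dot ((1%:M - T) *m g) ((1%:M - T) *m g) = 2 * quadform (1%:M - T) g.
  rewrite /quadform mulmxBl mul1mx dotBl !dotBr.
  have -> : dot (T *m g) (T *m g) = dot g g by rewrite dot_mulmxr mulmxA (proj1 ST) mul1mx.
  by rewrite (dotC (T *m g)); ring.
have [e [x [TE xx e1]]] := SO3_axis ST.
rewrite (attnorm2_axis TE).
have -> : quadform (1%:M - T) g = 2 * (dot e e * dot g g - dot e g ^+ 2).
  have cr : dot g (crossmx x *m g) = 0.
    rewrite -[dot _ _]/(quadform (crossmx x) g) -mxtrace_outer mxtrace_cross_sym //.
    by rewrite trmx_mul trmxK.
  have eg : dot g (e *m e^T *m g) = dot e g ^+ 2.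
    rewrite -mulmxA [e^T *m g]mx11_scalar -/(dot e g) mul_mx_scalar dotZr (dotC g).
    by rewrite expr2.
  rewrite TE /quadform mulmxBl mul1mx !mulmxDl mul_scalar_mx -scalemxAl.
  by rewrite dotBr !dotDr !dotZr cr eg; ring.
have := sqr_ge0 (dot e g); move: (dot e g ^+ 2) => r; rewrite mulrBr => r0; lra.
Qed.

End LyapunovDerivative.

Section ProductNorm.
Context {R : realType}.

Lemma norm_fst_le (W W' : normedModType R) (x : W * W') : `|x.1| <= `|x|.
Proof. by rewrite prod_normE le_max lexx. Qed.

Lemma norm_snd_le (W W' : normedModType R) (x : W * W') : `|x.2| <= `|x|.
Proof. by rewrite prod_normE le_max lexx orbT. Qed.

(** Carries inequalities from the interior of a slice, where the flow condition is imposed, to its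
    end points. The approximating point is moved towards the middle of the segment, so that it stays
    inside. *)
Lemma closure_itv_le (f : R -> R) (a b B : R) : a < b -> {within `[a, b], continuous f} ->
  (forall t, a < t < b -> f t <= B) -> forall t, a <= t <= b -> f t <= B.
Proof.
move=> ab cf fB t /andP[a_t tb]; apply: (within_le_closed cf).
  by rewrite /= in_itv /= a_t.
move=> d d0; pose e := Num.min (d / 2) ((b - a) / 2).
have e0 : 0 < e by rewrite lt_min !divr_gt0 // subr_gt0.
have ed : e <= d / 2 by rewrite ge_min lexx.
have eb : e <= (b - a) / 2 by rewrite ge_min lexx orbT.
case: (leP t ((a + b) / 2)) => tm.
  exists (t + e / 2); split.
  - by rewrite /= in_itv /=; apply/andP; split; lra.
  - by rewrite opprD addNKr normrN ger0_norm; lra.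
  - by apply: fB; apply/andP; split; lra.
exists (t - e / 2); split.
- by rewrite /= in_itv /=; apply/andP; split; lra.
- by rewrite opprB addrC subrK ger0_norm; lra.
- by apply: fB; apply/andP; split; lra.
Qed.

End ProductNorm.

(** The last inequality of the Lyapunov estimate: [y1] is the potential, [y2] its dissipation, [y3]
    the form of the inverse Riccati matrix S at x, [y4] and [y5] the products of S x with itself and
    with the disturbance, [y6] and [y7] the forms of [V] and of the output Gram matrix, [y8] the
    Young term of the disturbance and [y9] its bound by the attitude norm. *)
Lemma lyap_arith (R : realType) (b kR c v slo r y1 y2 y3 y4 y5 y6 y7 y8 y9 : R) :
  r * (b * y1) <= kR * c / 2 * (b * y1) -> r * y3 <= v * slo / 2 * y3 ->
  v / 2 * (slo * y3) <= v / 2 * y4 -> b * kR * c * y1 <= b * kR * y2 ->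
  y9 <= b * (kR * c / 2) * y1 -> y8 <= y9 -> 2 * y5 <= v / 2 * y4 + y8 ->
  v * y4 <= y6 -> 0 <= y7 ->
  b * - (kR * y2) + (- y7 - y6 + 2 * y5) <= - r * (b * y1 + y3).
Proof. lra. Qed.

Lemma lyap_dist_arith (R : realType) (b lo hi slo shi c1 y1 y2 q d : R) :
  0 <= b -> 0 <= hi -> 0 <= shi -> 0 <= y1 -> 0 <= d -> c1 <= b * lo -> c1 <= slo ->
  lo * y1 <= y2 -> y2 <= hi * y1 -> slo * d <= q -> q <= shi * d ->
  c1 * (y1 + d) <= b * y2 + q /\ b * y2 + q <= (b * hi + shi) * (y1 + d).
Proof.
move=> b0 hi0 shi0 y10 d0 m1 m2 h1 h2 q1 q2.
have p1 := ler_wpM2r y10 m1; have p2 := ler_wpM2r d0 m2.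
have p3 := ler_wpM2l b0 h1; have p4 := ler_wpM2l b0 h2.
have p5 : 0 <= shi * y1 by rewrite mulr_ge0.
have p6 : 0 <= b * hi * d by rewrite !mulr_ge0.
split; lra.
Qed.

(** * The Lyapunov function along hybrid solutions *)

Section ClosedLoop.
Context {R : realType}.
Variables (n : nat) (g : 'cV[R]_3) (p : 'I_n -> 'cV[R]_3) (k : 'I_n -> R).
Variables (omega a : R -> 'cV[R]_3) (theta : R) (U : set 'cV[R]_3) (delta kR : R).
Variables (Q : R -> 'M[R]_3) (V P : R -> 'M[R]_6).
Hypotheses (hk : forall i, 0 < k i) (hkc : kc k != 0) (US : U `<=` sphere2) (hkR : 0 < kR)
  (hQ : unif_pos_def Q) (hP : riccati omega Q V P).
Local Notation M := (MM p k).
Local Notation pot := (att_potential M).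
Variables (lo hi c slo shi v L : R).
Hypotheses (lo0 : 0 < lo) (hi0 : 0 < hi) (c0 : 0 < c)
  (slo0 : 0 < slo) (shi0 : 0 < shi) (v0 : 0 < v).
Hypothesis hatt : forall A, SO3 A ->
  [/\ lo * attnorm2 A <= pot A, pot A <= hi * attnorm2 A & 0 <= attnorm2 A <= 1].
Hypothesis hdecay : forall A, SO3 A ->
  (forall u, U u -> \tr ((Ra theta u - 1%:M) *m (M *m A)) <= delta) ->
  c * pot A <= att_dissipation M A.
Hypothesis hS : forall t, 0 <= t ->
  [/\ P t \in unitmx, (invmx (P t))^T = invmx (P t),
      forall u, slo * dot u u <= quadform (invmx (P t)) u,
      forall u, quadform (invmx (P t)) u <= shi * dot u u &
      forall u, slo * quadform (invmx (P t)) u <= dot (invmx (P t) *m u) (invmx (P t) *m u)].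
Hypothesis hL : forall x y i j, 0 <= x -> x <= y ->
  `|invmx (P y) i j - invmx (P x) i j| <= L * `|y - x|.
Hypotheses (Vsym : forall t, 0 <= t -> (V t)^T = V t)
  (hV : forall t, 0 <= t -> forall u, v * dot u u <= quadform (V t) u).

(* [K] bounds the effect of the gravity disturbance on the translational part; the
   weight [b] lets half of the dissipation of the potential absorb it. *)
Let K := 8 * dot g g / v.
Let b := 2 * K / (lo * (kR * c)) + 1.
(** The rates left after half of each dissipation is spent: that of the potential against the
    disturbance bound, that of the translational part in the Young inequality. *)
Definition lyap_rate : R := Num.min (kR * c / 2) (v * slo / 2).
Definition lyap (z : cl_state) : R :=
  b * pot (rerr z) + quadform (invmx (P (tim z))) (terr z).

Let K_ge0 : 0 <= K.
Proof. by rewrite /K divr_ge0 ?mulr_ge0 ?dot_ge0 // ltW. Qed.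

Let b_gt0 : 0 < b.
Proof.
rewrite /b; apply: ltr_wpDl => //; apply: divr_ge0; first by rewrite mulr_ge0.
by rewrite ltW // !mulr_gt0.
Qed.

Lemma lyap_rate_gt0 : 0 < lyap_rate.
Proof. by rewrite /lyap_rate lt_min !divr_gt0 ?mulr_gt0. Qed.

Let H := closed_loop g p k omega a theta U delta kR Q P.

(** The flow map does not prescribe the derivatives of the error components. They are obtained from
    [error_state], which holds on a neighbourhood of [s], by differentiating the errors as functions
    of the true and estimated states. *)
Lemma flow_derivatives (X : R -> 'M[R]_5) (zeta : R -> cl_state) (s t0 : R) dz :
  true_trajectory g omega a X ->
  (\forall u \near s, flow_set (H X) (zeta u)) ->
  (\forall u \near s, tim (zeta u) = t0 + u) -> 0 < t0 + s ->
  flow_map (H X) (zeta s) dz -> is_derive s (1 : R) zeta dz ->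
  (exists2 d, is_derive s (1 : R) (fun u => pot (rerr (zeta u))) d & d <= 0) /\
  (exists2 d, is_derive s (1 : R) (fun u => lyap (zeta u)) d & d <= - lyap_rate * lyap (zeta s)).
Proof.
move=> [SX [_ dX]] nflow ntim t0s [dest dtim] dzeta.
have tims : tim (zeta s) = t0 + s by exact: nbhs_singleton ntim.
have [[SXh [SRt _]] [rE xE] hFo] := nbhs_singleton nflow.
have SXs : SE23 (X (t0 + s)) by apply: SX; exact: ltW.
rewrite tims in rE xE hFo dest.
have dXc := is_derive_shift_left (dX _ t0s).
have dXh : is_derive s (1 : R) (fun u => est (zeta u))
    (observer_flow g p k omega a kR Q P (t0 + s) (est (zeta s)) (landmark_meas p (X (t0 + s)))).
  by rewrite -dest; exact: is_derive_fst (is_derive_fst (is_derive_fst dzeta)).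
have nR : \forall u \near s, Rtilde (X (t0 + u)) (est (zeta u)) = rerr (zeta u).
  by apply: filterS2 nflow ntim => u [_ [E _] _] tu; rewrite E tu.
have nx : \forall u \near s, xerr p k (X (t0 + u)) (est (zeta u)) = terr (zeta u).
  by apply: filterS2 nflow ntim => u [_ [_ E] _] tu; rewrite E tu.
have dR := near_eq_is_derive nR (rotation_error_derive hkc SXs SXh dXc dXh).
have dx := near_eq_is_derive nx (translation_error_derive hkc SXs SXh dXc dXh).
rewrite -rE in dR; rewrite -xE -rE in dx.
have dpot := att_potential_derive (MM_sym p k) dR.
have [l1 l2 /andP[l3 l4]] := hatt SRt.
have dec : c * pot (rerr (zeta s)) <= att_dissipation M (rerr (zeta s)).
  by apply: hdecay => // u Uu; rewrite rE; exact: (Fo_att hk hkc US SXs SXh hFo).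
have pot0 : 0 <= pot (rerr (zeta s)) by apply: le_trans l1; rewrite mulr_ge0 // ltW.
have diss0 : 0 <= att_dissipation M (rerr (zeta s)).
  by apply: le_trans dec; rewrite mulr_ge0 // ltW.
split.
  by eexists; [exact: dpot|rewrite oppr_le0 mulr_ge0 // ltW].
have [uP sS s1 s2 s3] := hS (ltW t0s).
have dS := is_derive_shift_left (riccati_inv_derive hP t0s uP).
have SLC : invmx (P (t0 + s)) *m LL Q P (t0 + s) *m CC = output_gram Q (t0 + s).
  by rewrite /LL !mulmxA mulVmx // mul1mx.
set d := (col_mx 0 _ : 'cV[R]_(3 + 3)) in dx.
have dW := @translation_quadform_derive _ _ _ _ _ _ _ d (fun u => terr (zeta u))
  (fun u => invmx (P (t0 + u))) s sS (Vsym (ltW t0s)) SLC erefl dx dS.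
set x := terr (zeta s) in dW *.
set S := invmx (P (t0 + s)) in sS s1 s2 s3 SLC dW *.
have nW : \forall u \near s, b * pot (rerr (zeta u)) + quadform (invmx (P (t0 + u))) (terr (zeta u))
   = lyap (zeta u).
  by apply: filterS ntim => u tu; rewrite /lyap tu.
have dV := near_eq_is_derive nW (is_deriveD (is_deriveZ b dpot) dW).
eexists; first exact: dV.
rewrite /lyap tims -/S -/x /GRing.scale /=.
have hd : dot d d <= 4 * dot g g * attnorm2 (rerr (zeta s)).
  by apply: disturbance_le => //; case: (SE23P SXs).
have qG : 0 <= quadform (output_gram Q (t0 + s)) x.
  have [_ [qc qc0 hq]] := hQ.
  rewrite /quadform /output_gram -!mulmxA dot_mulmxr trmxK.
  by apply: le_trans (hq _ (ltW t0s) (CC *m x)); rewrite mulr_ge0 ?dot_ge0 // ltW.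
have hVx := hV (ltW t0s) (S *m x).
have v2 : 0 < v / 2 by rewrite divr_gt0.
have young := dot_young (S *m x) d v2.
have Wx := s3 x.
have sx := s1 x.
have invv : (v / 2)^-1 * (4 * dot g g * attnorm2 (rerr (zeta s))) = K * attnorm2 (rerr (zeta s)).
  by rewrite /K; field; rewrite gt_eqF.
have hd' : (v / 2)^-1 * dot d d <= K * attnorm2 (rerr (zeta s)).
  by rewrite -invv ler_wpM2l // invr_ge0 ltW.
have hK : K * attnorm2 (rerr (zeta s)) <= b * (kR * c / 2) * pot (rerr (zeta s)).
  (* The first summand of [b] pays for the disturbance; the summand 1 keeps [b] positive when
     [g = 0]. *)
  have -> : b * (kR * c / 2) = K / lo + kR * c / 2.
    by rewrite /b; field; rewrite !gt_eqF.
  have e1 : K * attnorm2 (rerr (zeta s)) <= K / lo * pot (rerr (zeta s)).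
    by rewrite -mulrA ler_wpM2l // ler_pdivlMl.
  have e2 : 0 <= kR * c / 2 * pot (rerr (zeta s)).
    by rewrite mulr_ge0 // divr_ge0 // mulr_ge0 // ltW.
  by rewrite mulrDl; apply: (le_trans e1); rewrite lerDl.
have hdiss : b * kR * c * pot (rerr (zeta s)) <= b * kR * att_dissipation M (rerr (zeta s)).
  by rewrite -(mulrA (b * kR)) ler_wpM2l // mulr_ge0 // ltW.
have W0 : 0 <= quadform S x by apply: le_trans sx; rewrite mulr_ge0 ?dot_ge0 // ltW.
have r1 : lyap_rate * (b * pot (rerr (zeta s))) <= kR * c / 2 * (b * pot (rerr (zeta s))).
  by rewrite ler_wpM2r ?ge_min ?lexx // mulr_ge0 // ltW.
have r2 : lyap_rate * quadform S x <= v * slo / 2 * quadform S x.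
  by rewrite ler_wpM2r // ge_min lexx orbT.
have hv : v / 2 * (slo * quadform S x) <= v / 2 * dot (S *m x) (S *m x).
  by rewrite ler_wpM2l // ltW.
exact: (lyap_arith r1 r2 hv hdiss hK hd' young hVx qG).
Qed.

Variables (X : R -> 'M[R]_5) (E : set (R * nat)) (z : R -> nat -> 'M[R]_5 * 'M[R]_3 * 'cV[R]_6 * R).
Hypotheses (hX : true_trajectory g omega a X) (hz : hybrid_solution (H X) E z).

Let hdom : hybrid_time_domain E.
Proof. by case: hz => -[]. Qed.

Lemma slice_convex j s r t : E (s, j) -> E (t, j) -> s <= r <= t -> E (r, j).
Proof.
move=> Es Et /andP[sr rt]; have [_ _ /(_ _ _ Et)[tj [_ _ EE]]] := hdom.
have : (E `&` [set e | e.1 <= t /\ (e.2 <= j)%N]) (s, j).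
  by split => //; split => //=; exact: le_trans rt.
rewrite EE => -[/= _ /andP[h1 _]].
have : (E `&` [set e | e.1 <= t /\ (e.2 <= j)%N]) (t, j) by split => //; split => //=.
rewrite EE => -[/= _ /andP[_ h2]].
suff : (E `&` [set e | e.1 <= t /\ (e.2 <= j)%N]) (r, j) by case.
by rewrite EE; split => //=; rewrite (le_trans h1) //= (le_trans rt).
Qed.

Section Slice.
Variables (j : nat) (s t : R).
Hypotheses (st : s < t) (Es : E (s, j)) (Et : E (t, j)).
Let zeta : R -> cl_state := z ^~ j.

Let slice_ac r r' : s <= r -> r <= r' -> r' <= t -> abs_continuous r r' zeta.
Proof.
move=> sr rr' r't; have [[_ h] _ _ _ _] := hz; apply: h => //.
  by apply: slice_convex Es Et _; rewrite sr (le_trans rr').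
by apply: slice_convex Es Et _; rewrite r't (le_trans sr).
Qed.

Let slice_int r : s < r < t -> (slice E j)° r.
Proof.
move=> /andP[sr rt]; have : r \in `]s, t[ by rewrite in_itv /= sr.
move/near_in_itvoo; apply: filterS => u; rewrite in_itv /= => /andP[su ut].
by apply: slice_convex Es Et _; rewrite !ltW.
Qed.

Let slice_flow r : s < r < t -> flow_set (H X) (zeta r).
Proof. by move=> /slice_int; have [_ _ h _ _] := hz; exact: h. Qed.

Let slice_ae : {ae (@lebesgue_measure R), forall r, s < r < t ->
  exists2 dx, flow_map (H X) (zeta r) dx & is_derive r (1 : R) zeta dx}.
Proof.
have [_ _ _ h _] := hz; apply: ae_imp (h j) => r hr /slice_int; exact: hr.
Qed.

Let tim_ac : abs_continuous s t (fun r => tim (zeta r)).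
Proof.
apply: (abs_continuous_dom (C := 1)) (slice_ac (lexx s) (ltW st) (lexx t))
  (slice_ac (lexx s) (ltW st) (lexx t)) => u v' _ _ _.
rewrite mul1r; apply: le_trans (norm_snd_le (zeta v' - zeta u)) _.
by rewrite lerDl.
Qed.

(** The difference of the time component and [r] has zero derivative almost everywhere; applying
    monotonicity to it and to its opposite, [e = 1] and [e = -1], makes it constant. *)
Lemma slice_tim r : s <= r <= t -> tim (zeta r) = tim (zeta s) + (r - s).
Proof.
move=> /andP[sr rt].
have ac1 : abs_continuous s r (fun r => tim (zeta r)).
  apply: (abs_continuous_dom (C := 1)) (slice_ac (lexx s) sr rt) (slice_ac (lexx s) sr rt).
  move=> u v' _ _ _; rewrite mul1r; apply: le_trans (norm_snd_le (zeta v' - zeta u)) _.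
  by rewrite lerDl.
have key (e : R) : e * (tim (zeta r) - r) <= e * (tim (zeta s) - s).
  apply: (@abs_continuous_nonincr _ (fun r => e * (tim (zeta r) - r)) s r) => //.
    apply: (abs_continuous_dom (C := `|e|)) ac1 (@abs_continuous_id _ s r) => u v' _ _ _.
    rewrite -mulrBr normrM ler_wpM2l //.
    have -> : tim (zeta v') - v' - (tim (zeta u) - u) = tim (zeta v') - tim (zeta u) - (v' - u).
      by ring.
    exact: ler_normB.
  apply: ae_imp slice_ae => u hu /andP[su ur].
  have [|dz [_ dt] dzeta] := hu; first by rewrite su (lt_le_trans ur).
  exists 0 => //; have d1 := is_deriveB (is_derive_snd dzeta) (is_derive_id u (1 : R)).
  by apply: (is_derive_eq (is_deriveZ e d1)); rewrite [dz.2]dt subrr scaler0.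
by have := key 1; have := key (-1); lra.
Qed.

Let tim_s_ge0 : 0 <= tim (zeta s).
Proof.
rewrite -oppr_le0.
apply: (@closure_itv_le _ (fun r => - tim (zeta r)) s t 0 st); last by rewrite lexx ltW.
  apply: (within_continuous_lip (C := 1)) (abs_continuous_within tim_ac) => x y _ _.
  by rewrite mul1r -opprD normrN.
by move=> r /slice_flow[[_ [_ h]] _ _]; rewrite oppr_le0.
Qed.

Lemma slice_tim_ge0 r : s <= r <= t -> 0 <= tim (zeta r).
Proof. by move=> hr; rewrite slice_tim // addr_ge0 // subr_ge0; case/andP: hr. Qed.

Let rerr_lip (f : 'M[R]_3 -> R) (C : R) : (forall A B, `|f A - f B| <= C * `|A - B|) ->
  abs_continuous s t (fun r => f (rerr (zeta r))).
Proof.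
move=> hf; apply: (abs_continuous_dom (C := `|C|)) (slice_ac (lexx s) (ltW st) (lexx t))
  (slice_ac (lexx s) (ltW st) (lexx t)) => u v' _ _ _.
apply: (le_trans (hf _ _)); apply: (@le_trans _ _ (`|C| * `|rerr (zeta v') - rerr (zeta u)|)).
  by rewrite ler_wpM2r // ler_norm.
rewrite ler_wpM2l //; apply: (@le_trans _ _ `|zeta v' - zeta u|); last by rewrite lerDl.
apply: le_trans (norm_fst_le (zeta v' - zeta u)).
apply: le_trans (norm_fst_le (zeta v' - zeta u).1).
exact: (norm_snd_le (zeta v' - zeta u).1.1).
Qed.

Let mxtrace_lip (C D A B : 'M[R]_3) :
  `|\tr ((C - A) *m D) - \tr ((C - B) *m D)| <= (9 * `|D|) * `|A - B|.
Proof.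
have -> : \tr ((C - A) *m D) - \tr ((C - B) *m D) = \tr ((B - A) *m D).
  by rewrite -raddfB /= -mulmxBl; congr (\tr (_ *m _)); rewrite opprB addrC addrA subrK.
apply: (le_trans (mxtrace_le _)).
have := mx_norm_mul (B - A) D; rewrite distrC; lra.
Qed.

Let pot_ac : abs_continuous s t (fun r => pot (rerr (zeta r))).
Proof. by apply: rerr_lip => A B; exact: mxtrace_lip. Qed.

Let attnorm2_ac : abs_continuous s t (fun r => attnorm2 (rerr (zeta r))).
Proof.
apply: (rerr_lip (C := 4^-1 * (9 * `|1%:M : 'M[R]_3|))) => A B; rewrite /attnorm2.
have := mxtrace_lip 1%:M 1%:M A B; rewrite !mulmx1 -mulrBr normrM gtr0_norm //.
by move=> h; rewrite -[leRHS]mulrA ler_wpM2l // invr_ge0.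
Qed.

Lemma slice_att r : s <= r <= t -> [/\ lo * attnorm2 (rerr (zeta r)) <= pot (rerr (zeta r)),
  pot (rerr (zeta r)) <= hi * attnorm2 (rerr (zeta r)) & 0 <= attnorm2 (rerr (zeta r)) <= 1].
Proof.
move=> hr.
(* Each of the four bounds is one linear inequality in the potential and the attitude norm, hence
   passes to the ends of the slice. *)
have lin (e f h : R) : (forall A, SO3 A -> e * pot A + f * attnorm2 A <= h) ->
    e * pot (rerr (zeta r)) + f * attnorm2 (rerr (zeta r)) <= h.
  move=> hA; apply: (@closure_itv_le _ (fun r => e * pot (rerr (zeta r)) +
     f * attnorm2 (rerr (zeta r))) s t h st) hr.
    apply: within_continuousD; apply: within_continuousM;
      try exact: within_continuous_cst; exact: abs_continuous_within.
  by move=> u /slice_flow[[_ [SR _]] _ _]; exact: hA.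
split; last apply/andP; [..|split].
- have := lin (-1) lo 0; rewrite mulN1r addrC subr_le0; apply => A /hatt[h _ _].
  by rewrite mulN1r addrC subr_le0.
- have := lin 1 (- hi) 0; rewrite mul1r mulNr subr_le0; apply => A /hatt[_ h _].
  by rewrite mul1r mulNr subr_le0.
- have := lin 0 (-1) 0; rewrite mul0r add0r mulN1r oppr_le0; apply => A /hatt[_ _ /andP[h _]].
  by rewrite mul0r add0r mulN1r oppr_le0.
- have := lin 0 1 1; rewrite mul0r add0r mul1r; apply => A /hatt[_ _ /andP[_ h]].
  by rewrite mul0r add0r mul1r.
Qed.

Let slice_derivatives : {ae (@lebesgue_measure R), forall r, s < r < t ->
  (exists2 d, is_derive r (1 : R) (fun u => pot (rerr (zeta u))) d & d <= 0) /\
  (exists2 d, is_derive r (1 : R) (fun u => lyap (zeta u)) d & d <= - lyap_rate * lyap (zeta r))}.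
Proof.
apply: ae_imp slice_ae => r hr srt; have [dz fl dzeta] := hr srt.
have /andP[sr rt] := srt.
have nst : \forall u \near r, u \in `]s, t[ by apply: near_in_itvoo; rewrite in_itv /= sr.
apply: (@flow_derivatives X zeta r (tim (zeta s) - s) dz) => //.
- by apply: filterS nst => u; rewrite in_itv /=; exact: slice_flow.
- apply: filterS nst => u; rewrite in_itv /= => /andP[su ut].
  by rewrite slice_tim ?ltW ?ltW //; ring.
- by have := tim_s_ge0; lra.
Qed.

Lemma slice_pot_le : pot (rerr (zeta t)) <= pot (rerr (zeta s)).
Proof.
apply: (abs_continuous_nonincr (ltW st) pot_ac).
by apply: ae_imp slice_derivatives => r hr /hr[].
Qed.

Lemma slice_lyap_le : lyap (zeta t) <= expR (- (lyap_rate * (t - s))) * lyap (zeta s).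
Proof.
have ac := slice_ac (lexx s) (ltW st) (lexx t).
apply: (@abs_continuous_gronwall _ _ _ (fun r => lyap (zeta r))); first exact: ltW.
  apply: abs_continuousD; first by apply: abs_continuousM => //; exact: abs_continuous_cst.
  have terr_ac i : abs_continuous s t (fun r => terr (zeta r) i 0).
    apply: (abs_continuous_dom (C := 1) _ ac ac) => u v' _ _ _; rewrite mul1r.
    apply: (@le_trans _ _ `|zeta v' - zeta u|); last by rewrite lerDl.
    apply: le_trans (norm_fst_le (zeta v' - zeta u)).
    apply: le_trans (norm_snd_le (zeta v' - zeta u).1).
    by have := mx_entry_le (terr (zeta v') - terr (zeta u)) i 0; rewrite !mxE.
  (* Time advances at unit rate in a slice, so the Lipschitz bound in time is one in [r]. *)
  have S_ac i l : abs_continuous s t (fun r => invmx (P (tim (zeta r))) i l).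
    apply: (abs_continuous_lip (C := L)) => u v' su uv vt.
    have hu : tim (zeta u) = tim (zeta s) + (u - s) by apply: slice_tim; rewrite su (le_trans uv).
    have hv' : tim (zeta v') = tim (zeta s) + (v' - s).
      by apply: slice_tim; rewrite vt (le_trans su).
    have -> : `|v' - u| = `|tim (zeta v') - tim (zeta u)|.
      by rewrite hu hv'; congr (`|_|); ring.
    apply: hL; first by apply: slice_tim_ge0; rewrite su (le_trans uv).
    by rewrite hu hv'; lra.
  have E1 : (fun r => quadform (invmx (P (tim (zeta r)))) (terr (zeta r))) =
      fun r => \sum_i terr (zeta r) i 0 * \sum_l invmx (P (tim (zeta r))) i l * terr (zeta r) l 0.
    apply/funext => r; rewrite /quadform dotE; apply: eq_bigr => i _.
    by rewrite mxE.
  rewrite E1; apply: abs_continuous_sum => i; apply: abs_continuousM => //.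
  by apply: abs_continuous_sum => l; apply: abs_continuousM.
by apply: ae_imp slice_derivatives => r hr /hr[].
Qed.

End Slice.

Hypothesis delta0 : 0 < delta.

(** What the estimates use of membership in SO(3) and of nonnegative time, as inequalities: the form
    in which it is carried to the end points of slices. *)
Definition good_state (y : cl_state) : Prop :=
  [/\ lo * attnorm2 (rerr y) <= pot (rerr y), pot (rerr y) <= hi * attnorm2 (rerr y),
     0 <= attnorm2 (rerr y) <= 1 & 0 <= tim y].

Lemma SO3_good_state y : SO3 (rerr y) -> 0 <= tim y -> good_state y.
Proof. by move=> /hatt[? ? ?] ?. Qed.

(** The translational error and the time are unchanged by a jump, so [lyap] drops with the potential
    alone. *)
Lemma jump_step j t : E (t, j) -> E (t, j.+1) ->
  [/\ good_state (z t j), good_state (z t j.+1),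
      pot (rerr (z t j.+1)) + delta <= pot (rerr (z t j)) &
      lyap (z t j.+1) <= lyap (z t j)].
Proof.
move=> Ej Ej1; have [_ _ _ _ /(_ _ _ Ej Ej1)] := hz.
move=> [[[SXh [SR tim0]] [rE xE] hJo] [Xq hXq ->]].
have SXs : SE23 (X (tim (z t j))) by apply: (proj1 hX).
have [SRq drop] := jump_att hkc US SXs SXh hJo hXq.
rewrite -rE in drop; split => //;
  [exact: SO3_good_state|apply: SO3_good_state => //; exact: SO3_mul|].
rewrite /lyap lerD2r ler_wpM2l ?(ltW b_gt0) //.
by apply: le_trans drop; rewrite lerDl ltW.
Qed.

(** Induction on the jump index: the two bounds propagate within a slice from its left end, and
    across each jump, where the potential pays [delta]. *)
Lemma lyap_along t j : E (t, j) ->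
  lyap (z t j) <= expR (- (lyap_rate * t)) * lyap (z 0 0%N) /\
  pot (rerr (z t j)) + j%:R * delta <= pot (rerr (z 0 0%N)).
Proof.
move=> Etj; have [_ t_ge0 /(_ _ _ Etj)[tj [tj0 tjS EE]]] := hdom.
have Ein i r : (i <= j)%N -> tj i <= r <= tj i.+1 -> E (r, i).
  move=> ij hr; suff : (E `&` [set e | e.1 <= t /\ (e.2 <= j)%N]) (r, i) by case.
  by rewrite EE.
have key i : (i <= j)%N -> forall r, tj i <= r <= tj i.+1 ->
    lyap (z r i) <= expR (- (lyap_rate * r)) * lyap (z 0 0%N) /\
    pot (rerr (z r i)) + i%:R * delta <= pot (rerr (z 0 0%N)).
  have flow i' : (i' <= j)%N ->
    lyap (z (tj i') i') <= expR (- (lyap_rate * tj i')) * lyap (z 0 0%N) /\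
    pot (rerr (z (tj i') i')) + i'%:R * delta <= pot (rerr (z 0 0%N)) ->
    forall r, tj i' <= r <= tj i'.+1 ->
    lyap (z r i') <= expR (- (lyap_rate * r)) * lyap (z 0 0%N) /\
    pot (rerr (z r i')) + i'%:R * delta <= pot (rerr (z 0 0%N)).
    move=> ij [IL IP] r /andP[]; rewrite le_eqVlt => /predU1P[<- //|ir] rS.
    have E1 : E (tj i', i') by apply: Ein => //; rewrite lexx tjS.
    have E2 : E (r, i') by apply: Ein => //; rewrite rS ltW.
    have h1 := slice_lyap_le ir E1 E2; have h2 := slice_pot_le ir E1 E2.
    split; last by move: h2 IP; rewrite /=; lra.
    apply: (le_trans h1).
    have -> : expR (- (lyap_rate * r)) =
        expR (- (lyap_rate * (r - tj i'))) * expR (- (lyap_rate * tj i')).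
      by rewrite -expRD; congr expR; ring.
    by rewrite -mulrA ler_wpM2l // expR_ge0.
  elim: i => [|i IH] ij.
    by apply: flow => //; rewrite tj0 mulr0 oppr0 expR0 !mul1r mul0r addr0.
  apply: flow => //.
  have [IL IP] := IH (ltnW ij) (tj i.+1) ltac:(by rewrite lexx tjS // ltnW).
  have E1 : E (tj i.+1, i) by apply: Ein; [exact: ltnW|rewrite lexx tjS // ltnW].
  have E2 : E (tj i.+1, i.+1) by apply: Ein => //; rewrite lexx tjS.
  have [_ _ j1 j2] := jump_step E1 E2.
  split; first exact: le_trans IL.
  by move: j1 IP; rewrite -(natr1 i); lra.
apply: (key j) => //.
have : (E `&` [set e | e.1 <= t /\ (e.2 <= j)%N]) (t, j) by split => //; split => //=.
by rewrite EE => -[].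
Qed.

(* An initial state in the closure of the flow set need not lie in [S2c]: its bounds
   come by continuity from the first slice, or from the jump set. *)
Lemma good_ends t j : E (t, j) -> (0 < j)%N || (0 < t) ->
  good_state (z 0 0%N) /\ good_state (z t j).
Proof.
move=> Etj jt; have [_ t_ge0 /(_ _ _ Etj)[tj [tj0 tjS EE]]] := hdom.
have Ein i r : (i <= j)%N -> tj i <= r <= tj i.+1 -> E (r, i).
  move=> ij hr; suff : (E `&` [set e | e.1 <= t /\ (e.2 <= j)%N]) (r, i) by case.
  by rewrite EE.
have slice_good s u v' i : s < v' -> E (s, i) -> E (v', i) -> s <= u <= v' -> good_state (z u i).
  move=> sv Es Ev hu; have [? ? ?] := slice_att sv Es Ev hu.
  by split => //; exact: slice_tim_ge0 sv Es Ev _ hu.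
have E00 : E (0, 0%N) by apply: Ein => //; rewrite tj0 lexx -{1}tj0 tjS.
have : (E `&` [set e | e.1 <= t /\ (e.2 <= j)%N]) (t, j) by split => //; split => //=.
rewrite EE => -[/= _ /andP[jt1 jt2]].
have Etjj : E (tj j, j) by apply: Ein => //; rewrite lexx tjS.
split.
  case: (posnP j) => j0.
    rewrite j0 ltnn /= in jt; rewrite j0 in Etj.
    by apply: (slice_good 0 0 t 0%N) => //; rewrite lexx ltW.
  have E10 : E (tj 1%N, 0%N) by apply: Ein => //; rewrite lexx tjS.
  have E11 : E (tj 1%N, 1%N) by apply: Ein => //; rewrite lexx tjS.
  have : 0 <= tj 1%N by rewrite -tj0 tjS.
  rewrite le_eqVlt => /predU1P[t10|t10].
    by rewrite -t10 in E11; have [] := jump_step E00 E11.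
  by apply: (slice_good 0 0 (tj 1%N) 0%N) => //; rewrite lexx ltW.
(* Either [t] lies beyond the start of its slice, which then has positive length, or it is a jump
   time reached from the previous slice. *)
move: jt1; rewrite le_eqVlt => /predU1P[tE|tjt]; last first.
  by apply: (slice_good (tj j) t t j) => //; rewrite lexx ltW.
have [j0|j0] := posnP j; first by move: jt; rewrite -tE j0 tj0 ltxx.
have ji : j.-1.+1 = j by rewrite prednK.
have E1 : E (t, j.-1).
  rewrite -tE; apply: Ein; first exact: leq_pred.
  by rewrite ji lexx andbT -{2}ji tjS // leq_pred.
by have := @jump_step j.-1 t E1; rewrite ji => /(_ Etj)[].
Qed.

Let c1 : R := Num.min (b * lo) slo.
Let c2 : R := b * hi + shi.

Let c1_gt0 : 0 < c1.
Proof. by rewrite /c1 lt_min slo0 mulr_gt0. Qed.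

Let c2_gt0 : 0 < c2.
Proof. by rewrite /c2 addr_gt0 // mulr_gt0. Qed.

Lemma lyap_dist (y : cl_state) : good_state y ->
  c1 * dist_A2 y ^+ 2 <= lyap y /\ lyap y <= c2 * dist_A2 y ^+ 2.
Proof.
move=> [h1 h2 /andP[h3 h4] h5].
rewrite /dist_A2 sqr_sqrtr; last by rewrite addr_ge0 // sqr_ge0.
rewrite enorm_sqr /lyap; have [_ _ s1 s2 _] := hS h5.
apply: (lyap_dist_arith (lo := lo) (slo := slo)) => //; try exact: ltW; try exact: dot_ge0.
- by rewrite ge_min lexx.
- by rewrite ge_min lexx orbT.
Qed.

(** The summand 1 covers the initial instant, the root comes from comparing [lyap] with the squared
    distance, and the exponential compensates the decay demanded in [j], as [j] is at most
    [hi / delta]. *)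
Definition uges_gain : R :=
  1 + Num.sqrt (c2 / c1) * expR (lyap_rate / 2 * (hi / delta)).

(** The initial potential is at most [hi], the attitude norm being at most 1, and each jump lowers
    it by at least [delta]. *)
Lemma solution_jumps t j : E (t, j) -> j%:R * delta <= hi.
Proof.
move=> Etj; have [->|j0] := posnP j; first by rewrite mul0r ltW.
have [|[_ h2 /andP[h3 h4] _] [g1 _ /andP[g3 _] _]] := good_ends Etj; first by rewrite j0.
have [_ h] := lyap_along Etj.
have : 0 <= pot (rerr (z t j)) by apply: le_trans g1; rewrite mulr_ge0 // ltW.
have : pot (rerr (z 0 0%N)) <= hi by apply: (le_trans h2); rewrite ler_piMr // ltW.
move: h; lra.
Qed.

Lemma solution_dist t j : E (t, j) -> dist_A2 (z t j) <=
  uges_gain * expR (- (lyap_rate / 2 * (t + j%:R))) * dist_A2 (z 0 0%N).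
Proof.
move=> Etj.
have rate0 := lyap_rate_gt0.
have D0 y : 0 <= @dist_A2 R y by exact: sqrtr_ge0.
have sq0 : 0 <= Num.sqrt (c2 / c1) by exact: sqrtr_ge0.
have gain1 : 1 <= uges_gain by rewrite /uges_gain lerDl mulr_ge0 // expR_ge0.
have [_ t_ge0 _] := hdom; have t0 := t_ge0 _ _ Etj.
(* At the initial instant the estimate holds because the gain is at least 1. *)
have [jt|] := boolP ((0 < j)%N || (0 < t)); last first.
  rewrite negb_or -!leqNgt -leNgt leqn0 => /andP[/eqP j0 t0'].
  have -> : t = 0 by apply/eqP; rewrite eq_le t0' t0.
  by rewrite j0 addr0 mulr0 oppr0 expR0 mulr1 ler_peMl.
have [g0 g1] := good_ends Etj jt.
have [_ u1] := lyap_dist g0; have [l1 _] := lyap_dist g1.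
have [h _] := lyap_along Etj; have hj := solution_jumps Etj.
(* The Lyapunov function is comparable to the square of the distance, hence half of its rate. *)
have step : dist_A2 (z t j) <=
    Num.sqrt (c2 / c1) * expR (- (lyap_rate / 2 * t)) * dist_A2 (z 0 0%N).
  rewrite -(ler_pXn2r (n := 2)) ?nnegrE // ?mulr_ge0 ?expR_ge0 //.
  have c21 : 0 <= c2 / c1 by apply: divr_ge0; exact: ltW.
  rewrite !exprMn (sqr_sqrtr c21).
  have -> : expR (- (lyap_rate / 2 * t)) ^+ 2 = expR (- (lyap_rate * t)).
    by rewrite expr2 -expRD; congr expR; field.
  have -> : c2 / c1 * expR (- (lyap_rate * t)) * dist_A2 (z 0 0%N) ^+ 2 =
    c1^-1 * (expR (- (lyap_rate * t)) * (c2 * dist_A2 (z 0 0%N) ^+ 2)).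
    by field; rewrite gt_eqF.
  rewrite ler_pdivlMl //; apply: (le_trans l1); apply: (le_trans h).
  by rewrite ler_wpM2l // expR_ge0.
apply: (le_trans step); rewrite ler_wpM2r //.
have -> : expR (- (lyap_rate / 2 * t)) =
    expR (lyap_rate / 2 * j%:R) * expR (- (lyap_rate / 2 * (t + j%:R))).
  by rewrite -expRD; congr expR; ring.
rewrite mulrA ler_wpM2r ?expR_ge0 // /uges_gain.
apply: (@le_trans _ _ (Num.sqrt (c2 / c1) * expR (lyap_rate / 2 * (hi / delta)))).
  rewrite ler_wpM2l // ler_expR ler_wpM2l //; first by rewrite divr_ge0 // ltW.
  by rewrite ler_pdivlMr.
by rewrite lerDr.
Qed.

Lemma uges_gain_gt0 : 0 < uges_gain.
Proof. by rewrite /uges_gain ltr_wpDr // mulr_ge0 ?sqrtr_ge0 // expR_ge0. Qed.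

End ClosedLoop.

Theorem theorem2 (R : realType) (n : nat) (hn : (3 <= n)%N)
  (g : 'cV[R]_3) (p : 'I_n -> 'cV[R]_3) (k : 'I_n -> R)
  (hp : exists i j l : 'I_n, ~ collinear (p i) (p j) (p l))
  (hk : forall i, 0 < k i)
  (omega a : R -> 'cV[R]_3)
  (homega : {within `[0, +oo[, continuous omega})
  (ha : {within `[0, +oo[, continuous a})
  (hA : bounded_mx (AA omega))
  (theta : R) (htheta : 0 < theta <= pi)
  (U : set 'cV[R]_3) (hU : admissible_U p k U)
  (delta : R) (hdelta : 0 < delta)
  (hdelta' : delta < (1 - cos theta) * DeltaMstar p k U)
  (kR : R) (hkR : 0 < kR)
  (Q : R -> 'M[R]_3) (hQ : unif_pos_def Q) (hQb : bounded_mx Q)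
  (V : R -> 'M[R]_6) (hV : unif_pos_def V) (hVb : bounded_mx V)
  (P : R -> 'M[R]_6) (hP0 : pos_def (P 0)) (hP : riccati omega Q V P) :
  let solution :=
    closed_loop_solution g p k omega a theta U delta kR Q P in
  (forall E z, solution E z -> finitely_many_jumps E) /\
  uges solution (@dist_A2 R).
Proof.
move=> solution.
have n0 : (0 < n)%N by apply: leq_trans hn.
have hkc : kc k != 0 by rewrite gt_eqF // kc_gt0.
have [w hw] := pos_def_ge (barM_pos_def hk hp).
have [lo [hi [lo0 [hi0 hatt]]]] := att_potential_bounds hw.
have [Ufin US _] := hU.
have c1 : 0 <= 1 - cos theta by rewrite subr_ge0 cos_le1.
have c1' : 0 < 1 - cos theta.
  rewrite lt_neqAle c1 andbT eq_sym; apply/eqP => h.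
  by move: hdelta'; rewrite h mul0r ltNge ltW.
have D0 : 0 < DeltaMstar p k U by rewrite -(pmulr_rgt0 _ c1') (lt_trans hdelta).
(* Half the margin in [hdelta']: the supremum over [U] is approximated, so the level is lowered to
   [DeltaMstar p k U - e], which still exceeds [delta / (1 - cos theta)]. *)
pose e := (DeltaMstar p k U - delta / (1 - cos theta)) / 2.
have e0 : 0 < e by rewrite divr_gt0 // subr_gt0 ltr_pdivrMr // mulrC.
have hD := DeltaMstar_adherent US D0 e0.
have hde : delta < (1 - cos theta) * (DeltaMstar p k U - e).
  rewrite -ltr_pdivrMl //; move: e0; rewrite /e (mulrC _ delta); lra.
have [c c0 hdecay] := att_potential_decay hw hD hde.
have [slo [shi [slo0 [shi0 hS]]]] := riccati_inverse_bounds hA hQ hQb hV hVb hP0 hP.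
have [L hL] := riccati_inverse_lip hA hQ hQb hV hVb hP0 hP.
have [Vs [v v0 hv]] := hV.
split.
  (* A natural number at most [hi / delta] is at most its truncation; the bound is the same for all
     solutions. *)
  move=> E z [X hX hz]; exists (Num.truncn (hi / delta)) => t j Etj.
  have := solution_jumps hk hkc US hkR hQ hP lo0 hi0 c0 slo0 v0 hatt hdecay hS hL Vs hv
    hX hz hdelta Etj.
  by rewrite -ler_pdivlMr // truncn_ge_nat // divr_ge0 // ltW.
exists (uges_gain g delta kR lo hi c slo shi v), (lyap_rate kR c slo v / 2); split.
- exact: uges_gain_gt0.
- by rewrite divr_gt0 // lyap_rate_gt0.
move=> E z [X hX hz] t j Etj.
exact: (solution_dist hk hkc US hkR hQ hP lo0 hi0 c0 slo0 shi0 v0 hatt hdecay hS hL Vs hv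
  hX hz hdelta Etj).
Qed.
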